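(* Let $L(s)$ be an element of the Selberg class, defined for $\Re s>1$ by $\sum_{n\ge1}a_L(n)n^{-s}$. Assume that \[ \sum_{p\le x}|a_L(p)|=\kappa\frac{x}{\log x}+\mathcal{O}\left(\frac{x}{\log^2x}\right) \] for some $\kappa>0$, and let $\theta$ be an arbitrary real number. Then for every sufficiently large $T$ there exist $\sigma>1$ and $t\in[T,2T]$ such that \[ \Re\, e^{-i\theta}\log L(\sigma+it)\ \ge\ \kappa\log\log\log T+\mathcal{O}(1). \] In particular, $|L(1+it)|=\Omega\big((\log\log t)^\kappa\big)$ as $t\to\infty$.
   Context: The Selberg class $\mathcal{S}$ consists of functions $L(s)$ given for $\Re s>1$ by a Dirichlet series $\sum_{n\ge1}a_L(n)n^{-s}$ such that: (i) $a_L(n)\ll_\varepsilon n^\varepsilon$ for every $\varepsilon>0$; (ii) there is an integer $k_0\ge0$ such that $(s-1)^{k_0}L(s)$ is entire of finite order; (iii) $\Lambda(s)=\omega\overline{\Lambda(1-\bar s)}$ where $\Lambda(s)=L(s)Q^s\prod_{j=1}^k\Gamma(\lambda_js+\mu_j)$, $|\omega|=1$, $Q\in\mathbb{R}$, $\lambda_j>0$, $\mu_j\in\mathbb{C}$ with $\Re\mu_j\ge0$; (iv) $L(s)=\prod_p\exp\left(\sum_{j\ge1}b(p^j)p^{-js}\right)$ for $\Re s>1$ with $b(p^j)\ll p^{j\delta}$ for some $\delta<1/2$. For $\Re s>1$, $\log L(s)$ denotes $\sum_p\sum_{j\ge1}b(p^j)p^{-js}$. The implied constant in $\mathcal{O}(1)$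 is independent of $T$. $f(t)=\Omega(g(t))$ means $\limsup_{t\to\infty}|f(t)|/g(t)>0$. *)

(* Defs.v *)
From Stdlib Require Import Reals ZArith Znumtheory.
From Coquelicot Require Import Coquelicot.
Open Scope R_scope.

(** * Complex exponentials, limits, series and products *)

Definition Cexp (z : C) : C :=
  (exp (Re z) * cos (Im z), exp (Re z) * sin (Im z)).

(* [x ^ s] for real [x > 0]. *)
Definition rcpow (x : R) (s : C) : C := Cexp (s * RtoC (ln x))%C.

Definition ncpow (n : nat) (s : C) : C := rcpow (INR n) s.

(* Meaningful only when the limit, resp. the series, converges. *)
Definition CLim_seq (u : nat -> C) : C :=
  (real (Lim_seq (fun n => Re (u n))), real (Lim_seq (fun n => Im (u n)))).

Definition CSeries (u : nat -> C) : C :=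
  (Series (fun n => Re (u n)), Series (fun n => Im (u n))).

(* [f 0 * ... * f (n - 1)]. *)
Fixpoint Cprod (f : nat -> C) (n : nat) : C :=
  match n with
  | O => RtoC 1
  | S m => (Cprod f m * f m)%C
  end.

Definition nprime (n : nat) : Prop := prime (Z.of_nat n).

Definition nprime_dec (n : nat) : {nprime n} + {~ nprime n} :=
  prime_dec (Z.of_nat n).

(** * The Gamma function *)

(* Gauss's formula [lim n! n^s / (s (s+1) ... (s+n))], valid at every complex
   [s] that is not a pole. *)
Definition CGamma (s : C) : C :=
  CLim_seq (fun n =>
    (RtoC (INR (fact n)) * ncpow n s / Cprod (fun j => s + RtoC (INR j)) (S n))%C).

Definition Gamma_pole (s : C) : Prop := exists n : nat, s = RtoC (- INR n).

(** * Entire functions of finite order *)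

Definition entire (F : C -> C) : Prop :=
  forall z : C, @ex_derive C_AbsRing C_NormedModule F z.

Definition finite_order (F : C -> C) : Prop :=
  exists rho r0 : R, forall s : C, r0 <= Cmod s ->
    Cmod (F s) <= exp (Rpower (Cmod s) rho).

(** * The Selberg class *)

(* [\sum_{j >= 1} b(p^j) p^{-js}]. *)
Definition log_Euler_factor (b : nat -> C) (p : nat) (s : C) : C :=
  CSeries (fun i =>
    let j := S i in (b (p ^ j)%nat * ncpow p (- (RtoC (INR j) * s)))%C).

(* [\sum_p \sum_{j >= 1} b(p^j) p^{-js}], the logarithm of [L] on [Re s > 1]. *)
Definition log_L (b : nat -> C) (s : C) : C :=
  CSeries (fun n => if nprime_dec n then log_Euler_factor b n s else RtoC 0).

Definition complete_L (L : C -> C) (Q : R) (k : nat)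
    (lam : nat -> R) (mu : nat -> C) (s : C) : C :=
  (L s * rcpow Q s
     * Cprod (fun j => CGamma (RtoC (lam j) * s + mu j)) k)%C.

Definition dirichlet_series (a : nat -> C) (L : C -> C) : Prop :=
  forall s : C, 1 < Re s ->
    @is_series C_AbsRing C_NormedModule
      (fun i => let n := S i in (a n * ncpow n (- s))%C) (L s).

Definition ramanujan_bound (a : nat -> C) : Prop :=
  forall eps : R, 0 < eps -> exists M : R, forall n : nat, (1 <= n)%nat ->
    Cmod (a n) <= M * Rpower (INR n) eps.

(* [L] is a total function standing for a meromorphic one with a possible pole
   at 1, so [L 1] is left unconstrained. *)
Definition analytic_continuation (L : C -> C) : Prop :=
  exists (k0 : nat) (F : C -> C),
    entire F /\ finite_order F /\
    forall s : C, s <> RtoC 1 -> F s = (Cpow (s - RtoC 1) k0 * L s)%C.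

(* An identity of meromorphic functions, stated wherever no factor on either
   side has a pole. *)
Definition functional_equation (L : C -> C) : Prop :=
  exists (omega : C) (Q : R) (k : nat) (lam : nat -> R) (mu : nat -> C),
    Cmod omega = 1 /\ 0 < Q /\
    (forall j, (j < k)%nat -> 0 < lam j /\ 0 <= Re (mu j)) /\
    forall s : C,
      s <> RtoC 0 -> s <> RtoC 1 ->
      (forall j, (j < k)%nat ->
         ~ Gamma_pole (RtoC (lam j) * s + mu j)%C /\
         ~ Gamma_pole (RtoC (lam j) * (RtoC 1 - Cconj s) + mu j)%C) ->
      complete_L L Q k lam mu s =
        (omega * Cconj (complete_L L Q k lam mu (RtoC 1 - Cconj s)))%C.

Definition euler_product (b : nat -> C) (L : C -> C) : Prop :=
  (forall s : C, 1 < Re s ->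
     filterlim
       (fun N => Cprod (fun n =>
          if nprime_dec n then Cexp (log_Euler_factor b n s) else RtoC 1) N)
       eventually (@locally C_UniformSpace (L s))) /\
  exists delta M : R, delta < 1 / 2 /\
    forall p j : nat, nprime p -> (1 <= j)%nat ->
      Cmod (b (p ^ j)%nat) <= M * Rpower (INR p) (INR j * delta).

(* [a] and [b] are determined by [L] ([b] on prime powers, the only place where
   it is used); they are exposed because [log_L] and the hypothesis on the mean
   value of [|a(p)|] refer to them. *)
Record selberg_class (L : C -> C) (a b : nat -> C) : Prop := {
  selberg_dirichlet : dirichlet_series a L;
  selberg_ramanujan : ramanujan_bound a;
  selberg_continuation : analytic_continuation L;
  selberg_functional : functional_equation L;
  selberg_euler : euler_product b L
}.

(** * Asymptotics *)

(* [\sum_{p <= x} |a(p)|], for [x >= 0]; [Int_part] is the floor. *)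
Definition prime_abs_sum (a : nat -> C) (x : R) : R :=
  sum_f_R0 (fun n => if nprime_dec n then Cmod (a n) else 0)
           (Z.to_nat (Int_part x)).

(* [limsup_{t -> +oo} f t = inf_T sup_{t >= T} f t]. *)
Definition LimSup_infty (f : R -> R) : Rbar :=
  Rbar_glb (fun m => exists T : R,
    m = Lub_Rbar (fun y => exists t : R, T <= t /\ y = f t)).

Definition Omega (f g : R -> R) : Prop :=
  Rbar_lt (Finite 0) (LimSup_infty (fun t => Rabs (f t) / g t)).

(* Main.v *)
Require Import Defs.
From Stdlib Require Import Reals ZArith Znumtheory Lra Lia Psatz List IndefiniteDescription.
From Coquelicot Require Import Coquelicot.
Import ListNotations.
Open Scope R_scope.

(** By the Euler product [b] and [a] agree on primes, and [log L s] differs from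
    [sum_p b(p) p^{-s}] by a bounded amount for [Re s > 1].  With [sigma = 1 + 1 / ln X] the primes
    [p > X] contribute [O(1)], and partial summation gives
    [sum_{p <= X} |b(p)| p^{-sigma} = kappa ln ln X + O(1)].  It remains to align the phases of the
    terms with [p <= X].  Averaging over [T, 2T] against a product of Fejer kernels of degree [X],
    one for each prime, replaces each cosine by [X / (X + 1)]; the off-diagonal frequencies are
    logarithms of rationals of height [exp (O (X^4))], so their contribution is negligible as soon
    as [X] is a small power of [ln T], and then [ln ln X = ln ln ln T + O(1)].

    For the line [Re s = 1], the same estimates give [L s = O((Re s - 1)^{-kappa})].  Suppose
    [L (1 + i t) = o((ln ln t)^kappa)].  The maximum principle on a rectangle of side
    [H = A / ln ln T] resting on the line, applied to [L] times a polynomial of high order of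
    vanishing at the two corners on the line, bounds [L] at the point found above by a constant,
    arbitrarily small for large [A], times [(ln ln T)^kappa]: a contradiction.  Inside the rectangle
    the Dirichlet series converges absolutely, so the maximum principle is only needed for functions
    with an explicit second-order expansion. *)

(** * Partial summation *)

(** [a] and [b] are tied together only through [L], so their equality on primes is read off from
    [L k] at large integers [k]. Sequences expanded in the [n^{-k}] form a ring, and for a prime [p]
    no product of two terms with [n, m < p] yields [p^{-k}].

    Fejer kernels serve because they are nonnegative, so that a mean value produces a point, and
    because the sum of the moduli of their coefficients is only the square of their constant term.
    Degree [X] is what is needed: the relative loss [1 / (X + 1)] meets at most [X + 1]
    coefficients, each bounded.

    Near the line the bound [(Re s - 1)^{-kappa}] blows up along the horizontal sides of the
    rectangle; zeros of order at least [kappa] at the corners compensate for this. The left side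
    lies on the line itself, outside the region of absolute convergence, and continuity up to it
    comes from the entire function [(s - 1)^{k0} L s]. The extra factor varies so little at height
    [t0] that it costs only [2^{k0}]. *)

Lemma ln_le_sub1 (y : R) : 0 < y -> ln y <= y - 1.
Proof.
  intros Hy. pose proof (exp_ineq1_le (ln y)) as H. rewrite exp_ln in H by lra. lra.
Qed.

Lemma ln_succ_upper (x : R) : 0 < x -> ln (x + 1) - ln x <= / x.
Proof.
  intros Hx. rewrite <- ln_div by lra.
  eapply Rle_trans; [apply ln_le_sub1; apply Rdiv_lt_0_compat; lra|].
  right; field; lra.
Qed.

Lemma ln_succ_lower (x : R) : 0 < x -> / (x + 1) <= ln (x + 1) - ln x.
Proof.
  intros Hx. assert (ln (x / (x + 1)) <= x / (x + 1) - 1)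
    by (apply ln_le_sub1; apply Rdiv_lt_0_compat; lra).
  rewrite ln_div in H by lra.
  replace (x / (x + 1) - 1) with (- / (x + 1)) in H by (field; lra). lra.
Qed.

Lemma ln_ge_1 (x : R) : 3 <= x -> 1 <= ln x.
Proof.
  intros Hx. rewrite <- (ln_exp 1). apply ln_le; [apply exp_pos|].
  pose proof exp_le_3; lra.
Qed.

(** Replaces Abel summation: a partial sum is compared with an explicit function by checking single
    increments, [f - g] being nonincreasing from [n0] on. *)
Lemma increments_le (f g : nat -> R) (n0 : nat) :
  (forall n, (n0 <= n)%nat -> f (S n) - f n <= g (S n) - g n) ->
  forall n, (n0 <= n)%nat -> f n - g n <= f n0 - g n0.
Proof.
  intros H n Hn. induction Hn as [|n Hn IH]; [lra|]. specialize (H n Hn). lra.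
Qed.

Lemma INR_ge_3 (n : nat) : (3 <= n)%nat -> 3 <= INR n.
Proof. intros H; apply le_INR in H; simpl in H; lra. Qed.

(** The hypothesis of the theorem at integer points, for an abstract sequence; it is used with
    [prime_abs b]. *)
Definition mean_value (s : nat -> R) (kappa : R) : Prop :=
  exists (M : R) (n0 : nat), forall n, (n0 <= n)%nat ->
    Rabs (sum_f_R0 s n - kappa * (INR n / ln (INR n))) <= M * (INR n / (ln (INR n)) ^ 2).

(** The error term is at most a multiple of the main one once [ln n >= 1], which [3 <= n1] ensures.
    This Chebyshev-type bound controls the boundary terms of all the partial summations. *)
Lemma partial_sum_upper (s : nat -> R) (kappa : R) :
  (forall n, 0 <= s n) -> mean_value s kappa ->
  exists (c : R) (n1 : nat), 0 <= c /\ (3 <= n1)%nat /\ forall n, (n1 <= n)%nat ->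
    0 <= sum_f_R0 s n <= c * (INR n / ln (INR n)).
Proof.
  intros Hs [M [n0 H]]. exists (Rabs kappa + Rabs M), (max 3 n0).
  split; [pose proof (Rabs_pos kappa); pose proof (Rabs_pos M); lra|].
  split; [lia|]. intros n Hn.
  split; [apply cond_pos_sum; auto|].
  assert (Hx : 3 <= INR n) by (apply INR_ge_3; lia).
  assert (Hl : 1 <= ln (INR n)) by (apply ln_ge_1; lra).
  specialize (H n ltac:(lia)). apply Rabs_le_between in H. destruct H as [_ H].
  assert (Hq : 0 < INR n / ln (INR n)) by (apply Rdiv_lt_0_compat; lra).
  assert (INR n / ln (INR n) ^ 2 <= INR n / ln (INR n)).
  { unfold Rdiv. apply Rmult_le_compat_l; [lra|]. apply Rinv_le_contravar; nra. }
  assert (0 <= INR n / ln (INR n) ^ 2).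
  { apply Rlt_le, Rdiv_lt_0_compat; nra. }
  pose proof (Rle_abs kappa). pose proof (Rle_abs M). pose proof (Rabs_pos M). nra.
Qed.

Lemma lnln_succ_bounds (x : R) : 3 <= x ->
  / ((x + 1) * ln (x + 1)) <= ln (ln (x + 1)) - ln (ln x) <= / (x * ln x).
Proof.
  intros Hx. assert (Hl : 1 <= ln x) by (apply ln_ge_1; lra).
  pose proof (ln_succ_upper x ltac:(lra)) as Hu.
  pose proof (ln_succ_lower x ltac:(lra)) as Hlo.
  assert (0 < / (x + 1)) by (apply Rinv_0_lt_compat; lra).
  set (u := ln x) in *. set (v := ln (x + 1)) in *.
  assert (0 < / u) by (apply Rinv_0_lt_compat; lra).
  assert (0 < / v) by (apply Rinv_0_lt_compat; lra).
  split.
  - assert (H' : ln (u / v) <= u / v - 1) by (apply ln_le_sub1, Rdiv_lt_0_compat; lra).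
    rewrite ln_div in H' by lra. rewrite Rinv_mult.
    assert (/ (x + 1) * / v <= (v - u) * / v) by (apply Rmult_le_compat_r; lra).
    assert ((v - u) * / v = 1 - u / v) by (field; lra). lra.
  - assert (H' : ln (v / u) <= v / u - 1) by (apply ln_le_sub1, Rdiv_lt_0_compat; lra).
    rewrite ln_div in H' by lra. rewrite Rinv_mult.
    assert ((v - u) * / u <= / x * / u) by (apply Rmult_le_compat_r; lra).
    assert ((v - u) * / u = v / u - 1) by (field; lra). lra.
Qed.

(** A telescoping majorant for what the error in [mean_value] contributes: the sum stays bounded
    because [1 / ln x] does. The factor 2 pays for [ln (x + 1) <= 2 ln x]. *)
Lemma inv_ln_succ_lower (x : R) : 3 <= x ->
  / ((x + 1) * ln x ^ 2) <= 2 * (/ ln x - / ln (x + 1)).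
Proof.
  intros Hx. assert (Hl : 1 <= ln x) by (apply ln_ge_1; lra).
  pose proof (ln_succ_upper x ltac:(lra)) as Hu.
  pose proof (ln_succ_lower x ltac:(lra)) as Hlo.
  assert (/ x <= 1) by (rewrite <- Rinv_1; apply Rinv_le_contravar; lra).
  assert (0 < / (x + 1)) by (apply Rinv_0_lt_compat; lra).
  set (u := ln x) in *. set (v := ln (x + 1)) in *.
  replace (2 * (/ u - / v)) with (2 * ((v - u) * / (u * v))) by (field; lra).
  rewrite Rinv_mult.
  assert (/ (u ^ 2) <= 2 * / (u * v)).
  { replace (2 * / (u * v)) with (/ (u * (v / 2))) by (field; lra).
    apply Rinv_le_contravar; nra. }
  assert (0 < / (u * v)) by (apply Rinv_0_lt_compat; nra).
  nra.
Qed.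

(** Abel summation in difference form: once the boundary term is removed, the increment involves
    only the partial sums of [s]. *)
Lemma harmonic_increment (s : nat -> R) (n : nat) : (1 <= n)%nat ->
  (sum_f_R0 (fun i => s i / INR i) (S n) - sum_f_R0 s (S n) / INR (S n))
  - (sum_f_R0 (fun i => s i / INR i) n - sum_f_R0 s n / INR n)
  = sum_f_R0 s n / (INR n * (INR n + 1)).
Proof.
  intros Hn. assert (1 <= INR n) by (apply (le_INR 1); lia).
  rewrite !tech5, S_INR. field. lra.
Qed.

(** A Mertens-type estimate: by [harmonic_increment] the increments are close to [kappa / (n ln n)],
    that is, to those of [kappa ln ln n]. *)
Lemma sum_div_estimate (s : nat -> R) (kappa : R) :
  (forall n, 0 <= s n) -> 0 < kappa -> mean_value s kappa ->
  exists (K : R) (n1 : nat), forall n, (n1 <= n)%nat ->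
    Rabs (sum_f_R0 (fun i => s i / INR i) n - kappa * ln (ln (INR n))) <= K.
Proof.
  intros Hs Hk Hm.
  destruct (partial_sum_upper s kappa Hs Hm) as [c [m1 [Hc [Hm1 Hup]]]].
  destruct Hm as [M [n0 Hm]].
  set (n1 := max n0 m1).
  set (D := fun n => sum_f_R0 (fun i => s i / INR i) n - sum_f_R0 s n / INR n).
  assert (HM : 0 <= Rabs M) by apply Rabs_pos.
  assert (Hmm : M <= Rabs M) by apply Rle_abs.
  (* The multiples of [1 / ln n] absorb both the error of [mean_value] and the shift between [x] and
     [x + 1] in [1 / (x ln x)]; being bounded, they end up in the constant. *)
  set (g1 := fun n => kappa * ln (ln (INR n)) - 2 * (Rabs M + kappa) * - / ln (INR n)).
  set (g2 := fun n => kappa * ln (ln (INR n)) + (2 * Rabs M + kappa) * - / ln (INR n)).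
  assert (Hfacts : forall n, (n1 <= n)%nat ->
     g1 (S n) - g1 n <= D (S n) - D n <= g2 (S n) - g2 n).
  { intros n Hn. unfold D. rewrite harmonic_increment by lia. unfold g1, g2. rewrite S_INR.
    assert (Hx : 3 <= INR n) by (apply INR_ge_3; lia).
    assert (Hl : 1 <= ln (INR n)) by (apply ln_ge_1; lra).
    specialize (Hm n ltac:(lia)). apply Rabs_le_between in Hm.
    set (Sn := sum_f_R0 s n) in *.
    pose proof (lnln_succ_bounds (INR n) Hx) as HLL.
    pose proof (inv_ln_succ_lower (INR n) Hx) as HI.
    pose proof (ln_le_sub1 (INR n) ltac:(lra)) as Hln.
    assert (Hv : ln (INR n) < ln (INR n + 1)) by (apply ln_increasing; lra).
    set (x := INR n) in *. set (u := ln x) in *. set (v := ln (x + 1)) in *.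
    set (q := / (x * (x + 1))).
    assert (Hq : 0 < q) by (apply Rinv_0_lt_compat; nra).
    assert (E1 : (x / u) * q = / ((x + 1) * u)) by (unfold q; field; nra).
    assert (E2 : (x / u ^ 2) * q = / ((x + 1) * u ^ 2)) by (unfold q; field; nra).
    assert (E3 : / (x * u) = / ((x + 1) * u) + / (x * (x + 1) * u)) by (field; nra).
    assert (I4 : / (x * (x + 1) * u) <= / ((x + 1) * u ^ 2))
      by (assert (0 <= (x + 1) * u * (x - u)) by (apply Rmult_le_pos; nra);
          apply Rinv_le_contravar; [apply Rmult_lt_0_compat; nra|nra]).
    assert (I5 : / ((x + 1) * u) - / ((x + 1) * v) <= / u - / v).
    { rewrite !Rinv_mult.
      assert (/ v <= / u) by (apply Rinv_le_contravar; lra).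
      assert (/ (x + 1) <= 1) by (rewrite <- Rinv_1; apply Rinv_le_contravar; lra).
      nra. }
    assert (P2 : 0 < / ((x + 1) * u ^ 2)) by (apply Rinv_0_lt_compat; nra).
    change (Sn / (x * (x + 1))) with (Sn * q).
    assert (L1 : Sn * q >= kappa * / ((x + 1) * u) - Rabs M * / ((x + 1) * u ^ 2)) by nra.
    assert (L2 : Sn * q <= kappa * / ((x + 1) * u) + Rabs M * / ((x + 1) * u ^ 2)) by nra.
    split; nra. }
  exists (Rabs (D n1) + Rabs (g1 n1) + Rabs (g2 n1) + 2 * (2 * Rabs M + 2 * kappa) + c), n1.
  intros n Hn.
  pose proof (increments_le g1 D n1 (fun n Hn => proj1 (Hfacts n Hn)) n Hn) as B1.
  pose proof (increments_le D g2 n1 (fun n Hn => proj2 (Hfacts n Hn)) n Hn) as B2.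
  assert (Hx : 3 <= INR n) by (apply INR_ge_3; lia).
  assert (Hl : 1 <= ln (INR n)) by (apply ln_ge_1; lra).
  assert (Hi : 0 < / ln (INR n) <= 1).
  { split; [apply Rinv_0_lt_compat; lra|]. rewrite <- Rinv_1; apply Rinv_le_contravar; lra. }
  destruct (Hup n ltac:(lia)) as [H0 H1].
  assert (H2 : 0 <= sum_f_R0 s n / INR n <= c).
  { split; [apply Rdiv_le_0_compat; lra|]. apply Rle_div_l; [lra|].
    eapply Rle_trans; [exact H1|]. unfold Rdiv.
    assert (0 <= INR n * (1 - / ln (INR n))) by nra. nra. }
  unfold D in B1 at 1, B2 at 1. unfold g1 in B1 at 1; unfold g2 in B2 at 1.
  pose proof (Rle_abs (D n1)); pose proof (Rle_abs (g1 n1)); pose proof (Rle_abs (g2 n1)).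
  pose proof (Rle_abs (- D n1)); pose proof (Rle_abs (- g1 n1)); pose proof (Rle_abs (- g2 n1)).
  rewrite Rabs_Ropp in *.
  apply Rabs_le_between. split; nra.
Qed.

(** Divided by [ln X], this bounds what is lost when [p^{-1 / ln X}] is replaced by 1. *)
Lemma sum_ln_div_upper (s : nat -> R) (kappa : R) :
  (forall n, 0 <= s n) -> mean_value s kappa ->
  exists (K : R) (n1 : nat), forall n, (n1 <= n)%nat ->
    sum_f_R0 (fun i => s i * ln (INR i) / INR i) n <= K * ln (INR n).
Proof.
  intros Hs Hm.
  destruct (partial_sum_upper s kappa Hs Hm) as [c [n1 [Hc [Hn1 Hup]]]].
  set (V := sum_f_R0 (fun i => s i * ln (INR i) / INR i)).
  set (D := fun n => V n - sum_f_R0 s n * ln (INR n) / INR n).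
  set (g := fun n => c * ln (INR n)).
  assert (Hfacts : forall n, (n1 <= n)%nat -> D (S n) - D n <= g (S n) - g n).
  { intros n Hn. unfold D, g, V. rewrite !tech5, S_INR.
    assert (Hx : 3 <= INR n) by (apply INR_ge_3; lia).
    assert (Hl : 1 <= ln (INR n)) by (apply ln_ge_1; lra).
    destruct (Hup n Hn) as [H0 H1].
    set (Sn := sum_f_R0 s n) in *.
    pose proof (ln_succ_lower (INR n) ltac:(lra)) as Hlo.
    assert (Hv : ln (INR n) < ln (INR n + 1)) by (apply ln_increasing; lra).
    set (x := INR n) in *. set (u := ln x) in *. set (v := ln (x + 1)) in *.
    match goal with |- ?l <= _ => replace l with (Sn * (u / x - v / (x + 1))) by (field; lra) end.
    assert (0 < / (x + 1)) by (apply Rinv_0_lt_compat; lra).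
    assert (I1 : u / x - v / (x + 1) <= u * / (x * (x + 1))).
    { replace (u * / (x * (x + 1))) with (u / x - u / (x + 1)) by (field; lra).
      unfold Rdiv; nra. }
    assert (0 < / (x * (x + 1))) by (apply Rinv_0_lt_compat; nra).
    assert (I2 : Sn * (u * / (x * (x + 1))) <= c * / (x + 1)).
    { replace (c * / (x + 1)) with (c * (x / u) * (u * / (x * (x + 1)))) by (field; lra).
      apply Rmult_le_compat_r; nra. }
    nra. }
  exists (Rabs (D n1) + Rabs (g n1) + 2 * c), n1. intros n Hn.
  pose proof (increments_le D g n1 Hfacts n Hn) as B.
  assert (Hx : 3 <= INR n) by (apply INR_ge_3; lia).
  assert (Hl : 1 <= ln (INR n)) by (apply ln_ge_1; lra).
  destruct (Hup n Hn) as [H0 H1].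
  assert (sum_f_R0 s n * ln (INR n) / INR n <= c).
  { apply Rle_div_l; [lra|].
    replace (c * INR n) with (c * (INR n / ln (INR n)) * ln (INR n)) by (field; lra).
    apply Rmult_le_compat_r; lra. }
  unfold D in B at 1; unfold g in B at 1.
  pose proof (Rle_abs (D n1)). pose proof (Rle_abs (- g n1)). rewrite Rabs_Ropp in *.
  pose proof (Rabs_pos (D n1)). pose proof (Rabs_pos (g n1)). nra.
Qed.

Lemma Rpower_succ_lower (x sigma : R) : 0 < x ->
  Rpower x (- sigma) - Rpower (x + 1) (- sigma) <= Rabs sigma * (Rpower x (- sigma) / x).
Proof.
  intros Hx. unfold Rpower.
  replace (- sigma * ln (x + 1)) with (- sigma * ln x + - (sigma * (ln (x + 1) - ln x))) by ring.
  rewrite exp_plus.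
  pose proof (exp_ineq1_le (- (sigma * (ln (x + 1) - ln x)))).
  pose proof (exp_pos (- sigma * ln x)).
  pose proof (ln_succ_upper x Hx).
  assert (0 < ln (x + 1) - ln x) by (assert (ln x < ln (x + 1)) by (apply ln_increasing; lra); lra).
  assert (sigma * (ln (x + 1) - ln x) <= Rabs sigma * / x).
  { pose proof (Rle_abs sigma). pose proof (Rabs_pos sigma). nra. }
  unfold Rdiv. nra.
Qed.

Lemma Rpower_succ_upper (x eta : R) : 1 <= x -> 0 < eta <= 1 ->
  eta * Rpower x (- (1 + eta)) <= 4 * (Rpower x (- eta) - Rpower (x + 1) (- eta)).
Proof.
  intros Hx He. unfold Rpower.
  replace (- eta * ln x) with (- eta * ln (x + 1) + (eta * (ln (x + 1) - ln x))) by ring.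
  rewrite exp_plus.
  pose proof (exp_ineq1_le (eta * (ln (x + 1) - ln x))) as H1.
  pose proof (exp_pos (- eta * ln (x + 1))) as H2.
  pose proof (ln_succ_lower x ltac:(lra)) as H3.
  (* [x + 1 <= 2 x] and [1 + eta <= 2] give the factor [2^2 = 4]. *)
  assert (H4 : exp (- (1 + eta) * ln x) <= 4 * (exp (- eta * ln (x + 1)) * / (x + 1))).
  { assert (Hd : ln (x + 1) <= ln x + ln 2).
    { rewrite <- ln_mult by lra. apply ln_le; lra. }
    assert (Hln2 : 0 < ln 2) by (rewrite <- ln_1; apply ln_increasing; lra).
    assert (H4' : 4 = exp (2 * ln 2)).
    { replace (2 * ln 2) with (ln 2 + ln 2) by ring. rewrite exp_plus, exp_ln; lra. }
    assert (H5 : / (x + 1) = exp (- ln (x + 1))) by (rewrite exp_Ropp, exp_ln; lra).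
    rewrite H4', H5, <- !exp_plus.
    destruct (Rle_lt_or_eq_dec (- (1 + eta) * ln x) (2 * ln 2 + (- eta * ln (x + 1) + - ln (x + 1)))) as [H|H].
    - nra.
    - left; apply exp_increasing; lra.
    - right; rewrite H; reflexivity. }
  set (e := exp (- eta * ln (x + 1))) in *.
  assert (H5 : eta * / (x + 1) <= exp (eta * (ln (x + 1) - ln x)) - 1) by nra.
  assert (H6 : e * (eta * / (x + 1)) <= e * (exp (eta * (ln (x + 1) - ln x)) - 1))
    by (apply Rmult_le_compat_l; lra).
  assert (H7 : eta * exp (- (1 + eta) * ln x) <= eta * (4 * (e * / (x + 1))))
    by (apply Rmult_le_compat_l; lra).
  lra.
Qed.

(** Uniformity in [sigma] and [X] is the point: with [sigma - 1] of order [1 / ln X] the tail is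
    bounded. *)
Lemma tail_sum_upper (s : nat -> R) (kappa : R) :
  (forall n, 0 <= s n) -> mean_value s kappa ->
  exists (K : R) (n1 : nat), (3 <= n1)%nat /\ 0 <= K /\ forall (sigma : R) (X N : nat),
    1 < sigma <= 2 -> (n1 <= X <= N)%nat ->
    sum_f_R0 (fun i => s i * Rpower (INR i) (- sigma)) N
      - sum_f_R0 (fun i => s i * Rpower (INR i) (- sigma)) X
    <= K / ((sigma - 1) * ln (INR X)).
Proof.
  intros Hs Hm.
  destruct (partial_sum_upper s kappa Hs Hm) as [c [n1 [Hc [Hn1 Hup]]]].
  (* 8 comes from the increments ([sigma <= 2] times the 4 of [Rpower_succ_upper]) and 1 from the
     boundary term at [N]. *)
  exists (9 * c), n1. split; [exact Hn1|]. split; [lra|]. intros sigma X N Hsig HXN.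
  set (W := sum_f_R0 (fun i => s i * Rpower (INR i) (- sigma))).
  assert (HxX : 3 <= INR X) by (apply INR_ge_3; lia).
  assert (HlX : 1 <= ln (INR X)) by (apply ln_ge_1; lra).
  set (lX := ln (INR X)) in *.
  set (D := fun n => W n - sum_f_R0 s n * Rpower (INR n) (- sigma)).
  set (k := 8 * c / ((sigma - 1) * lX)).
  set (g := fun n => k * - Rpower (INR n) (- (sigma - 1))).
  assert (Hk : 0 <= k).
  { unfold k. apply Rdiv_le_0_compat; [lra|]. apply Rmult_lt_0_compat; lra. }
  assert (Hln : forall n, (X <= n)%nat -> lX <= ln (INR n)).
  { intros n Hn. apply ln_le; [lra|]. apply le_INR; lia. }
  assert (Hfacts : forall n, (X <= n)%nat -> D (S n) - D n <= g (S n) - g n).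
  { intros n Hn. unfold D, g, W. rewrite !tech5, S_INR.
    assert (Hx : 3 <= INR n) by (apply INR_ge_3; lia).
    specialize (Hln n Hn).
    destruct (Hup n ltac:(lia)) as [H0 H1].
    set (Sn := sum_f_R0 s n) in *.
    pose proof (Rpower_succ_lower (INR n) sigma ltac:(lra)) as P1.
    pose proof (Rpower_succ_upper (INR n) (sigma - 1) ltac:(lra) ltac:(lra)) as P2.
    replace (- (1 + (sigma - 1))) with (- sigma) in P2 by ring.
    rewrite Rabs_pos_eq in P1 by lra.
    match goal with |- ?l <= _ => replace l with (Sn * (Rpower (INR n) (- sigma) - Rpower (INR n + 1) (- sigma))) by ring end.
    assert (HP : 0 < Rpower (INR n) (- sigma)) by apply exp_pos.
    set (x := INR n) in *. set (R1 := Rpower x (- sigma)) in *.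
    assert (I1 : Sn * (sigma * (R1 / x)) <= c * (x / ln x) * (2 * (R1 / x))).
    { assert (0 < R1 / x) by (apply Rdiv_lt_0_compat; lra).
      apply Rmult_le_compat; try lra; nra. }
    assert (I2 : c * (x / ln x) * (2 * (R1 / x)) <= 2 * c / lX * R1).
    { replace (c * (x / ln x) * (2 * (R1 / x))) with (2 * c * R1 * / ln x) by (field; lra).
      replace (2 * c / lX * R1) with (2 * c * R1 * / lX) by (field; lra).
      apply Rmult_le_compat_l; [nra|]. apply Rinv_le_contravar; lra. }
    assert (I3 : 2 * c / lX * R1 <= k * (Rpower x (- (sigma - 1)) - Rpower (x + 1) (- (sigma - 1)))).
    { replace (2 * c / lX * R1) with (k / 4 * ((sigma - 1) * R1)) by (unfold k; field; lra).
      nra. }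
    nra. }
  pose proof (increments_le D g X Hfacts N ltac:(lia)) as B.
  assert (HxN : INR X <= INR N) by (apply le_INR; lia).
  destruct (Hup N ltac:(lia)) as [H0 H1].
  destruct (Hup X ltac:(lia)) as [H2 _].
  specialize (Hln N ltac:(lia)).
  assert (Hle1 : forall n e, (X <= n)%nat -> 0 < e -> Rpower (INR n) (- e) <= 1).
  { intros n e Hn He. unfold Rpower. rewrite <- exp_0.
    assert (INR X <= INR n) by (apply le_INR; lia).
    assert (1 <= ln (INR n)) by (apply ln_ge_1; lra).
    left; apply exp_increasing. nra. }
  assert (E1 : sum_f_R0 s N * Rpower (INR N) (- sigma) <= c / ((sigma - 1) * lX)).
  { assert (Rpower (INR N) (- sigma) = Rpower (INR N) (- (sigma - 1)) / INR N).
    { replace (- sigma) with (- (sigma - 1) + - (1)) by ring. rewrite Rpower_plus, (Rpower_Ropp _ 1), Rpower_1; [reflexivity|lra]. }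
    rewrite H.
    pose proof (Hle1 N (sigma - 1) ltac:(lia) ltac:(lra)) as Hl1.
    assert (0 < Rpower (INR N) (- (sigma - 1))) by apply exp_pos.
    set (r := Rpower (INR N) (- (sigma - 1))) in *.
    apply Rle_trans with (c * (INR N / ln (INR N)) * (1 / INR N)).
    - apply Rmult_le_compat; try lra. apply Rdiv_le_0_compat; lra.
      apply Rmult_le_compat_r; [|lra]. left; apply Rinv_0_lt_compat; lra.
    - replace (c * (INR N / ln (INR N)) * (1 / INR N)) with (c * / ln (INR N)) by (field; lra).
      apply Rmult_le_compat_l; [lra|]. apply Rinv_le_contravar; nra. }
  unfold D, g in B.
  pose proof (Hle1 X (sigma - 1) ltac:(lia) ltac:(lra)).
  assert (0 < Rpower (INR N) (- (sigma - 1))) by apply exp_pos.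
  assert (0 < Rpower (INR X) (- sigma)) by apply exp_pos.
  replace (9 * c / ((sigma - 1) * lX)) with (c / ((sigma - 1) * lX) + k) by (unfold k; field; lra).
  assert (0 <= sum_f_R0 s X * Rpower (INR X) (- sigma)) by (apply Rmult_le_pos; lra).
  nra.
Qed.

(** * Convergence of nonnegative series *)

Lemma ex_series_nonneg_bounded (u : nat -> R) (B : R) :
  (forall n, 0 <= u n) -> (forall n, sum_f_R0 u n <= B) -> ex_series u.
Proof.
  intros Hu HB.
  destruct (ex_finite_lim_seq_incr (sum_n u) B) as [l Hl].
  - intros n. rewrite sum_Sn. unfold plus; simpl. specialize (Hu (S n)). lra.
  - intros n. rewrite sum_n_Reals. apply HB.
  - exists l. exact Hl.
Qed.

Lemma ex_series_Rabs_le (u v : nat -> R) :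
  (forall n, Rabs (u n) <= v n) -> ex_series v -> ex_series u.
Proof. apply (@ex_series_le R_AbsRing R_CompleteNormedModule). Qed.

Lemma ex_series_Rpower (eta : R) : 0 < eta ->
  ex_series (fun n => Rpower (INR (S n)) (- (1 + eta))).
Proof.
  (* [Rpower_succ_upper] asks for an exponent at most 1; larger ones follow by comparison. *)
  assert (Hsmall : forall e, 0 < e <= 1 -> ex_series (fun n => Rpower (INR (S n)) (- (1 + e)))).
  { intros e He.
    apply ex_series_nonneg_bounded with (4 / e + 1); [intros; left; apply exp_pos|].
    set (f := sum_f_R0 (fun n => Rpower (INR (S n)) (- (1 + e)))).
    set (g := fun n => (4 / e) * - Rpower (INR (S n)) (- e)).
    intros n.
    assert (B : f n - g n <= f 0%nat - g 0%nat).
    { apply increments_le; [|lia]. intros m _. unfold f, g. rewrite tech5.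
      assert (1 <= INR (S m)) by (apply (le_INR 1); lia).
      pose proof (Rpower_succ_upper (INR (S m)) e ltac:(lra) He) as P.
      rewrite !(S_INR (S m)).
      assert (Rpower (INR (S m) + 1) (- (1 + e)) <= Rpower (INR (S m)) (- (1 + e))).
      { unfold Rpower. assert (ln (INR (S m)) < ln (INR (S m) + 1)) by (apply ln_increasing; lra).
        left; apply exp_increasing. nra. }
      apply Rle_trans with (Rpower (INR (S m)) (- (1 + e))); [lra|].
      apply Rmult_le_reg_l with e; [lra|].
      replace (e * (4 / e * - Rpower (INR (S m) + 1) (- e) - 4 / e * - Rpower (INR (S m)) (- e)))
        with (4 * (Rpower (INR (S m)) (- e) - Rpower (INR (S m) + 1) (- e))) by (field; lra).
      exact P. }
    unfold f at 2, g in B. unfold sum_f_R0 in B.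
    assert (Hone : forall y, Rpower (INR 1) y = 1).
    { intros y. unfold Rpower. simpl. rewrite ln_1, Rmult_0_r. apply exp_0. }
    rewrite !Hone in B.
    assert (0 < Rpower (INR (S n)) (- e)) by apply exp_pos.
    assert (0 < 4 / e) by (apply Rdiv_lt_0_compat; lra). nra. }
  intros He. destruct (Rle_dec eta 1) as [H|H]; [apply Hsmall; lra|].
  apply (ex_series_Rabs_le _ (fun n => Rpower (INR (S n)) (- (1 + 1)))); [|apply Hsmall; lra].
  intros n.
  rewrite Rabs_pos_eq by (left; apply exp_pos).
  unfold Rpower. assert (1 <= INR (S n)) by (apply (le_INR 1); lia).
  assert (0 <= ln (INR (S n))) by (rewrite <- ln_1; apply ln_le; lra).
  destruct (Rle_lt_or_eq_dec (- (1 + eta) * ln (INR (S n))) (- (1 + 1) * ln (INR (S n)))) as [Hlt|Heq].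
  - nra.
  - left; apply exp_increasing; lra.
  - right; rewrite Heq; reflexivity.
Qed.

(** * Continuous functions and their integrals *)

Definition cont (f : R -> R) : Prop := forall x, continuous f x.

Lemma cont_plus (f g : R -> R) : cont f -> cont g -> cont (fun x => f x + g x).
Proof. intros Hf Hg x. apply (continuous_plus f g); auto. Qed.

Lemma cont_mult (f g : R -> R) : cont f -> cont g -> cont (fun x => f x * g x).
Proof. intros Hf Hg x. apply (continuous_mult f g); auto. Qed.

Lemma cont_const (c : R) : cont (fun _ => c).
Proof. intros x. apply continuous_const. Qed.

Lemma cont_cos_affine (w f : R) : cont (fun t => cos (w * t + f)).
Proof. intros x. apply (ex_derive_continuous (fun t => cos (w * t + f))). auto_derive. trivial. Qed.

Lemma cont_ext (f g : R -> R) : (forall x, f x = g x) -> cont f -> cont g.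
Proof. intros H Hf x. apply (continuous_ext f g); auto. Qed.

Lemma ex_RInt_cont (f : R -> R) (u v : R) : cont f -> ex_RInt f u v.
Proof. intros Hf. apply (ex_RInt_continuous f). intros; apply Hf. Qed.

Lemma RInt_cont_plus (f g : R -> R) (u v : R) : cont f -> cont g ->
  RInt (fun x => f x + g x) u v = RInt f u v + RInt g u v.
Proof. intros Hf Hg. apply (RInt_plus f g); apply ex_RInt_cont; auto. Qed.

Lemma RInt_cont_scal (f : R -> R) (c u v : R) : cont f ->
  RInt (fun x => c * f x) u v = c * RInt f u v.
Proof. intros Hf. apply (RInt_scal f); apply ex_RInt_cont; auto. Qed.

Lemma RInt_eq (f g : R -> R) (u v : R) : (forall x, f x = g x) -> RInt f u v = RInt g u v.
Proof. intros H. apply RInt_ext. intros; apply H. Qed.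

(** * Products of trigonometric polynomials *)

(* A list of pairs [(c, j)] stands for the sum of the [c cos (j y)]. *)
Fixpoint trig (ts : list (R * nat)) (y : R) : R :=
  match ts with
  | [] => 0
  | (c, j) :: ts => c * cos (INR j * y) + trig ts y
  end.

(** The mean value of [trig ts]. An index may occur several times in the list, so all entries with
    [j = 0] count. *)
Fixpoint trig_const (ts : list (R * nat)) : R :=
  match ts with
  | [] => 0
  | (c, j) :: ts => (if Nat.eqb j 0 then c else 0) + trig_const ts
  end.

Fixpoint trig_norm (ts : list (R * nat)) : R :=
  match ts with
  | [] => 0
  | (c, j) :: ts => Rabs c + trig_norm ts
  end.

Fixpoint lprod {A : Type} (f : A -> R) (l : list A) : R :=
  match l with
  | [] => 1
  | x :: l => f x * lprod f l
  end.

Fixpoint lsum {A : Type} (f : A -> R) (l : list A) : R :=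
  match l with
  | [] => 0
  | x :: l => f x + lsum f l
  end.

Definition trig_prod (lam beta : nat -> R) (ts : nat -> list (R * nat)) (l : list nat) (t : R) : R :=
  lprod (fun p => trig (ts p) (lam p * t - beta p)) l.

Lemma cont_trig (ts : list (R * nat)) (lam beta : R) : cont (fun t => trig ts (lam * t - beta)).
Proof.
  induction ts as [|[c j] ts IH]; simpl; [apply cont_const|].
  apply cont_plus; [|exact IH]. apply cont_mult; [apply cont_const|].
  apply (cont_ext (fun t => cos ((INR j * lam) * t + - (INR j * beta)))); [|apply cont_cos_affine].
  intros x. f_equal. ring.
Qed.

Lemma cont_trig_prod lam beta ts l : cont (trig_prod lam beta ts l).
Proof.
  unfold trig_prod. induction l as [|p l IH]; simpl; [apply cont_const|].
  apply cont_mult; [apply cont_trig|exact IH].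
Qed.

Lemma lprod_nonneg {A : Type} (f : A -> R) l : (forall x, 0 <= f x) -> 0 <= lprod f l.
Proof. intros H. induction l; simpl; [lra|]. apply Rmult_le_pos; auto. Qed.

Lemma RInt_cos_bound (w f delta u v : R) : 0 < delta -> delta <= Rabs w ->
  Rabs (RInt (fun t => cos (w * t + f)) u v) <= 2 / delta.
Proof.
  intros Hd Hw.
  assert (w <> 0) by (intros ->; rewrite Rabs_R0 in Hw; lra).
  assert (HI : is_RInt (fun t => cos (w * t + f)) u v (sin (w * v + f) / w - sin (w * u + f) / w)).
  { apply (is_RInt_derive (fun t => sin (w * t + f) / w) (fun t => cos (w * t + f))).
    - intros x _. auto_derive; [trivial|]. field; auto.
    - intros x _. apply cont_cos_affine. }
  rewrite (is_RInt_unique _ _ _ _ HI).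
  replace (sin (w * v + f) / w - sin (w * u + f) / w) with ((sin (w * v + f) - sin (w * u + f)) / w)
    by (field; auto).
  unfold Rdiv at 1. rewrite Rabs_mult, Rabs_inv.
  pose proof (SIN_bound (w * v + f)). pose proof (SIN_bound (w * u + f)).
  apply Rmult_le_compat; [apply Rabs_pos| |apply Rabs_le; lra|].
  - left. apply Rinv_0_lt_compat; lra.
  - apply Rinv_le_contravar; lra.
Qed.

(* All the frequencies [w + sum_p (+-j_p) lam_p] with [j_p <= m] are at least [delta] in modulus. *)
Fixpoint separated (lam : nat -> R) (m : nat) (delta : R) (l : list nat) (w : R) : Prop :=
  match l with
  | [] => delta <= Rabs w
  | p :: l => forall j, (j <= m)%nat ->
      separated lam m delta l (w + INR j * lam p) /\ separated lam m delta l (w - INR j * lam p)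
  end.

(** Expanding one factor at a time by the product-to-sum formula keeps the shape of a cosine times a
    product, with new frequencies [w + j lam p] and [w - j lam p]; the phase [f] is arbitrary so
    that the induction closes. Each term splits into two halves, hence only [|c|] is paid. *)
Lemma off_diagonal_bound lam beta ts m delta u v :
  0 < delta -> (forall p c j, In (c, j) (ts p) -> (j <= m)%nat) ->
  forall l w f, separated lam m delta l w ->
  Rabs (RInt (fun t => cos (w * t + f) * trig_prod lam beta ts l t) u v)
    <= 2 / delta * lprod (fun p => trig_norm (ts p)) l.
Proof.
  intros Hd Hm l. induction l as [|p l IH]; intros w f Hsep.
  - unfold trig_prod; simpl. rewrite Rmult_1_r.
    rewrite (RInt_eq _ (fun t => cos (w * t + f))) by (intros; ring).
    apply RInt_cos_bound; assumption.
  - change (trig_prod lam beta ts (p :: l)) with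
      (fun t => trig (ts p) (lam p * t - beta p) * trig_prod lam beta ts l t).
    simpl lprod. simpl in Hsep. specialize (Hm p).
    set (W := trig_prod lam beta ts l) in *.
    set (B := lprod (fun p => trig_norm (ts p)) l) in *.
    revert Hm. induction (ts p) as [|[c j] q IHq]; intros Hm.
    + simpl. rewrite (RInt_eq _ (fun _ => 0)) by (intros; ring).
      rewrite RInt_const. unfold scal; simpl; unfold mult; simpl.
      rewrite Rmult_0_r, Rabs_R0. lra.
    + assert (Hj : (j <= m)%nat) by (apply (Hm c j); left; reflexivity).
      destruct (Hsep j Hj) as [S1 S2].
      assert (Hq : forall c j, In (c, j) q -> (j <= m)%nat) by (intros; eapply Hm; right; eauto).
      specialize (IHq Hq).
      pose proof (IH _ (f - INR j * beta p) S1) as I1.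
      pose proof (IH _ (f + INR j * beta p) S2) as I2.
      rewrite (RInt_eq _ (fun t =>
        c / 2 * (cos ((w + INR j * lam p) * t + (f - INR j * beta p)) * W t
          + cos ((w - INR j * lam p) * t + (f + INR j * beta p)) * W t)
        + cos (w * t + f) * (trig q (lam p * t - beta p) * W t))).
      2:{ intros t. simpl.
          replace ((w + INR j * lam p) * t + (f - INR j * beta p))
            with ((w * t + f) + INR j * (lam p * t - beta p)) by ring.
          replace ((w - INR j * lam p) * t + (f + INR j * beta p))
            with ((w * t + f) - INR j * (lam p * t - beta p)) by ring.
          set (x := w * t + f). set (y := INR j * (lam p * t - beta p)).
          rewrite (cos_plus x y), (cos_minus x y). field. }
      assert (CW : cont W) by apply cont_trig_prod.
      assert (forall w f, cont (fun t => cos (w * t + f) * W t))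
        by (intros; apply cont_mult; [apply cont_cos_affine|exact CW]).
      rewrite RInt_cont_plus.
      * rewrite RInt_cont_scal by (apply cont_plus; auto).
        rewrite RInt_cont_plus by auto.
        eapply Rle_trans; [apply Rabs_triang|]. rewrite Rabs_mult.
        simpl trig_norm.
        eapply Rle_trans; [apply Rplus_le_compat; [|exact IHq]|].
        -- apply Rmult_le_compat_l; [apply Rabs_pos|].
           eapply Rle_trans; [apply Rabs_triang|]. apply Rplus_le_compat; [exact I1|exact I2].
        -- unfold Rdiv at 1. rewrite Rabs_mult, (Rabs_pos_eq (/ 2)) by lra. right. field. lra.
      * apply cont_mult; [apply cont_const|]. apply cont_plus; auto.
      * apply cont_mult; [apply cont_cos_affine|]. apply cont_mult; [apply cont_trig|exact CW].
Qed.

(** A nonzero frequency has a first nonzero index along the list. It may be taken positive since the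
    cosine is even, and the indices after it are arbitrary: hence the call to [separated]. *)
Fixpoint independent (lam : nat -> R) (m : nat) (delta : R) (l : list nat) : Prop :=
  match l with
  | [] => True
  | p :: l => independent lam m delta l /\
      forall j, (1 <= j <= m)%nat -> separated lam m delta l (INR j * lam p)
  end.

(** The entries [j = 0] of the head factor pass to the induction hypothesis and build up the
    constant terms; all others are off-diagonal by [independent]. *)
Lemma trig_prod_mean lam beta ts m delta u v :
  0 < delta -> u <= v -> (forall p c j, In (c, j) (ts p) -> (j <= m)%nat) ->
  forall l, independent lam m delta l ->
  Rabs (RInt (trig_prod lam beta ts l) u v - (v - u) * lprod (fun p => trig_const (ts p)) l)
    <= 2 / delta * lprod (fun p => trig_norm (ts p)) l.
Proof.
  intros Hd Huv Hm l. induction l as [|p l IH]; intros Hind.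
  - unfold trig_prod; simpl. rewrite RInt_const. unfold scal; simpl; unfold mult; simpl.
    match goal with |- Rabs ?x <= _ => replace x with 0 by ring end.
    rewrite Rabs_R0, Rmult_1_r. left; apply Rdiv_lt_0_compat; lra.
  - destruct Hind as [Hind Hsep]. specialize (IH Hind).
    change (trig_prod lam beta ts (p :: l)) with
      (fun t => trig (ts p) (lam p * t - beta p) * trig_prod lam beta ts l t).
    simpl lprod.
    assert (Hoff : forall w f, separated lam m delta l w ->
      Rabs (RInt (fun t => cos (w * t + f) * trig_prod lam beta ts l t) u v)
      <= 2 / delta * lprod (fun p => trig_norm (ts p)) l)
      by (intros; eapply off_diagonal_bound; eauto).
    specialize (Hm p).
    assert (CW : cont (trig_prod lam beta ts l)) by apply cont_trig_prod.
    set (W := trig_prod lam beta ts l) in *.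
    set (B := lprod (fun p => trig_norm (ts p)) l) in *.
    set (C0 := lprod (fun p => trig_const (ts p)) l) in *.
    revert Hm. induction (ts p) as [|[c j] q IHq]; intros Hm.
    + simpl. rewrite (RInt_eq _ (fun _ => 0)) by (intros; ring).
      rewrite RInt_const. unfold scal; simpl; unfold mult; simpl.
      match goal with |- Rabs ?x <= _ => replace x with 0 by ring end.
      rewrite Rabs_R0. lra.
    + assert (Hj : (j <= m)%nat) by (apply (Hm c j); left; reflexivity).
      assert (Hq : forall c j, In (c, j) q -> (j <= m)%nat) by (intros; eapply Hm; right; eauto).
      specialize (IHq Hq).
      rewrite (RInt_eq _ (fun t =>
        c * (cos ((INR j * lam p) * t + - (INR j * beta p)) * W t)
        + trig q (lam p * t - beta p) * W t)).
      2:{ intros t. simpl.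
          replace (INR j * lam p * t + - (INR j * beta p))
            with (INR j * (lam p * t - beta p)) by ring. ring. }
      assert (HC : forall w f, cont (fun t => cos (w * t + f) * W t))
        by (intros; apply cont_mult; [apply cont_cos_affine|exact CW]).
      rewrite RInt_cont_plus.
      * rewrite RInt_cont_scal by auto.
        simpl trig_const; simpl trig_norm.
        set (Iq := RInt (fun t => trig q (lam p * t - beta p) * W t) u v) in *.
        set (Ic := RInt (fun t => cos (INR j * lam p * t + - (INR j * beta p)) * W t) u v).
        match goal with |- Rabs ?x <= _ => replace x with
          (c * (Ic - (v - u) * ((if Nat.eqb j 0 then 1 else 0) * C0))
           + (Iq - (v - u) * (trig_const q * C0)))
          by (destruct (Nat.eqb j 0); ring) end.
        eapply Rle_trans; [apply Rabs_triang|]. rewrite Rabs_mult.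
        replace (2 / delta * ((Rabs c + trig_norm q) * B))
          with (Rabs c * (2 / delta * B) + 2 / delta * (trig_norm q * B)) by ring.
        apply Rplus_le_compat; [|exact IHq].
        apply Rmult_le_compat_l; [apply Rabs_pos|].
        destruct (Nat.eqb_spec j 0) as [->|Hj0].
        -- replace Ic with (RInt W u v); [rewrite Rmult_1_l; exact IH|].
           apply RInt_eq. intros x. simpl INR.
           replace (0 * lam p * x + - (0 * beta p)) with 0 by ring. rewrite cos_0. ring.
        -- rewrite Rmult_0_l, Rmult_0_r, Rminus_0_r. apply Hoff, Hsep. lia.
      * apply cont_mult; [apply cont_const|auto].
      * apply cont_mult; [apply cont_trig|exact CW].
Qed.

(** * Linear independence of the logarithms of primes *)

(** Distinct integers differ by at least 1. The product [u v], cruder than the maximum, is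
    multiplicative and so survives the induction over the primes. *)
Lemma ln_diff_lower (u v : nat) : (1 <= u)%nat -> (1 <= v)%nat -> u <> v ->
  / (INR u * INR v) <= Rabs (ln (INR u) - ln (INR v)).
Proof.
  assert (H : forall u v, (1 <= u)%nat -> (u < v)%nat ->
    / (INR u * INR v) <= ln (INR v) - ln (INR u)).
  { intros x y Hx Hxy. assert (1 <= INR x) by (apply (le_INR 1); lia).
    assert (INR x + 1 <= INR y) by (rewrite <- S_INR; apply le_INR; lia).
    pose proof (ln_le_sub1 (INR x / INR y) ltac:(apply Rdiv_lt_0_compat; lra)) as Hl.
    rewrite ln_div in Hl by lra.
    assert (INR x / INR y - 1 <= - / INR y).
    { replace (INR x / INR y - 1) with (- (INR y - INR x) * / INR y) by (field; lra).
      assert (0 < / INR y) by (apply Rinv_0_lt_compat; lra). nra. }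
    assert (/ (INR x * INR y) <= / INR y) by (apply Rinv_le_contravar; nra). lra. }
  intros Hu Hv Huv.
  destruct (Nat.lt_total u v) as [Hlt|[Heq|Hlt]]; [| contradiction |].
  - rewrite Rabs_minus_sym. eapply Rle_trans; [|apply Rle_abs]. apply H; lia.
  - eapply Rle_trans; [|apply Rle_abs]. rewrite Rmult_comm. apply H; lia.
Qed.

Lemma nprime_ge_2 (p : nat) : nprime p -> (2 <= p)%nat.
Proof. intros H. destruct H as [H _]. lia. Qed.

Lemma nprime_divide_mul (p x y : nat) : nprime p ->
  Nat.divide p (x * y) -> Nat.divide p x \/ Nat.divide p y.
Proof.
  intros Hp [k Hk].
  assert (Z.divide (Z.of_nat p) (Z.of_nat x * Z.of_nat y)) by (exists (Z.of_nat k); lia).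
  apply prime_mult in H; [|exact Hp].
  assert (Hz : forall z, Z.divide (Z.of_nat p) (Z.of_nat z) -> Nat.divide p z).
  { intros z [q Hq]. pose proof (nprime_ge_2 p Hp). exists (Z.to_nat q).
    assert (0 <= q)%Z by nia. apply Nat2Z.inj. rewrite Nat2Z.inj_mul, Z2Nat.id by lia. exact Hq. }
  destruct H; [left|right]; auto.
Qed.

Lemma nprime_divide_pow (p q j : nat) : nprime p -> nprime q -> Nat.divide p (q ^ j) -> p = q.
Proof.
  intros Hp Hq. pose proof (nprime_ge_2 p Hp). induction j as [|j IH]; simpl; intros Hd.
  - apply Nat.divide_1_r in Hd. lia.
  - apply nprime_divide_mul in Hd; [|exact Hp]. destruct Hd as [[k Hk]|Hd]; [|auto].
    assert (Z.divide (Z.of_nat p) (Z.of_nat q)) by (exists (Z.of_nat k); lia).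
    apply prime_div_prime in H0; [lia|exact Hp|exact Hq].
Qed.

(** Frequencies are carried as [ln u - ln v]: adding [j ln q] multiplies [u] by [q^j], subtracting
    it multiplies [v]. A prime [p] outside the list that divides exactly one of [u], [v] keeps doing
    so, whence [u <> v] at the end. *)
Lemma separated_primes (m p : nat) (delta : R) (l : list nat) : nprime p -> 0 < delta ->
  (forall q, In q l -> nprime q) -> ~ In p l ->
  forall u v : nat, (1 <= u)%nat -> (1 <= v)%nat ->
  (Nat.divide p u /\ ~ Nat.divide p v \/ ~ Nat.divide p u /\ Nat.divide p v) ->
  delta * (INR u * INR v * lprod (fun q => INR q ^ m) l) <= 1 ->
  separated (fun q => ln (INR q)) m delta l (ln (INR u) - ln (INR v)).
Proof.
  intros Hp Hd0. induction l as [|q l IH]; intros Hl Hpl u v Hu Hv Hdiv Hdel.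
  - simpl in *. assert (u <> v) by (intros ->; tauto).
    eapply Rle_trans; [|apply ln_diff_lower; auto].
    assert (0 < INR u * INR v) by (apply Rmult_lt_0_compat; apply lt_0_INR; lia).
    apply Rmult_le_reg_r with (INR u * INR v); [assumption|].
    rewrite Rinv_l by lra. lra.
  - assert (Hq : nprime q) by (apply Hl; left; reflexivity).
    pose proof (nprime_ge_2 q Hq) as Hq2.
    assert (Hq1 : 1 <= INR q) by (apply (le_INR 1); lia).
    assert (Hpq : p <> q) by (intros ->; apply Hpl; left; reflexivity).
    intros j Hj.
    assert (Hqj : (1 <= q ^ j)%nat) by (pose proof (Nat.pow_nonzero q j); lia).
    assert (Hnd : forall x, ~ Nat.divide p x -> ~ Nat.divide p (x * q ^ j)).
    { intros x Hx H. apply nprime_divide_mul in H; [|exact Hp]. destruct H as [H|H]; [tauto|].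
      apply nprime_divide_pow in H; auto. }
    assert (Hln : ln (INR (q ^ j)) = INR j * ln (INR q)).
    { rewrite pow_INR, <- Rpower_pow by lra. unfold Rpower. apply ln_exp. }
    assert (Hlm : forall x, (1 <= x)%nat -> ln (INR (x * q ^ j)) = ln (INR x) + INR j * ln (INR q)).
    { intros x Hx. rewrite mult_INR, ln_mult by (apply lt_0_INR; lia). rewrite Hln. reflexivity. }
    assert (Hpow : INR (q ^ j) <= INR q ^ m).
    { rewrite pow_INR. apply Rle_pow; [exact Hq1|exact Hj]. }
    assert (HL : 0 <= lprod (fun q => INR q ^ m) l)
      by (apply lprod_nonneg; intros; apply pow_le, pos_INR).
    assert (Huv : 0 < INR u * INR v) by (apply Rmult_lt_0_compat; apply lt_0_INR; lia).
    assert (Hbd : delta * (INR u * INR v * INR (q ^ j) * lprod (fun q => INR q ^ m) l) <= 1).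
    { eapply Rle_trans; [|exact Hdel]. simpl. apply Rmult_le_compat_l; [lra|].
      rewrite !Rmult_assoc, <- !(Rmult_assoc (INR u)).
      apply Rmult_le_compat_l; [lra|]. apply Rmult_le_compat_r; assumption. }
    split.
    + replace (ln (INR u) - ln (INR v) + INR j * ln (INR q))
        with (ln (INR (u * q ^ j)) - ln (INR v)) by (rewrite Hlm by exact Hu; ring).
      apply IH; auto.
      * intros; apply Hl; right; auto.
      * intros H; apply Hpl; right; auto.
      * nia.
      * destruct Hdiv as [[H1 H2]|[H1 H2]]; [left|right]; split; auto. now apply Nat.divide_mul_l.
      * rewrite mult_INR. eapply Rle_trans; [|exact Hbd]. right; ring.
    + replace (ln (INR u) - ln (INR v) - INR j * ln (INR q))
        with (ln (INR u) - ln (INR (v * q ^ j))) by (rewrite Hlm by exact Hv; ring).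
      apply IH; auto.
      * intros; apply Hl; right; auto.
      * intros H; apply Hpl; right; auto.
      * nia.
      * destruct Hdiv as [[H1 H2]|[H1 H2]]; [left|right]; split; auto. now apply Nat.divide_mul_l.
      * rewrite mult_INR. eapply Rle_trans; [|exact Hbd]. right; ring.
Qed.

(** The first prime with a nonzero index starts [separated_primes] with [u = p^j] and [v = 1]. *)
Lemma independent_primes (m : nat) (delta : R) (l : list nat) : 0 < delta ->
  (forall q, In q l -> nprime q) -> NoDup l ->
  delta * lprod (fun q => INR q ^ m) l <= 1 ->
  independent (fun q => ln (INR q)) m delta l.
Proof.
  intros Hd. induction l as [|p l IH]; intros Hl Hnd Hdel; [exact I|].
  inversion Hnd; subst. assert (Hp : nprime p) by (apply Hl; left; reflexivity).
  pose proof (nprime_ge_2 p Hp).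
  assert (Hp1 : 1 <= INR p) by (apply (le_INR 1); lia).
  assert (HL : 0 <= lprod (fun q => INR q ^ m) l)
    by (apply lprod_nonneg; intros; apply pow_le, pos_INR).
  simpl in Hdel. simpl. split.
  - apply IH; auto; [intros; apply Hl; right; auto|].
    eapply Rle_trans; [|exact Hdel]. apply Rmult_le_compat_l; [lra|].
    assert (1 <= INR p ^ m) by (apply pow_R1_Rle; lra). nra.
  - intros j Hj.
    assert (Hln : INR j * ln (INR p) = ln (INR (p ^ j)) - ln (INR 1)).
    { rewrite pow_INR, <- Rpower_pow by lra. unfold Rpower. rewrite ln_exp. simpl. rewrite ln_1. ring. }
    rewrite Hln. apply separated_primes with p; auto.
    + intros; apply Hl; right; auto.
    + pose proof (Nat.pow_nonzero p j); lia.
    + left. split.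
      * destruct j; [lia|]. simpl. apply Nat.divide_factor_l.
      * intros Hk. apply Nat.divide_1_r in Hk. lia.
    + eapply Rle_trans; [|exact Hdel]. apply Rmult_le_compat_l; [lra|].
      rewrite pow_INR. simpl INR. rewrite Rmult_1_r.
      apply Rmult_le_compat_r; [assumption|]. apply Rle_pow; [exact Hp1|lia].
Qed.

(** * Fejer kernels and an effective Kronecker theorem *)

(* [sum_{j, k <= m} cos ((j - k) y)], i.e. [m + 1] times the Fejer kernel. *)
Fixpoint fejer (m : nat) : list (R * nat) :=
  match m with
  | O => [(1, 0%nat)]
  | S n => (1, 0%nat) :: map (fun j => (2, (m - j)%nat)) (seq 0 m) ++ fejer n
  end.

(** The coefficient of [cos y], that is, twice the mean of the product with [cos y]. *)
Fixpoint trig_coef1 (ts : list (R * nat)) : R :=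
  match ts with
  | [] => 0
  | (c, j) :: ts => (if Nat.eqb j 1 then c else 0) + trig_coef1 ts
  end.

(** The lower index is [|j - 1|], which is 1 for [j = 0]. *)
Fixpoint mul_cos (ts : list (R * nat)) : list (R * nat) :=
  match ts with
  | [] => []
  | (c, j) :: ts => (c / 2, S j) :: (c / 2, if Nat.eqb j 0 then 1%nat else pred j) :: mul_cos ts
  end.

Lemma trig_app ts ts' y : trig (ts ++ ts') y = trig ts y + trig ts' y.
Proof. induction ts as [|[c j] ts IH]; simpl; [ring|]. rewrite IH; ring. Qed.

Lemma trig_const_app ts ts' : trig_const (ts ++ ts') = trig_const ts + trig_const ts'.
Proof. induction ts as [|[c j] ts IH]; simpl; [ring|]. rewrite IH; ring. Qed.

Lemma trig_norm_app ts ts' : trig_norm (ts ++ ts') = trig_norm ts + trig_norm ts'.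
Proof. induction ts as [|[c j] ts IH]; simpl; [ring|]. rewrite IH; ring. Qed.

Lemma trig_coef1_app ts ts' : trig_coef1 (ts ++ ts') = trig_coef1 ts + trig_coef1 ts'.
Proof. induction ts as [|[c j] ts IH]; simpl; [ring|]. rewrite IH; ring. Qed.

Lemma trig_mul_cos ts y : trig (mul_cos ts) y = cos y * trig ts y.
Proof.
  induction ts as [|[c j] ts IH]; [simpl; ring|].
  change (trig (mul_cos ((c, j) :: ts)) y) with
    (c / 2 * cos (INR (S j) * y)
     + (c / 2 * cos (INR (if Nat.eqb j 0 then 1%nat else pred j) * y) + trig (mul_cos ts) y)).
  rewrite IH, S_INR. simpl trig.
  replace ((INR j + 1) * y) with (INR j * y + y) by ring.
  assert (E : cos (INR (if Nat.eqb j 0 then 1%nat else pred j) * y) = cos (INR j * y - y)).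
  { destruct j; simpl Nat.eqb; cbv iota.
    - rewrite <- cos_neg. f_equal. simpl; ring.
    - f_equal. simpl pred. rewrite S_INR; ring. }
  rewrite E, cos_plus, cos_minus. field.
Qed.

Lemma trig_const_mul_cos ts : trig_const (mul_cos ts) = trig_coef1 ts / 2.
Proof.
  induction ts as [|[c j] ts IH]; [simpl; field|].
  simpl. rewrite IH. destruct j as [|[|j]]; simpl; field.
Qed.

Lemma trig_norm_mul_cos ts : trig_norm (mul_cos ts) = trig_norm ts.
Proof.
  induction ts as [|[c j] ts IH]; [reflexivity|].
  simpl. rewrite IH. unfold Rdiv. rewrite Rabs_mult, (Rabs_pos_eq (/ 2)) by lra. field.
Qed.

Lemma mul_cos_degree ts m : (1 <= m)%nat -> (forall c j, In (c, j) ts -> (j <= m)%nat) ->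
  forall c j, In (c, j) (mul_cos ts) -> (j <= S m)%nat.
Proof.
  intros Hm1. induction ts as [|[c0 j0] ts IH]; intros Hm c j; simpl; [tauto|].
  assert (j0 <= m)%nat by (apply (Hm c0); left; reflexivity).
  intros [E|[E|E]].
  - injection E; intros; subst; lia.
  - injection E; intros; subst. destruct j0; simpl; lia.
  - apply IH with c; auto. intros; eapply Hm; right; eauto.
Qed.

Lemma fejer_degree m c j : In (c, j) (fejer m) -> (j <= m)%nat.
Proof.
  revert c j. induction m as [|m IH]; intros c j H.
  - simpl in H. destruct H as [E|[]]. injection E; lia.
  - change (fejer (S m)) with
      ((1, 0%nat) :: map (fun j => (2, (S m - j)%nat)) (seq 0 (S m)) ++ fejer m) in H.
    destruct H as [E|H]; [injection E; lia|].
    apply in_app_or in H. destruct H as [H|H].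
    + apply in_map_iff in H. destruct H as [k [E _]]. apply (f_equal snd) in E. cbn [snd] in E. lia.
    + apply IH in H. lia.
Qed.

Lemma trig_map_seq N n y : trig (map (fun j => (2, (N - j)%nat)) (seq 0 (S n))) y
  = 2 * sum_f_R0 (fun j => cos (INR (N - j) * y)) n.
Proof.
  induction n as [|n IH].
  - simpl. ring.
  - rewrite seq_S, map_app, trig_app, IH. rewrite Nat.add_0_l, tech5. cbn [map trig]. ring.
Qed.

(** The right-hand side is the squared modulus of [sum_{j <= m} e^{ijy}], so the kernel is
    nonnegative. Appending [e^{iz}] to that sum adds 1 and twice a real part, which is the recursion
    of [fejer]. *)
Lemma trig_fejer m y : trig (fejer m) y
  = (sum_f_R0 (fun j => cos (INR j * y)) m) ^ 2 + (sum_f_R0 (fun j => sin (INR j * y)) m) ^ 2.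
Proof.
  induction m as [|m IH].
  - simpl. rewrite Rmult_0_l, cos_0, sin_0. ring.
  - change (fejer (S m)) with
      ((1, 0%nat) :: map (fun j => (2, (S m - j)%nat)) (seq 0 (S m)) ++ fejer m).
    cbn [trig]. rewrite trig_app, trig_map_seq, IH, !tech5.
    set (z := INR (S m) * y).
    assert (E : sum_f_R0 (fun j => cos (INR (S m - j) * y)) m
      = cos z * sum_f_R0 (fun j => cos (INR j * y)) m + sin z * sum_f_R0 (fun j => sin (INR j * y)) m).
    { rewrite !scal_sum, <- plus_sum. apply sum_eq. intros j Hj.
      rewrite minus_INR by lia. replace ((INR (S m) - INR j) * y) with (z - INR j * y)
        by (unfold z; ring). rewrite cos_minus. ring. }
    rewrite E. change (INR 0) with 0. rewrite Rmult_0_l, cos_0.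
    pose proof (sin2_cos2 z) as P. unfold Rsqr in P. nra.
Qed.

Lemma trig_const_fejer m : trig_const (fejer m) = INR (S m).
Proof.
  induction m as [|m IH]; [simpl; ring|].
  change (fejer (S m)) with
    ((1, 0%nat) :: map (fun j => (2, (S m - j)%nat)) (seq 0 (S m)) ++ fejer m).
  cbn [trig_const]. rewrite trig_const_app, IH, (S_INR (S m)).
  assert (H : forall n, (n <= S m)%nat ->
    trig_const (map (fun j => (2, (S m - j)%nat)) (seq 0 n)) = 0).
  { induction n as [|n IHn]; intros Hn; [reflexivity|].
    rewrite seq_S, map_app, trig_const_app, IHn by lia. rewrite Nat.add_0_l. cbn [map trig_const].
    destruct (Nat.eqb_spec (S m - n) 0); [lia|ring]. }
  rewrite H by lia. simpl Nat.eqb. cbv iota. ring.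
Qed.

(** There are [2 m] ordered pairs of neighbours in [0, ..., m]. Halved and compared with the
    constant term [m + 1], this leaves the mean [m / (m + 1)] of the cosine. *)
Lemma trig_coef1_fejer m : trig_coef1 (fejer m) = 2 * INR m.
Proof.
  induction m as [|m IH]; [simpl; ring|].
  change (fejer (S m)) with
    ((1, 0%nat) :: map (fun j => (2, (S m - j)%nat)) (seq 0 (S m)) ++ fejer m).
  cbn [trig_coef1]. rewrite trig_coef1_app, IH, S_INR.
  assert (H : forall n, (n <= m)%nat ->
    trig_coef1 (map (fun j => (2, (S m - j)%nat)) (seq 0 n)) = 0).
  { induction n as [|n IHn]; intros Hn; [reflexivity|].
    rewrite seq_S, map_app, trig_coef1_app, IHn by lia. rewrite Nat.add_0_l. cbn [map trig_coef1].
    destruct (Nat.eqb_spec (S m - n) 1); [lia|ring]. }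
  rewrite seq_S, map_app, trig_coef1_app, H by lia. rewrite Nat.add_0_l. cbn [map trig_coef1].
  destruct (Nat.eqb_spec (S m - m) 1); [|lia]. simpl Nat.eqb. cbv iota. ring.
Qed.

Lemma trig_norm_fejer m : trig_norm (fejer m) = INR (S m) ^ 2.
Proof.
  induction m as [|m IH]; [simpl; rewrite Rabs_pos_eq by lra; ring|].
  change (fejer (S m)) with
    ((1, 0%nat) :: map (fun j => (2, (S m - j)%nat)) (seq 0 (S m)) ++ fejer m).
  cbn [trig_norm]. rewrite trig_norm_app, IH, (S_INR (S m)).
  assert (H : forall n N, trig_norm (map (fun j => (2, (N - j)%nat)) (seq 0 n)) = 2 * INR n).
  { induction n as [|n IHn]; intros N; [simpl; ring|].
    rewrite seq_S, map_app, trig_norm_app, IHn. cbn [map trig_norm]. rewrite S_INR.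
    rewrite Rabs_pos_eq by lra. ring. }
  rewrite H, Rabs_pos_eq by lra. ring.
Qed.

(** * Finite sums and products over lists *)

Lemma lprod_ext {A : Type} (f g : A -> R) l :
  (forall x, In x l -> f x = g x) -> lprod f l = lprod g l.
Proof.
  induction l as [|x l IH]; intros H; simpl; [reflexivity|].
  rewrite H, IH; [reflexivity| |left; reflexivity]. intros; apply H; right; auto.
Qed.

Lemma lprod_const {A : Type} (c : R) (l : list A) : lprod (fun _ => c) l = c ^ length l.
Proof. induction l; simpl; [reflexivity|]. rewrite IHl; reflexivity. Qed.

(** For inserting a cosine into the factor of a single prime. *)
Lemma lprod_update (f g : nat -> R) (c : R) (p : nat) (l : list nat) : NoDup l -> In p l ->
  g p = c * f p -> (forall q, q <> p -> g q = f q) -> lprod g l = c * lprod f l.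
Proof.
  intros Hnd Hin Hp Hq. induction l as [|q l IH]; [contradiction|].
  inversion Hnd; subst. simpl. destruct Hin as [->|Hin].
  - rewrite Hp, (lprod_ext g f); [ring|]. intros x Hx. apply Hq. intros ->; contradiction.
  - rewrite IH by auto. rewrite Hq; [ring|]. intros ->; contradiction.
Qed.

Lemma lsum_cont {A : Type} (f : A -> R -> R) (l : list A) :
  (forall x, cont (f x)) -> cont (fun t => lsum (fun x => f x t) l).
Proof.
  intros H. induction l; simpl; [apply cont_const|]. apply cont_plus; auto.
Qed.

Lemma RInt_lsum {A : Type} (f : A -> R -> R) (l : list A) (u v : R) :
  (forall x, cont (f x)) ->
  RInt (fun t => lsum (fun x => f x t) l) u v = lsum (fun x => RInt (f x) u v) l.
Proof.
  intros H. induction l; simpl.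
  - rewrite RInt_const. unfold scal; simpl; unfold mult; simpl. ring.
  - rewrite RInt_cont_plus, IHl; [reflexivity|apply H|now apply lsum_cont].
Qed.

Lemma lsum_le {A : Type} (f g : A -> R) (l : list A) :
  (forall x, In x l -> f x <= g x) -> lsum f l <= lsum g l.
Proof.
  induction l as [|x l IH]; intros H; simpl; [lra|].
  apply Rplus_le_compat; [apply H; left; reflexivity|apply IH; intros; apply H; right; auto].
Qed.

Lemma lsum_scal {A : Type} (f : A -> R) (c : R) (l : list A) :
  lsum (fun x => f x * c) l = lsum f l * c.
Proof. induction l; simpl; [ring|]. rewrite IHl; ring. Qed.

Lemma lsum_ext {A : Type} (f g : A -> R) l :
  (forall x, In x l -> f x = g x) -> lsum f l = lsum g l.
Proof.
  intros H. apply Rle_antisym; apply lsum_le; intros; rewrite H; auto; lra.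
Qed.

Lemma lsum_nonneg {A : Type} (f : A -> R) l : (forall x, In x l -> 0 <= f x) -> 0 <= lsum f l.
Proof.
  induction l as [|x l IH]; intros H; simpl; [lra|].
  apply Rplus_le_le_0_compat; [apply H; left; reflexivity|apply IH; intros; apply H; right; auto].
Qed.

(* Averaging against the product of the kernels [fejer m (t ln p - beta p)] makes the mean of
   [1 - cos (t ln p - beta p)] equal to [1 / (m + 1)] up to the off-diagonal error. *)
Lemma kronecker_effective (l : list nat) (m : nat) (beta A : nat -> R) (T : R) :
  (1 <= m)%nat -> (forall q, In q l -> nprime q) -> NoDup l -> (forall q, 0 <= A q) ->
  4 * INR (S m) ^ (S (length l)) * lprod (fun q => INR q ^ (S m)) l <= T ->
  exists t, T <= t <= 2 * T /\
    lsum (fun p => A p * (1 - cos (ln (INR p) * t - beta p))) l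
      <= 4 * lsum A l / INR (S m) + 1.
Proof.
  intros Hm1 Hl Hnd HA HT.
  set (z := INR (S m)) in *. set (N := length l) in *.
  set (Q := lprod (fun q => INR q ^ S m) l) in *.
  assert (Hz : 1 <= z) by (apply (le_INR 1); lia).
  assert (HQ : 1 <= Q).
  { unfold Q. clear -Hl. induction l as [|p l IH]; simpl; [lra|].
    assert (2 <= p)%nat by (apply nprime_ge_2, Hl; left; reflexivity).
    assert (1 <= INR p) by (apply (le_INR 1); lia).
    assert (1 <= INR p ^ S m) by (apply pow_R1_Rle; lra).
    assert (1 <= lprod (fun q => INR q ^ S m) l) by (apply IH; intros; apply Hl; right; auto).
    simpl in *. nra. }
  assert (HzN : 1 <= z ^ N) by (apply pow_R1_Rle; lra).
  assert (HT0 : 4 <= T).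
  { eapply Rle_trans; [|exact HT]. simpl.
    assert (1 <= z * z ^ N) by nra. nra. }
  set (F := fun _ : nat => fejer m).
  set (lam := fun q : nat => ln (INR q)).
  set (W := trig_prod lam beta F l).
  assert (HW : forall t, 0 <= W t).
  { intros t. unfold W, trig_prod. apply lprod_nonneg. intros p. unfold F. rewrite trig_fejer.
    nra. }
  assert (CW : cont W) by apply cont_trig_prod.
  (* [Q] bounds the product of the two integers whose logarithms differ by a given frequency. *)
  set (delta := / Q).
  assert (Hd : 0 < delta) by (apply Rinv_0_lt_compat; lra).
  (* Degree [S m], since multiplication by the cosine raises the degree of a kernel by one; the same
     separation then serves with and without the inserted cosine. *)
  assert (Hind : independent lam (S m) delta l).
  { apply independent_primes; auto. fold Q. unfold delta. rewrite Rinv_l; lra. }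
  assert (EN : forall f, (forall q, f q = z ^ 2) -> 2 / delta * lprod f l = 2 * Q * (z ^ N * z ^ N)).
  { intros f Hf. rewrite (lprod_ext f (fun _ => z ^ 2)) by auto. rewrite lprod_const. fold N.
    rewrite <- pow_mult, Nat.mul_comm, pow_mult. unfold delta. field. lra. }
  set (I0 := RInt W T (2 * T)).
  assert (HI0 : Rabs (I0 - T * z ^ N) <= 2 * Q * (z ^ N * z ^ N)).
  { pose proof (trig_prod_mean lam beta F (S m) delta T (2 * T) Hd ltac:(lra)
      ltac:(intros p c j H; apply fejer_degree in H; lia) l Hind) as H.
    rewrite EN in H by (intros; apply trig_norm_fejer).
    rewrite (lprod_ext _ (fun _ => z)) in H by (intros; apply trig_const_fejer).
    rewrite lprod_const in H. replace (2 * T - T) with T in H by ring. exact H. }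
  set (Ip := fun p => RInt (fun t => cos (lam p * t - beta p) * W t) T (2 * T)).
  assert (HIp : forall p, In p l ->
    Rabs (Ip p - T * (INR m / z * z ^ N)) <= 2 * Q * (z ^ N * z ^ N)).
  { intros p Hp. set (G := fun q => if Nat.eqb q p then mul_cos (fejer m) else fejer m).
    pose proof (trig_prod_mean lam beta G (S m) delta T (2 * T) Hd ltac:(lra)) as H.
    assert (Hdeg : forall p c j, In (c, j) (G p) -> (j <= S m)%nat).
    { intros q c j. unfold G. destruct (Nat.eqb q p).
      - apply mul_cos_degree; auto. intros c' j'. apply fejer_degree.
      - intros Hin. apply fejer_degree in Hin. lia. }
    specialize (H Hdeg l Hind).
    rewrite EN in H.
    2:{ intros q. unfold G. destruct (Nat.eqb q p); [rewrite trig_norm_mul_cos|]; apply trig_norm_fejer. }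
    rewrite (lprod_update (fun _ => z) _ (INR m / z) p) in H; auto.
    2:{ unfold G. rewrite Nat.eqb_refl, trig_const_mul_cos, trig_coef1_fejer. field. lra. }
    2:{ intros q Hq. unfold G. apply Nat.eqb_neq in Hq. rewrite Hq. apply trig_const_fejer. }
    rewrite lprod_const in H. replace (2 * T - T) with T in H by ring.
    rewrite (RInt_eq _ (fun t => cos (lam p * t - beta p) * W t)) in H; [exact H|].
    intros t. unfold trig_prod, W, trig_prod. apply (lprod_update _ _ _ p); auto.
    - unfold G. rewrite Nat.eqb_refl. apply trig_mul_cos.
    - intros q Hq. unfold G. apply Nat.eqb_neq in Hq. rewrite Hq. reflexivity. }
  set (SA := lsum A l). assert (HSA : 0 <= SA) by (apply lsum_nonneg; auto).
  (* One factor 2 pays for the off-diagonal error in the means with a cosine, the other for that in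
     the mean of the kernel; the summand 1 makes the final inequality strict even if [SA = 0]. *)
  set (B := 4 * SA / z + 1).
  set (V := fun t => lsum (fun p => A p * (1 - cos (lam p * t - beta p))) l).
  (* If [V > B] on the whole interval, then [(V - B) W] has a nonnegative integral because [W >= 0];
     this contradicts the mean values. *)
  destruct (Classical_Prop.classic (exists t, T <= t <= 2 * T /\ V t <= B)) as [H|Hno];
    [exact H|exfalso].
  set (Vw := fun p t => A p * (W t + -1 * (cos (lam p * t - beta p) * W t))).
  assert (Ccos : forall p, cont (fun t => cos (lam p * t - beta p) * W t)).
  { intros p. apply cont_mult; [|exact CW].
    apply (cont_ext (fun t => cos (lam p * t + - beta p))); [reflexivity|apply cont_cos_affine]. }
  assert (Cvw' : forall p, cont (fun t => W t + -1 * (cos (lam p * t - beta p) * W t))).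
  { intros p. apply cont_plus; [exact CW|]. apply cont_mult; [apply cont_const|apply Ccos]. }
  assert (Cvw : forall p, cont (Vw p)) by (intros p; apply cont_mult; [apply cont_const|apply Cvw']).
  assert (Hpos : 0 <= RInt (fun t => lsum (fun p => Vw p t) l + - B * W t) T (2 * T)).
  { apply RInt_ge_0; [lra| |].
    - apply ex_RInt_cont, cont_plus; [now apply lsum_cont|]. apply cont_mult; [apply cont_const|exact CW].
    - intros t Ht.
      assert (B < V t) by (apply Rnot_le_lt; intros Hle; apply Hno; exists t; split; [lra|exact Hle]).
      assert (E : lsum (fun p => Vw p t) l = V t * W t).
      { unfold V. rewrite <- lsum_scal. apply lsum_ext. intros. unfold Vw. ring. }
      rewrite E. specialize (HW t). nra. }
  rewrite RInt_cont_plus in Hpos; [|now apply lsum_cont|apply cont_mult; [apply cont_const|exact CW]].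
  rewrite RInt_cont_scal in Hpos by exact CW. rewrite RInt_lsum in Hpos by exact Cvw.
  fold I0 in Hpos.
  set (E := 2 * Q * (z ^ N * z ^ N)) in *.
  apply Rabs_le_between in HI0.
  (* The size of [T] enters here: the off-diagonal error is at most [T z^N / (2 z)], below half of
     the deficit and of the main term. *)
  assert (HE : E * (2 * z) <= T * z ^ N).
  { unfold E. replace (2 * Q * (z ^ N * z ^ N) * (2 * z)) with ((4 * z ^ S N * Q) * z ^ N) by (simpl; ring).
    apply Rmult_le_compat_r; lra. }
  assert (Hle : lsum (fun p => RInt (Vw p) T (2 * T)) l <= lsum A l * (T * z ^ N / z + 2 * E)).
  { rewrite <- lsum_scal. apply lsum_le. intros p Hp. unfold Vw.
    rewrite RInt_cont_scal by auto. apply Rmult_le_compat_l; [apply HA|].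
    rewrite RInt_cont_plus; [|exact CW|apply cont_mult; [apply cont_const|apply Ccos]].
    rewrite RInt_cont_scal by auto. fold I0. fold (Ip p).
    specialize (HIp p Hp). apply Rabs_le_between in HIp.
    assert (T * (INR m / z * z ^ N) = T * z ^ N - T * z ^ N / z).
    { replace (INR m) with (z - 1) by (unfold z; rewrite S_INR; ring). field. lra. }
    lra. }
  fold SA in Hle.
  assert (HE' : 2 * E <= T * z ^ N / z).
  { apply Rmult_le_reg_r with z; [lra|]. replace (T * z ^ N / z * z) with (T * z ^ N) by (field; lra). lra. }
  set (Y := T * z ^ N / z) in *.
  assert (EY : T * z ^ N = Y * z) by (unfold Y; field; lra).
  assert (HY : 0 < Y) by (unfold Y; apply Rdiv_lt_0_compat; nra).
  assert (HI0' : Y * z / 2 <= I0) by nra.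
  assert (HB : B * z = 4 * SA + z) by (unfold B; field; lra).
  assert (1 <= B).
  { unfold B. assert (0 <= 4 * SA / z) by (apply Rdiv_le_0_compat; lra). lra. }
  assert (B * (Y * z / 2) <= B * I0) by (apply Rmult_le_compat_l; lra).
  assert (B * (Y * z / 2) = 2 * SA * Y + z * Y / 2).
  { replace (B * (Y * z / 2)) with (B * z * Y / 2) by field. rewrite HB. field. }
  assert (SA * (Y + 2 * E) <= SA * (2 * Y)) by (apply Rmult_le_compat_l; lra).
  assert (0 < z * Y) by nra. lra.
Qed.

(** * Complex exponentials and complex series *)

Lemma Cmod_Cexp (z : C) : Cmod (Cexp z) = exp (Re z).
Proof.
  unfold Cexp, Cmod; simpl.
  replace (exp (Re z) * cos (Im z) * (exp (Re z) * cos (Im z) * 1)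
    + exp (Re z) * sin (Im z) * (exp (Re z) * sin (Im z) * 1)) with ((exp (Re z))²).
  - apply sqrt_Rsqr. left; apply exp_pos.
  - pose proof (sin2_cos2 (Im z)) as P. unfold Rsqr in *. nra.
Qed.

Lemma Cexp_plus (z w : C) : Cexp (z + w) = (Cexp z * Cexp w)%C.
Proof.
  destruct z as [x y], w as [x' y']. unfold Cexp, Cplus, Cmult; simpl.
  rewrite exp_plus, cos_plus, sin_plus. f_equal; ring.
Qed.

Lemma Cexp_0 : Cexp 0 = 1.
Proof. unfold Cexp; simpl. rewrite exp_0, cos_0, sin_0, Rmult_0_r, Rmult_1_r. reflexivity. Qed.

Lemma Cmod_ncpow (n : nat) (s : C) : Cmod (ncpow n s) = Rpower (INR n) (Re s).
Proof.
  unfold ncpow, rcpow. rewrite Cmod_Cexp. unfold Rpower. f_equal. destruct s; simpl. ring.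
Qed.

Lemma Re_le_Cmod (z : C) : Re z <= Cmod z.
Proof. eapply Rle_trans; [apply Rle_abs|]. destruct (Rmax_Cmod z).
  - eapply Rle_trans; [apply Rmax_l|]. apply Rmax_Cmod.
  - rewrite <- H. apply Rmax_l. Qed.

Lemma Rabs_Re_le_Cmod (z : C) : Rabs (Re z) <= Cmod z.
Proof. eapply Rle_trans; [apply Rmax_l|apply Rmax_Cmod]. Qed.

Lemma Rabs_Im_le_Cmod (z : C) : Rabs (Im z) <= Cmod z.
Proof. eapply Rle_trans; [apply Rmax_r|apply Rmax_Cmod]. Qed.

(** Turns a modulus into the real part of a linear expression, so that bounds on complex series,
    Taylor remainders and interior maxima reduce to real ones. *)
Lemma Cmod_unit_dual (z : C) : exists w : C, Cmod w = 1 /\ Re (w * z)%C = Cmod z.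
Proof.
  destruct (Ceq_dec z 0) as [->|Hz].
  - exists 1. rewrite Cmod_1, Cmult_0_r, Cmod_0. split; reflexivity.
  - assert (0 < Cmod z) by (apply Cmod_gt_0; exact Hz).
    exists (Cconj z / RtoC (Cmod z))%C. split.
    + rewrite Cmod_div, Cmod_conj, Cmod_R, Rabs_pos_eq by (try lra; intros E; injection E; lra).
      field; lra.
    + unfold Cdiv. rewrite <- Cmult_assoc, (Cmult_comm (/ _)), Cmult_assoc.
      assert (E : (Cconj z * z)%C = RtoC (Cmod z * Cmod z)).
      { assert (HH : Cmod z * Cmod z = (fst z)^2 + (snd z)^2).
        { unfold Cmod. apply sqrt_sqrt. nra. }
        destruct z as [x y]. rewrite HH. unfold Cconj, Cmult, RtoC; simpl. f_equal; ring. }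
      rewrite E, <- RtoC_inv, <- RtoC_mult by lra. simpl. field; lra.
Qed.

(** [CSeries] is meaningful only for convergent series; an explicit majorant gives convergence and a
    bound at once. *)
Definition dominated (u : nat -> C) (v : nat -> R) : Prop :=
  (forall n, Cmod (u n) <= v n) /\ ex_series v.

Lemma dominated_ex_Re u v : dominated u v -> ex_series (fun n => Re (u n)).
Proof. intros [H1 H2]. apply ex_series_Rabs_le with v; [|exact H2].
  intros n. eapply Rle_trans; [apply Rabs_Re_le_Cmod|apply H1]. Qed.

Lemma dominated_ex_Im u v : dominated u v -> ex_series (fun n => Im (u n)).
Proof. intros [H1 H2]. apply ex_series_Rabs_le with v; [|exact H2].
  intros n. eapply Rle_trans; [apply Rabs_Im_le_Cmod|apply H1]. Qed.

Lemma Re_Cmult_CSeries (w : C) u v : dominated u v ->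
  is_series (fun n => Re (w * u n)%C) (Re (w * CSeries u)%C).
Proof.
  intros H. destruct w as [x y].
  apply (is_series_ext (fun n => minus (scal x (Re (u n))) (scal y (Im (u n))))); [reflexivity|].
  change (Re ((x, y) * CSeries u)%C) with
    (minus (scal x (Series (fun n => Re (u n)))) (scal y (Series (fun n => Im (u n))))).
  apply (is_series_minus (V := R_NormedModule)); apply (is_series_scal (V := R_NormedModule));
    apply Series_correct.
  - eapply dominated_ex_Re; eauto.
  - eapply dominated_ex_Im; eauto.
Qed.

Lemma Cmod_CSeries_le u v : dominated u v -> Cmod (CSeries u) <= Series v.
Proof.
  intros H. destruct (Cmod_unit_dual (CSeries u)) as [w [Hw <-]].
  pose proof (Re_Cmult_CSeries w u v H) as HS. rewrite <- (is_series_unique _ _ HS).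
  destruct H as [H1 H2].
  apply Rle_trans with (Series (fun n => Rabs (Re (w * u n)%C))).
  - eapply Rle_trans; [apply Rle_abs|]. apply Series_Rabs.
    apply ex_series_Rabs_le with v; [|exact H2]. intros n. rewrite Rabs_Rabsolu.
    eapply Rle_trans; [apply Rabs_Re_le_Cmod|]. rewrite Cmod_mult, Hw, Rmult_1_l. apply H1.
  - apply Series_le; [|exact H2]. intros n. split; [apply Rabs_pos|].
    eapply Rle_trans; [apply Rabs_Re_le_Cmod|]. rewrite Cmod_mult, Hw, Rmult_1_l. apply H1.
Qed.

(** Indices below [n], as in [Cprod]; hence the shift by one against [sum_f_R0]. *)
Fixpoint Csum (u : nat -> C) (n : nat) : C :=
  match n with
  | O => 0
  | S m => (Csum u m + u m)%C
  end.

Lemma Re_Csum u n : Re (Csum u (S n)) = sum_f_R0 (fun i => Re (u i)) n.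
Proof. induction n as [|n IH]; [cbn; rewrite Rplus_0_l; reflexivity|]. rewrite tech5, <- IH. reflexivity. Qed.

Lemma Im_Csum u n : Im (Csum u (S n)) = sum_f_R0 (fun i => Im (u i)) n.
Proof. induction n as [|n IH]; [cbn; rewrite Rplus_0_l; reflexivity|]. rewrite tech5, <- IH. reflexivity. Qed.

Lemma dominated_shift u v n : dominated u v ->
  dominated (fun k => u (n + k)%nat) (fun k => v (n + k)%nat).
Proof. intros [H1 H2]. split; [intros; apply H1|]. now apply (ex_series_incr_n v n). Qed.

Lemma CSeries_split u v n : dominated u v ->
  CSeries u = (Csum u n + CSeries (fun k => u (n + k)%nat))%C.
Proof.
  intros H. destruct n as [|n].
  - simpl. rewrite Cplus_0_l. reflexivity.
  - assert (E : forall z w : C, Re z = Re w -> Im z = Im w -> z = w)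
      by (intros [? ?] [? ?]; simpl; congruence).
    apply E.
    + change (Re (CSeries u)) with (Series (fun n => Re (u n))).
      rewrite (Series_incr_n _ (S n)) by (try lia; eapply dominated_ex_Re; eauto).
      rewrite re_plus, Re_Csum. reflexivity.
    + change (Im (CSeries u)) with (Series (fun n => Im (u n))).
      rewrite (Series_incr_n _ (S n)) by (try lia; eapply dominated_ex_Im; eauto).
      rewrite im_plus, Im_Csum. reflexivity.
Qed.

Lemma is_series_C_CSeries (u : nat -> C) (l : C) :
  @is_series C_AbsRing C_NormedModule u l -> l = CSeries u.
Proof.
  intros H.
  assert (Hsum : forall n, Re (sum_n u n) = sum_n (fun k => Re (u k)) n
                        /\ Im (sum_n u n) = sum_n (fun k => Im (u k)) n).
  { induction n as [|n [IH1 IH2]]; [rewrite !sum_O; auto|].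
    rewrite !sum_Sn, <- IH1, <- IH2. split; reflexivity. }
  unfold is_series in H.
  pose proof (proj1 (filterlim_locally (sum_n u) l) H) as H'. clear H.
  assert (H1 : is_series (fun n => Re (u n)) (Re l)).
  { apply (proj2 (filterlim_locally (F := eventually) (sum_n (fun n => Re (u n))) (Re l))).
    intros eps. destruct (H' eps) as [N HN]. exists N. intros n Hn. specialize (HN n Hn).
    rewrite <- (proj1 (Hsum n)). apply HN. }
  assert (H2 : is_series (fun n => Im (u n)) (Im l)).
  { apply (proj2 (filterlim_locally (F := eventually) (sum_n (fun n => Im (u n))) (Im l))).
    intros eps. destruct (H' eps) as [N HN]. exists N. intros n Hn. specialize (HN n Hn).
    rewrite <- (proj2 (Hsum n)). apply HN. }
  unfold CSeries. rewrite (is_series_unique _ _ H1), (is_series_unique _ _ H2).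
  destruct l; reflexivity.
Qed.

Lemma Series_partial_ge (g : nat -> R) (B : R) (X : nat) : ex_series g ->
  (forall N, (X <= N)%nat -> B <= sum_f_R0 g N) -> B <= Series g.
Proof.
  intros Hg H. apply Series_correct in Hg.
  apply (is_lim_seq_le_loc (fun _ => B) (sum_n g) B (Series g)); [|apply is_lim_seq_const|exact Hg].
  exists X. intros n Hn. rewrite sum_n_Reals. auto.
Qed.

(** * The logarithm of [L] *)

Definition prime_term (b : nat -> C) (s : C) (n : nat) : C :=
  if nprime_dec n then (b n * ncpow n (- s))%C else 0.

Definition prime_abs (b : nat -> C) (n : nat) : R :=
  if nprime_dec n then Cmod (b n) else 0.

Definition euler_term (b : nat -> C) (s : C) (n : nat) : C :=
  if nprime_dec n then log_Euler_factor b n s else 0.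

Definition euler_bound (b : nat -> C) (delta M : R) : Prop :=
  delta < 1 / 2 /\ forall p j : nat, nprime p -> (1 <= j)%nat ->
    Cmod (b (p ^ j)%nat) <= M * Rpower (INR p) (INR j * delta).

Lemma Rpower_le_base (x e e' : R) : 1 <= x -> e <= e' -> Rpower x e <= Rpower x e'.
Proof. intros Hx [He|He]; [|right; now rewrite He].
  destruct Hx as [Hx|Hx]; [left; now apply Rpower_lt|].
  subst x. unfold Rpower. rewrite ln_1, !Rmult_0_r. lra. Qed.

(** For [Re s >= 1] the exponent [delta - Re s] is below [-1/2], so the geometric series over the
    powers of any prime has ratio at most [2^{-1/2} < 3/4]. Its sum is the source of the factor 4 in
    the bounds that follow. *)
Lemma Rpower_prime_le (p : nat) (e : R) : nprime p -> e <= - (1 / 2) -> Rpower (INR p) e <= 3 / 4.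
Proof.
  intros Hp He. assert (H2 : 2 <= INR p) by (apply (le_INR 2); now apply nprime_ge_2).
  apply Rle_trans with (Rpower (INR p) (- (1 / 2))); [apply Rpower_le_base; lra|].
  set (r := Rpower (INR p) (- (1 / 2))).
  assert (Hr : r * r = / INR p).
  { unfold r. rewrite <- Rpower_plus. replace (- (1 / 2) + - (1 / 2)) with (Ropp 1) by field.
    rewrite Rpower_Ropp, Rpower_1 by lra. reflexivity. }
  assert (/ INR p <= / 2) by (apply Rinv_le_contravar; lra).
  assert (0 < r) by apply exp_pos. nra.
Qed.

Definition euler_factor_term (b : nat -> C) (p : nat) (s : C) (i : nat) : C :=
  (b (p ^ S i)%nat * ncpow p (- (RtoC (INR (S i)) * s)))%C.

Lemma euler_factor_dominated b delta M p s : euler_bound b delta M -> nprime p -> 1 <= Re s ->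
  dominated (euler_factor_term b p s) (fun i => M * Rpower (INR p) (delta - Re s) ^ S i) /\ 0 <= M.
Proof.
  intros [Hd Hb] Hp Hs.
  assert (H2 : 2 <= INR p) by (apply (le_INR 2); now apply nprime_ge_2).
  assert (Hq : Rpower (INR p) (delta - Re s) <= 3 / 4) by (apply Rpower_prime_le; [exact Hp|lra]).
  assert (Hq0 : 0 < Rpower (INR p) (delta - Re s)) by apply exp_pos.
  split.
  - split.
    + intros i. unfold euler_factor_term. rewrite Cmod_mult, Cmod_ncpow.
      assert (E : Re (- (RtoC (INR (S i)) * s))%C = - (INR (S i) * Re s)).
      { destruct s as [x y]. unfold Re; cbn [Copp Cmult RtoC fst snd]. ring. }
      rewrite E.
      eapply Rle_trans.
      { apply Rmult_le_compat_r; [left; apply exp_pos|]. apply (Hb p (S i) Hp). lia. }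
      right. rewrite <- Rpower_pow by exact Hq0. rewrite Rpower_mult.
      rewrite Rmult_assoc, <- Rpower_plus. f_equal. f_equal. ring.
    + apply (ex_series_ext (fun i => scal (M * Rpower (INR p) (delta - Re s)) (Rpower (INR p) (delta - Re s) ^ i))).
      * intros n. unfold scal; simpl; unfold mult; simpl. ring.
      * apply (ex_series_scal (V := R_NormedModule)). apply ex_series_geom.
        rewrite Rabs_pos_eq; lra.
  - specialize (Hb p 1%nat Hp ltac:(lia)).
    pose proof (Cmod_ge_0 (b (p ^ 1)%nat)).
    assert (0 < Rpower (INR p) (INR 1 * delta)) by apply exp_pos. nra.
Qed.

(** The number [J] of terms split off is left free: [J = 1] isolates the prime itself, while the
    comparison of coefficients takes [J] as large as [p]. *)
Lemma euler_factor_expansion b delta M p s J : euler_bound b delta M -> nprime p -> 1 <= Re s ->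
  Cmod (log_Euler_factor b p s - Csum (euler_factor_term b p s) J)
    <= 4 * M * Rpower (INR p) (delta - Re s) ^ S J.
Proof.
  intros Hb Hp Hs. destruct (euler_factor_dominated b delta M p s Hb Hp Hs) as [Hdom HM].
  change (log_Euler_factor b p s) with (CSeries (euler_factor_term b p s)).
  rewrite (CSeries_split _ _ J Hdom).
  match goal with |- Cmod ?z <= _ => replace z with (CSeries (fun k => euler_factor_term b p s (J + k)%nat)) by ring end.
  eapply Rle_trans; [apply Cmod_CSeries_le, (dominated_shift _ _ J Hdom)|].
  assert (Hq : Rpower (INR p) (delta - Re s) <= 3 / 4).
  { apply Rpower_prime_le; [exact Hp|]. destruct Hb; lra. }
  assert (Hq0 : 0 < Rpower (INR p) (delta - Re s)) by apply exp_pos.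
  set (q := Rpower (INR p) (delta - Re s)) in *.
  rewrite (Series_ext _ (fun k => (M * q ^ S J) * q ^ k)).
  2:{ intros k. rewrite <- plus_Sn_m, pow_add. ring. }
  rewrite Series_scal_l, Series_geom by (rewrite Rabs_pos_eq; lra).
  assert (/ (1 - q) <= 4) by (replace 4 with (/ (/ 4)) by field; apply Rinv_le_contravar; lra).
  assert (0 <= M * q ^ S J) by (apply Rmult_le_pos; [lra|apply pow_le; lra]).
  nra.
Qed.

(** What the higher powers of [n] contribute when [Re s >= 1]. The exponent is below -1 because
    [delta < 1/2], so this is summable, with a bound that does not depend on [s]. *)
Definition euler_rem (delta M : R) (n : nat) : R := 4 * Rabs M * Rpower (INR n) (2 * (delta - 1)).

Lemma euler_rem_nonneg delta M n : 0 <= euler_rem delta M n.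
Proof. unfold euler_rem. apply Rmult_le_pos; [pose proof (Rabs_pos M); lra|left; apply exp_pos]. Qed.

Lemma ex_series_euler_rem delta M : delta < 1 / 2 -> ex_series (euler_rem delta M).
Proof.
  intros Hd. apply ex_series_incr_1. unfold euler_rem.
  apply (ex_series_scal (V := R_NormedModule) (4 * Rabs M)).
  apply (ex_series_ext (fun n => Rpower (INR (S n)) (- (1 + (1 - 2 * delta))))).
  - intros n. f_equal. ring.
  - apply ex_series_Rpower. lra.
Qed.

Lemma Csum_1 u : Csum u 1 = u 0%nat.
Proof. simpl. apply Cplus_0_l. Qed.

Lemma euler_factor_first b p s : euler_factor_term b p s 0 = (b p * ncpow p (- s))%C.
Proof.
  unfold euler_factor_term. rewrite Nat.pow_1_r. change (INR 1) with 1.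
  rewrite Cmult_1_l. reflexivity.
Qed.

Lemma euler_term_near b delta M s n : euler_bound b delta M -> 1 <= Re s ->
  Cmod (euler_term b s n - prime_term b s n) <= euler_rem delta M n.
Proof.
  intros Hb Hs. unfold euler_term, prime_term. destruct (nprime_dec n) as [Hp|Hp].
  - pose proof (euler_factor_expansion b delta M n s 1 Hb Hp Hs) as H.
    rewrite Csum_1, euler_factor_first in H. eapply Rle_trans; [exact H|].
    unfold euler_rem. pose proof (Rle_abs M). pose proof (Rabs_pos M).
    assert (Hn : 2 <= INR n) by (apply (le_INR 2); now apply nprime_ge_2).
    assert (E : Rpower (INR n) (delta - Re s) ^ 2 <= Rpower (INR n) (2 * (delta - 1))).
    { rewrite <- Rpower_pow by apply exp_pos. rewrite Rpower_mult. apply Rpower_le_base; [lra|].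
      simpl INR. lra. }
    assert (0 <= Rpower (INR n) (delta - Re s) ^ 2) by (apply pow2_ge_0).
    apply Rmult_le_compat; try lra.
    destruct (euler_factor_dominated b delta M n s Hb Hp Hs) as [_ HM]. lra.
  - replace (0 - 0)%C with (RtoC 0) by ring. rewrite Cmod_0. apply euler_rem_nonneg.
Qed.

Lemma Cmod_prime_term b s n : Cmod (prime_term b s n) = prime_abs b n * Rpower (INR n) (- Re s).
Proof.
  unfold prime_term, prime_abs. destruct (nprime_dec n).
  - rewrite Cmod_mult, Cmod_ncpow. reflexivity.
  - rewrite Cmod_0. ring.
Qed.

Definition prime_series_cv (b : nat -> C) (sigma : R) : Prop :=
  ex_series (fun n => prime_abs b n * Rpower (INR n) (- sigma)).

Lemma euler_term_dominated b delta M s : euler_bound b delta M -> 1 <= Re s ->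
  prime_series_cv b (Re s) ->
  dominated (euler_term b s)
    (fun n => prime_abs b n * Rpower (INR n) (- Re s) + euler_rem delta M n).
Proof.
  intros Hb Hs Hcv. split.
  - intros n. rewrite <- Cmod_prime_term.
    replace (euler_term b s n) with (prime_term b s n + (euler_term b s n - prime_term b s n))%C by ring.
    eapply Rle_trans; [apply Cmod_triangle|]. apply Rplus_le_compat_l. now apply euler_term_near.
  - apply (ex_series_plus (V := R_NormedModule) _ (euler_rem delta M)); [exact Hcv|].
    apply ex_series_euler_rem. apply Hb.
Qed.

Lemma sum_f_R0_le_Series (v : nat -> R) N : (forall n, 0 <= v n) -> ex_series v ->
  sum_f_R0 v N <= Series v.
Proof.
  intros Hv Hex. apply Series_partial_ge with N; [exact Hex|]. intros K HK.
  induction HK as [|K HK IH]; [lra|]. rewrite tech5. specialize (Hv (S K)). lra.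
Qed.

Lemma prime_abs_nonneg b n : 0 <= prime_abs b n.
Proof. unfold prime_abs. destruct (nprime_dec n); [apply Cmod_ge_0|lra]. Qed.

(** The unit factor [w] stays general: it is a rotation [e^{-i theta}] for large values and -1 for
    [log_L_upper]. Primes up to [X] are kept exactly; the later ones cost at most [K] in modulus. *)
Lemma log_L_lower b delta M s w X K : euler_bound b delta M -> 1 <= Re s ->
  prime_series_cv b (Re s) -> Cmod w = 1 ->
  (forall N, (X <= N)%nat ->
    sum_f_R0 (fun n => prime_abs b n * Rpower (INR n) (- Re s)) N
    - sum_f_R0 (fun n => prime_abs b n * Rpower (INR n) (- Re s)) X <= K) ->
  sum_f_R0 (fun n => Re (w * prime_term b s n)%C) X - K - Series (euler_rem delta M)
    <= Re (w * log_L b s)%C.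
Proof.
  intros Hb Hs Hcv Hw HK.
  pose proof (Re_Cmult_CSeries w _ _ (euler_term_dominated b delta M s Hb Hs Hcv)) as HS.
  change (log_L b s) with (CSeries (euler_term b s)). rewrite <- (is_series_unique _ _ HS).
  apply Series_partial_ge with X; [eexists; exact HS|]. intros N HN.
  assert (Hterm : forall n, Re (w * prime_term b s n)%C - euler_rem delta M n
     <= Re (w * euler_term b s n)%C).
  { intros n.
    pose proof (euler_term_near b delta M s n Hb Hs) as H.
    pose proof (Re_le_Cmod (w * (prime_term b s n - euler_term b s n))%C) as H1.
    rewrite Cmod_mult, Hw, Rmult_1_l, <- Cmod_opp in H1.
    replace (- (prime_term b s n - euler_term b s n))%C
      with (euler_term b s n - prime_term b s n)%C in H1 by ring.
    replace (w * (prime_term b s n - euler_term b s n))%C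
      with (w * prime_term b s n - w * euler_term b s n)%C in H1 by ring.
    unfold Cminus in H1 at 1. rewrite re_plus, re_opp in H1. lra. }
  apply Rle_trans with (sum_f_R0 (fun n => Re (w * prime_term b s n)%C) N
    - sum_f_R0 (euler_rem delta M) N).
  - pose proof (sum_f_R0_le_Series (euler_rem delta M) N (euler_rem_nonneg delta M)
      (ex_series_euler_rem delta M (proj1 Hb))).
    specialize (HK N HN).
    assert (sum_f_R0 (fun n => Re (w * prime_term b s n)%C) X
       - sum_f_R0 (fun n => Re (w * prime_term b s n)%C) N
       <= sum_f_R0 (fun n => prime_abs b n * Rpower (INR n) (- Re s)) N
       - sum_f_R0 (fun n => prime_abs b n * Rpower (INR n) (- Re s)) X); [|lra].
    clear HK H. induction HN as [|N HN IH]; [lra|]. rewrite !tech5.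
    pose proof (Rabs_Re_le_Cmod (w * prime_term b s (S N))%C) as H1.
    rewrite Cmod_mult, Hw, Rmult_1_l, Cmod_prime_term in H1.
    apply Rabs_le_between in H1. lra.
  - rewrite <- minus_sum. apply sum_Rle. intros n _. apply Hterm.
Qed.

Lemma log_L_upper b delta M s X K : euler_bound b delta M -> 1 <= Re s ->
  prime_series_cv b (Re s) ->
  (forall N, (X <= N)%nat ->
    sum_f_R0 (fun n => prime_abs b n * Rpower (INR n) (- Re s)) N
    - sum_f_R0 (fun n => prime_abs b n * Rpower (INR n) (- Re s)) X <= K) ->
  Re (log_L b s) <=
    sum_f_R0 (fun n => prime_abs b n * Rpower (INR n) (- Re s)) X + K + Series (euler_rem delta M).
Proof.
  intros Hb Hs Hcv HK.
  assert (Hm : Cmod (- (1))%C = 1) by (rewrite Cmod_opp, Cmod_1; reflexivity).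
  pose proof (log_L_lower b delta M s (- (1))%C X K Hb Hs Hcv Hm HK) as H.
  assert (E : forall z : C, Re (- (1) * z)%C = - Re z).
  { intros [x y]. unfold Re; cbn [Copp Cmult RtoC fst snd]. ring. }
  rewrite E in H.
  assert (- sum_f_R0 (fun n => prime_abs b n * Rpower (INR n) (- Re s)) X
    <= sum_f_R0 (fun n => Re (- (1) * prime_term b s n)%C) X); [|lra].
  clear H HK. induction X as [|X IH]; [|rewrite !tech5].
  - cbn [sum_f_R0]. rewrite E, <- Cmod_prime_term. pose proof (Re_le_Cmod (prime_term b s 0)). lra.
  - rewrite E, <- Cmod_prime_term. pose proof (Re_le_Cmod (prime_term b s (S X))). lra.
Qed.

Lemma Cprod_Cexp (b : nat -> C) s N :
  Cprod (fun n => if nprime_dec n then Cexp (log_Euler_factor b n s) else RtoC 1) N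
  = Cexp (Csum (euler_term b s) N).
Proof.
  induction N as [|N IH]; [symmetry; apply Cexp_0|].
  simpl. rewrite Cexp_plus, IH. unfold euler_term at 3.
  destruct (nprime_dec N); [reflexivity|]. now rewrite Cexp_0.
Qed.

(** The partial Euler products tend to [L s] by hypothesis and, by continuity of the exponential in
    each component, to [Cexp (log_L b s)]. *)
Lemma L_eq_Cexp_log_L L b delta M s : euler_product b L -> euler_bound b delta M -> 1 < Re s ->
  prime_series_cv b (Re s) -> L s = Cexp (log_L b s).
Proof.
  intros [HP _] Hb Hs Hcv. specialize (HP s Hs).
  pose proof (euler_term_dominated b delta M s Hb ltac:(lra) Hcv) as Hdom.
  pose proof (Series_correct _ (dominated_ex_Re _ _ Hdom)) as HR.
  pose proof (Series_correct _ (dominated_ex_Im _ _ Hdom)) as HI.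
  assert (LR : is_lim_seq (fun N => Re (Csum (euler_term b s) (S N))) (Re (log_L b s))).
  { apply (is_lim_seq_ext (sum_n (fun n => Re (euler_term b s n)))); [|exact HR].
    intros n. rewrite sum_n_Reals, Re_Csum. reflexivity. }
  assert (LI : is_lim_seq (fun N => Im (Csum (euler_term b s) (S N))) (Im (log_L b s))).
  { apply (is_lim_seq_ext (sum_n (fun n => Im (euler_term b s n)))); [|exact HI].
    intros n. rewrite sum_n_Reals, Im_Csum. reflexivity. }
  assert (Le : is_lim_seq (fun N => exp (Re (Csum (euler_term b s) (S N)))) (exp (Re (log_L b s)))).
  { apply (is_lim_seq_continuous exp); [|exact LR].
    apply derivable_continuous_pt, derivable_pt_exp. }
  assert (Lc : is_lim_seq (fun N => cos (Im (Csum (euler_term b s) (S N)))) (cos (Im (log_L b s)))).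
  { apply (is_lim_seq_continuous cos); [|exact LI].
    apply derivable_continuous_pt, derivable_pt_cos. }
  assert (Ls : is_lim_seq (fun N => sin (Im (Csum (euler_term b s) (S N)))) (sin (Im (log_L b s)))).
  { apply (is_lim_seq_continuous sin); [|exact LI].
    apply derivable_continuous_pt, derivable_pt_sin. }
  pose proof (is_lim_seq_mult' _ _ _ _ Le Lc) as L1.
  pose proof (is_lim_seq_mult' _ _ _ _ Le Ls) as L2.
  pose proof (proj1 (filterlim_locally _ _) HP) as H'.
  assert (G1 : is_lim_seq (fun N => Re (Cexp (Csum (euler_term b s) (S N)))) (Re (L s))).
  { apply is_lim_seq_spec. intros eps. destruct (H' eps) as [N HN]. exists N. intros n Hn.
    rewrite <- Cprod_Cexp. specialize (HN (S n) ltac:(lia)). apply HN. }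
  assert (G2 : is_lim_seq (fun N => Im (Cexp (Csum (euler_term b s) (S N)))) (Im (L s))).
  { apply is_lim_seq_spec. intros eps. destruct (H' eps) as [N HN]. exists N. intros n Hn.
    rewrite <- Cprod_Cexp. specialize (HN (S n) ltac:(lia)). apply HN. }
  apply is_lim_seq_unique in L1. apply is_lim_seq_unique in L2.
  apply is_lim_seq_unique in G1. apply is_lim_seq_unique in G2.
  unfold Cexp in G1, G2; simpl in G1, G2.
  simpl in L1, L2. rewrite L1 in G1. rewrite L2 in G2.
  apply Rbar_finite_eq in G1. apply Rbar_finite_eq in G2.
  rewrite (surjective_pairing (L s)). unfold Cexp. f_equal; symmetry; [exact G1|exact G2].
Qed.

(** * Taylor expansion of the complex exponential *)

Definition exp_term (z : C) (j : nat) : C := (z ^ j * RtoC (/ INR (fact j)))%C.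

Lemma is_derive_Re_Cexp (c z : C) (t : R) :
  is_derive (fun t => Re (c * Cexp (RtoC t * z))%C) t (Re (c * z * Cexp (RtoC t * z))%C).
Proof.
  destruct c as [u v], z as [x y]. unfold Cexp, Cmult, RtoC, Re, Im; simpl.
  auto_derive; [trivial|]. unfold Rminus. ring.
Qed.

Lemma Derive_n_Re_Cexp (c z : C) (n : nat) (t : R) :
  is_derive_n (fun t => Re (c * Cexp (RtoC t * z))%C) n t (Re (c * z ^ n * Cexp (RtoC t * z))%C).
Proof.
  revert t. induction n as [|n IH]; intros t.
  - cbn [is_derive_n Cpow]. rewrite Cmult_1_r. reflexivity.
  - apply (is_derive_ext (fun t => Re (c * z ^ n * Cexp (RtoC t * z))%C)).
    + intros s. symmetry. apply is_derive_n_unique, IH.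
    + replace (c * z ^ S n)%C with (c * z ^ n * z)%C by (simpl; ring). apply is_derive_Re_Cexp.
Qed.

(** The Lagrange form of the remainder fails for complex values; it is applied to the real function
    [t |-> Re (w e^{tz})], with [w] dual to the remainder. *)
Lemma Cexp_taylor (z : C) (n : nat) :
  Cmod (Cexp z - Csum (exp_term z) (S n)) <= Cmod z ^ S n * exp (Cmod z).
Proof.
  destruct (Cmod_unit_dual (Cexp z - Csum (exp_term z) (S n))%C) as [w [Hw <-]].
  set (f := fun t => Re (w * Cexp (RtoC t * z))%C).
  destruct (Taylor_Lagrange f n 0 1) as [zeta [Hz HT]]; [lra| |].
  { intros t _ k _. destruct k; [exact I|]. eexists. apply (Derive_n_Re_Cexp w z (S k) t). }
  assert (E1 : f 1 = Re (w * Cexp z)%C) by (unfold f; rewrite Cmult_1_l; reflexivity).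
  assert (E2 : forall m, Re (w * Csum (exp_term z) (S m))%C
     = sum_f_R0 (fun m => (1 - 0) ^ m / INR (fact m) * Derive_n f m 0) m).
  { assert (D0 : forall m, Derive_n f m 0 = Re (w * z ^ m)%C).
    { intros m. unfold f. rewrite (is_derive_n_unique _ _ _ _ (Derive_n_Re_Cexp w z m 0)).
      rewrite Cmult_0_l, Cexp_0, Cmult_1_r. reflexivity. }
    assert (T : forall m, Re (w * exp_term z m)%C = (1 - 0) ^ m / INR (fact m) * Derive_n f m 0).
    { intros m. rewrite D0, Rminus_0_r, pow1. unfold exp_term. rewrite Cmult_assoc.
      destruct (w * z ^ m)%C as [x y]. unfold Re, Cmult, RtoC; simpl. unfold Rdiv. ring. }
    induction m as [|m IH].
    - cbn [Csum sum_f_R0]. rewrite Cplus_0_l. apply T.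
    - rewrite tech5, <- IH, <- T. change (Csum (exp_term z) (S (S m)))
        with (Csum (exp_term z) (S m) + exp_term z (S m))%C.
      rewrite Cmult_plus_distr_l, re_plus. reflexivity. }
  rewrite E1, <- E2 in HT.
  unfold Cminus. rewrite Cmult_plus_distr_l, re_plus, HT.
  match goal with |- ?l <= _ => replace l with
    ((1 - 0) ^ S n / INR (fact (S n)) * Derive_n f (S n) zeta) end.
  2:{ replace (w * - Csum (exp_term z) (S n))%C with (- (w * Csum (exp_term z) (S n)))%C by ring.
      rewrite re_opp. ring. }
  unfold f. rewrite (is_derive_n_unique _ _ _ _ (Derive_n_Re_Cexp w z (S n) zeta)).
  rewrite Rminus_0_r, pow1.
  assert (Hf : 0 < / INR (fact (S n)) <= 1).
  { assert (1 <= INR (fact (S n))) by (apply (le_INR 1); pose proof (lt_O_fact (S n)); lia).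
    split; [apply Rinv_0_lt_compat; lra|]. rewrite <- Rinv_1; apply Rinv_le_contravar; lra. }
  assert (Hb : Re (w * z ^ S n * Cexp (RtoC zeta * z))%C <= Cmod z ^ S n * exp (Cmod z)).
  { eapply Rle_trans; [apply Re_le_Cmod|]. rewrite !Cmod_mult, Hw, Rmult_1_l, Cmod_pow, Cmod_Cexp.
    apply Rmult_le_compat_l; [apply pow_le, Cmod_ge_0|].
    assert (Re (RtoC zeta * z)%C <= Cmod z).
    { eapply Rle_trans; [apply Re_le_Cmod|]. rewrite Cmod_mult, Cmod_R, Rabs_pos_eq by lra.
      pose proof (Cmod_ge_0 z). nra. }
    destruct H as [H|H]; [left; now apply exp_increasing|right; now rewrite H]. }
  assert (0 <= Cmod z ^ S n * exp (Cmod z))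
    by (apply Rmult_le_pos; [apply pow_le, Cmod_ge_0|left; apply exp_pos]).
  unfold Rdiv. rewrite Rmult_1_l. nra.
Qed.

(** * The coefficients [a] and [b] agree on primes *)

Definition pw (n k : nat) : C := RtoC ((/ INR n) ^ k).

Lemma Cmod_pw n k : Cmod (pw n k) = (/ INR n) ^ k.
Proof.
  unfold pw. rewrite Cmod_R. apply Rabs_pos_eq. apply pow_le.
  destruct n; [simpl; rewrite Rinv_0; lra|]. left; apply Rinv_0_lt_compat, lt_0_INR; lia.
Qed.

Lemma ncpow_nat n k : (1 <= n)%nat -> ncpow n (- RtoC (INR k)) = pw n k.
Proof.
  intros Hn. assert (0 < INR n) by (apply lt_0_INR; lia).
  unfold ncpow, rcpow, Cexp, pw, RtoC, Copp, Cmult, Re, Im; simpl.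
  replace (- INR k * 0 + - 0 * ln (INR n)) with 0 by ring.
  rewrite cos_0, sin_0. f_equal; [|ring]. rewrite Rmult_1_r.
  replace (- INR k * ln (INR n) - - 0 * 0) with (- (INR k * ln (INR n))) by ring.
  rewrite exp_Ropp. change (exp (INR k * ln (INR n))) with (Rpower (INR n) (INR k)).
  rewrite Rpower_pow, pow_inv by assumption. reflexivity.
Qed.

Lemma pw_mul n m k : (pw n k * pw m k)%C = pw (n * m) k.
Proof. unfold pw. rewrite <- RtoC_mult, <- Rpow_mult_distr, mult_INR, Rinv_mult. reflexivity. Qed.

Lemma inv_INR_le (n m : nat) : (1 <= n <= m)%nat -> 0 <= / INR m <= / INR n.
Proof.
  intros H. assert (1 <= INR n) by (apply (le_INR 1); lia).
  assert (INR n <= INR m) by (apply le_INR; lia).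
  split; [left; apply Rinv_0_lt_compat; lra|apply Rinv_le_contravar; lra].
Qed.

(** * Expansions in the sequences [n^{-k}] *)

Definition eventually_le (x : R) (f : nat -> C) : Prop :=
  exists (c : R) (k0 : nat), 0 <= c /\ forall k, (k0 <= k)%nat -> Cmod (f k) <= c * x ^ k.

(* Sequences with an expansion [sum_{n < p} alpha_n n^{-k} + O((p + 1)^{-k})] having no term
   in [p^{-k}].  They form a ring when [p] is prime. *)
Inductive no_term (p : nat) : (nat -> C) -> Prop :=
| no_term_big f : eventually_le (/ INR (S p)) f -> no_term p f
| no_term_mono n c : (1 <= n < p)%nat -> no_term p (fun k => c * pw n k)%C
| no_term_plus f g : no_term p f -> no_term p g -> no_term p (fun k => f k + g k)%C
| no_term_ext f g k0 : (forall k, (k0 <= k)%nat -> f k = g k) -> no_term p f -> no_term p g.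

Lemma eventually_le_mul x y f g : 0 <= x -> 0 <= y ->
  eventually_le x f -> eventually_le y g -> eventually_le (x * y) (fun k => f k * g k)%C.
Proof.
  intros Hx Hy [c [k0 [Hc Hf]]] [d [k1 [Hd Hg]]]. exists (c * d), (max k0 k1).
  split; [nra|]. intros k Hk. rewrite Cmod_mult, Rpow_mult_distr.
  replace (c * d * (x ^ k * y ^ k)) with ((c * x ^ k) * (d * y ^ k)) by ring.
  apply Rmult_le_compat; try apply Cmod_ge_0; [apply Hf|apply Hg]; lia.
Qed.

Lemma eventually_le_plus x f g :
  eventually_le x f -> eventually_le x g -> eventually_le x (fun k => f k + g k)%C.
Proof.
  intros [c [k0 [Hc Hf]]] [d [k1 [Hd Hg]]]. exists (c + d), (max k0 k1).
  split; [lra|]. intros k Hk. eapply Rle_trans; [apply Cmod_triangle|].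
  rewrite Rmult_plus_distr_r. apply Rplus_le_compat; [apply Hf|apply Hg]; lia.
Qed.

Lemma eventually_le_weaken x y f : 0 <= x <= y -> eventually_le x f -> eventually_le y f.
Proof.
  intros Hxy [c [k0 [Hc Hf]]]. exists c, k0. split; [exact Hc|]. intros k Hk.
  eapply Rle_trans; [apply Hf, Hk|]. apply Rmult_le_compat_l; [exact Hc|]. now apply pow_incr.
Qed.

Lemma eventually_le_ext x f g k0 : (forall k, (k0 <= k)%nat -> f k = g k) ->
  eventually_le x f -> eventually_le x g.
Proof.
  intros E [c [k1 [Hc Hf]]]. exists c, (max k0 k1). split; [exact Hc|]. intros k Hk.
  rewrite <- E by lia. apply Hf; lia.
Qed.

Lemma eventually_le_pw c n : eventually_le (/ INR n) (fun k => c * pw n k)%C.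
Proof.
  exists (Cmod c), 0%nat. split; [apply Cmod_ge_0|]. intros k _. rewrite Cmod_mult, Cmod_pw. lra.
Qed.

Lemma no_term_bounded p f : no_term p f -> eventually_le 1 f.
Proof.
  assert (H1 : / INR 1 = 1) by (simpl; apply Rinv_1).
  intros H. induction H.
  - eapply eventually_le_weaken; [|exact H]. rewrite <- H1. apply inv_INR_le. lia.
  - eapply eventually_le_weaken; [|apply eventually_le_pw]. rewrite <- H1. apply inv_INR_le. lia.
  - now apply eventually_le_plus.
  - eapply eventually_le_ext; eauto.
Qed.

Lemma no_term_pw p n c : (1 <= n)%nat -> n <> p -> no_term p (fun k => c * pw n k)%C.
Proof.
  intros H1 Hn. destruct (Nat.lt_ge_cases n p); [apply no_term_mono; lia|].
  apply no_term_big. eapply eventually_le_weaken; [|apply eventually_le_pw]. apply inv_INR_le. lia.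
Qed.

(** Primality enters here: for [n, m < p] the product [n m] is never [p]. A factor of size
    [O((p + 1)^{-k})] absorbs the other one, which is bounded. *)
Lemma no_term_mul p f g : nprime p -> no_term p f -> no_term p g ->
  no_term p (fun k => f k * g k)%C.
Proof.
  intros Hp Hf Hg.
  assert (Hx : 0 <= / INR (S p)) by (apply (inv_INR_le 1); lia).
  induction Hf as [f Hf|n c Hn|f1 f2 Hf1 IH1 Hf2 IH2|f1 f2 k0 E Hf1 IH1].
  - apply no_term_big. rewrite <- (Rmult_1_r (/ _)).
    apply eventually_le_mul; try lra; [exact Hf|]. eapply no_term_bounded; eauto.
  - induction Hg as [g Hg|m d Hm|g1 g2 Hg1 IH1 Hg2 IH2|g1 g2 k0 E Hg1 IH1].
    + apply no_term_big. rewrite <- (Rmult_1_l (/ _)).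
      apply eventually_le_mul; try lra; [|exact Hg].
      apply (no_term_bounded p). now apply no_term_mono.
    + apply (no_term_ext p (fun k => (c * d) * pw (n * m) k)%C _ 0%nat).
      { intros k _. rewrite <- pw_mul. ring. }
      apply no_term_pw; [nia|]. intros E.
      assert (Hd : Nat.divide p (n * m)) by (rewrite E; apply Nat.divide_refl).
      apply nprime_divide_mul in Hd; [|exact Hp].
      destruct Hd as [Hd|Hd]; apply Nat.divide_pos_le in Hd; lia.
    + apply (no_term_ext p (fun k => c * pw n k * g1 k + c * pw n k * g2 k)%C _ 0%nat).
      { intros k _. ring. }
      now apply no_term_plus.
    + apply (no_term_ext p (fun k => c * pw n k * g1 k)%C _ k0); [|exact IH1].
      intros k Hk. rewrite E by exact Hk. reflexivity.
  - apply (no_term_ext p (fun k => f1 k * g k + f2 k * g k)%C _ 0%nat).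
    { intros k _. ring. }
    now apply no_term_plus.
  - apply (no_term_ext p (fun k => f1 k * g k)%C _ k0); [|exact IH1].
    intros k Hk. rewrite E by exact Hk. reflexivity.
Qed.

(* [kill N] composes the operators [f k |-> f (k + 1) - f k / n] for [1 <= n <= N]; each of them
   annihilates [n^{-k}]. *)
Fixpoint kill (N : nat) (f : nat -> C) (k : nat) : C :=
  match N with
  | O => f k
  | S n => (kill n f (S k) - RtoC (/ INR N) * kill n f k)%C
  end.

(** The eigenvalue of [kill N] on the sequence [p^{-k}]. *)
Fixpoint kill_coef (N p : nat) : R :=
  match N with
  | O => 1
  | S n => (/ INR p - / INR N) * kill_coef n p
  end.

Lemma kill_plus N f g k : kill N (fun k => f k + g k)%C k = (kill N f k + kill N g k)%C.
Proof. revert k. induction N as [|N IH]; intros k; simpl; [reflexivity|]. rewrite !IH. ring. Qed.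

Lemma kill_ext N f g k0 : (forall k, (k0 <= k)%nat -> f k = g k) ->
  forall k, (k0 <= k)%nat -> kill N f k = kill N g k.
Proof.
  intros E. induction N as [|N IH]; intros k Hk; simpl; [now apply E|]. rewrite !IH by lia. reflexivity.
Qed.

Lemma kill_pw N c p k : kill N (fun k => c * pw p k)%C k = (RtoC (kill_coef N p) * (c * pw p k))%C.
Proof.
  revert k. induction N as [|N IH]; intros k; cbn [kill kill_coef]; [ring|].
  rewrite !IH. assert (E : pw p (S k) = (RtoC (/ INR p) * pw p k)%C).
  { unfold pw. rewrite <- RtoC_mult. reflexivity. }
  rewrite E, RtoC_mult, RtoC_minus. ring.
Qed.

Lemma kill_coef_0 N p : (1 <= p <= N)%nat -> kill_coef N p = 0.
Proof.
  induction N as [|N IH]; intros H; [lia|]. cbn [kill_coef].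
  destruct (Nat.eq_dec p (S N)) as [->|Hne]; [ring|]. rewrite IH by lia. ring.
Qed.

Lemma kill_coef_neq_0 N p : (N < p)%nat -> kill_coef N p <> 0.
Proof.
  induction N as [|N IH]; intros H; cbn [kill_coef]; [lra|].
  apply Rmult_integral_contrapositive. split; [|apply IH; lia].
  intros E. assert (E' : / INR p = / INR (S N)) by lra. apply Rinv_eq_reg in E'.
  apply INR_eq in E'. lia.
Qed.

Lemma kill_big x N f : 0 <= x -> eventually_le x f -> eventually_le x (kill N f).
Proof.
  intros Hx Hf. induction N as [|N [c [k0 [Hc IH]]]]; [exact Hf|].
  exists (c * x + / INR (S N) * c), k0.
  assert (0 < / INR (S N)) by (apply Rinv_0_lt_compat, lt_0_INR; lia).
  split; [nra|]. intros k Hk. cbn [kill].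
  eapply Rle_trans; [apply Cmod_triangle|].
  rewrite Cmod_opp, Cmod_mult, Cmod_R, Rabs_pos_eq by lra.
  pose proof (IH (S k) ltac:(lia)) as I1. pose proof (IH k Hk) as I2. simpl in I1.
  assert (/ INR (S N) * Cmod (kill N f k) <= / INR (S N) * (c * x ^ k))
    by (apply Rmult_le_compat_l; lra).
  rewrite Rmult_plus_distr_r. apply Rplus_le_compat; lra.
Qed.

Lemma no_term_kill p f : no_term p f -> eventually_le (/ INR (S p)) (kill (pred p) f).
Proof.
  assert (Hx : 0 <= / INR (S p)) by (apply (inv_INR_le 1); lia).
  intros H. induction H as [f Hf|n c Hn|f1 f2 Hf1 IH1 Hf2 IH2|f1 f2 k0 E Hf1 IH1].
  - now apply kill_big.
  - exists 0, 0%nat. split; [lra|]. intros k _. rewrite kill_pw, kill_coef_0 by lia.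
    rewrite Cmult_0_l, Cmod_0. lra.
  - eapply eventually_le_ext with (k0 := 0%nat); [intros; symmetry; apply kill_plus|].
    now apply eventually_le_plus.
  - eapply eventually_le_ext; [|exact IH1]. intros k Hk. eapply kill_ext; eauto.
Qed.

(** [kill (pred p)] brings every sequence in [no_term p] down to [O((p + 1)^{-k})], but only
    multiplies [c p^{-k}] by a nonzero constant; and [(p / (p + 1))^k] tends to 0. *)
Lemma no_term_unique p c : (1 <= p)%nat -> no_term p (fun k => c * pw p k)%C -> c = 0.
Proof.
  intros Hp H. apply no_term_kill in H. destruct H as [d [k0 [Hd H]]].
  pose proof (kill_coef_neq_0 (pred p) p ltac:(lia)) as HK.
  destruct (Ceq_dec c 0) as [E|Hc]; [exact E|exfalso].
  set (g := Rabs (kill_coef (pred p) p) * Cmod c).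
  assert (Hg : 0 < g).
  { apply Rmult_lt_0_compat; [now apply Rabs_pos_lt|now apply Cmod_gt_0]. }
  assert (Hip : 1 <= INR p) by (apply (le_INR 1); lia).
  set (y := INR p / INR (S p)).
  assert (Hy : 0 < y < 1).
  { unfold y. rewrite S_INR. split; [apply Rdiv_lt_0_compat; lra|].
    apply Rlt_div_l; lra. }
  destruct (pow_lt_1_zero y ltac:(rewrite Rabs_pos_eq; lra) (g / (d + 1)))
    as [N HN]; [apply Rdiv_lt_0_compat; lra|].
  set (k := max N k0). specialize (HN k ltac:(lia)). specialize (H k ltac:(lia)).
  rewrite kill_pw, !Cmod_mult, Cmod_R, Cmod_pw in H.
  rewrite Rabs_pos_eq in HN by (apply pow_le; lra).
  assert (E : (/ INR (S p)) ^ k = y ^ k * (/ INR p) ^ k).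
  { rewrite <- Rpow_mult_distr. f_equal. unfold y. rewrite S_INR. field. lra. }
  rewrite E in H. assert (0 < (/ INR p) ^ k) by (apply pow_lt, Rinv_0_lt_compat; lra).
  assert (H' : g <= d * y ^ k).
  { apply Rmult_le_reg_r with ((/ INR p) ^ k); [assumption|]. unfold g. lra. }
  assert (y ^ k * (d + 1) < g) by (apply Rlt_div_r in HN; lra).
  assert (0 < y ^ k) by (apply pow_lt; lra). nra.
Qed.

(** [n^{1 - k} = n^{-2} n^{-(k - 3)}]: the first factor gives convergence, the second is at most
    [N^{3 - k}] for [n >= N]. The exponent [1 - k] fits coefficients of size [O(n)]. *)
Lemma Series_tail_bound (w : nat -> C) (c : R) (N k : nat) : (3 <= k)%nat -> (1 <= N)%nat -> 0 <= c ->
  (forall i, Cmod (w i) <= c * Rpower (INR (N + i)) (1 - INR k)) ->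
  let v := fun i => c * INR N ^ 3 * (/ INR N) ^ k * Rpower (INR (S i)) (- (1 + 1)) in
  dominated w v /\ Series v = c * INR N ^ 3 * Series (fun i => Rpower (INR (S i)) (- (1 + 1))) * (/ INR N) ^ k.
Proof.
  intros Hk HN Hc Hw v. split; [split|].
  - intros i. eapply Rle_trans; [apply Hw|]. unfold v. rewrite !Rmult_assoc.
    apply Rmult_le_compat_l; [exact Hc|].
    assert (H1 : 1 <= INR N) by (apply (le_INR 1); lia).
    assert (H2 : INR N <= INR (N + i)) by (apply le_INR; lia).
    assert (H3 : INR (S i) <= INR (N + i)) by (apply le_INR; lia).
    assert (H0 : 0 < INR (S i)) by (apply lt_0_INR; lia).
    replace (1 - INR k) with (- (1 + 1) + - INR (k - 3)) by (rewrite minus_INR by lia; simpl; ring).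
    rewrite Rpower_plus, (Rpower_Ropp _ (INR (k - 3))), (Rpower_pow (k - 3)) by lra.
    replace (INR N ^ 3 * ((/ INR N) ^ k * Rpower (INR (S i)) (- (1 + 1))))
      with (Rpower (INR (S i)) (- (1 + 1)) * (/ INR N) ^ (k - 3)).
    2:{ replace ((/ INR N) ^ k) with ((/ INR N) ^ 3 * (/ INR N) ^ (k - 3)).
        - field. lra.
        - rewrite <- pow_add. f_equal. lia. }
    apply Rmult_le_compat; [left; apply exp_pos| | |].
    + left; apply Rinv_0_lt_compat, pow_lt; lra.
    + rewrite !Rpower_Ropp. apply Rinv_le_contravar; [apply exp_pos|].
      apply Rle_Rpower_l; lra.
    + rewrite pow_inv. apply Rinv_le_contravar; [apply pow_lt; lra|]. apply pow_incr; lra.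
  - unfold v. apply (ex_series_scal (V := R_NormedModule) (c * INR N ^ 3 * (/ INR N) ^ k)).
    apply ex_series_Rpower. lra.
  - unfold v. rewrite Series_scal_l. ring.
Qed.

Lemma euler_term_bound b delta M k n : euler_bound b delta M -> (3 <= k)%nat -> (1 <= n)%nat ->
  Cmod (euler_term b (RtoC (INR k)) n) <= 4 * Rabs M * Rpower (INR n) (1 - INR k).
Proof.
  intros Hb Hk Hn. unfold euler_term.
  assert (Hk3 : 3 <= INR k) by (apply INR_ge_3; lia).
  assert (1 <= INR n) by (apply (le_INR 1); lia).
  pose proof (Rabs_pos M). pose proof (Rle_abs M).
  destruct (nprime_dec n) as [Hp|Hp].
  - pose proof (euler_factor_expansion b delta M n (RtoC (INR k)) 0 Hb Hp ltac:(simpl; lra)) as H2.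
    cbn [Csum] in H2. replace (log_Euler_factor b n (RtoC (INR k)) - 0)%C
      with (log_Euler_factor b n (RtoC (INR k))) in H2 by ring.
    rewrite pow_1 in H2. eapply Rle_trans; [exact H2|].
    destruct (euler_factor_dominated b delta M n (RtoC (INR k)) Hb Hp ltac:(simpl; lra)) as [_ HM].
    apply Rmult_le_compat; [lra|left; apply exp_pos|lra|].
    apply Rpower_le_base; [lra|]. destruct Hb. simpl. lra.
  - rewrite Cmod_0. apply Rmult_le_pos; [lra|left; apply exp_pos].
Qed.

Lemma prime_series_cv_nat b delta M k : euler_bound b delta M -> (3 <= k)%nat ->
  prime_series_cv b (INR k).
Proof.
  intros [Hd Hb] Hk. unfold prime_series_cv.
  assert (Hk3 : 3 <= INR k) by (apply INR_ge_3; lia).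
  apply ex_series_incr_1.
  apply ex_series_Rabs_le with (fun n => Rabs M * Rpower (INR (S n)) (- (1 + 1))).
  - intros n. rewrite Rabs_pos_eq.
    2:{ apply Rmult_le_pos; [apply prime_abs_nonneg|left; apply exp_pos]. }
    assert (1 <= INR (S n)) by (apply (le_INR 1); lia).
    unfold prime_abs. destruct (nprime_dec (S n)) as [Hp|Hp].
    + specialize (Hb (S n) 1%nat Hp ltac:(lia)). rewrite Nat.pow_1_r in Hb.
      eapply Rle_trans; [apply Rmult_le_compat_r; [left; apply exp_pos|exact Hb]|].
      rewrite Rmult_assoc, <- Rpower_plus.
      apply Rle_trans with (Rabs M * Rpower (INR (S n)) (INR 1 * delta + - INR k)).
      * apply Rmult_le_compat_r; [left; apply exp_pos|apply Rle_abs].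
      * apply Rmult_le_compat_l; [apply Rabs_pos|]. apply Rpower_le_base; [lra|]. simpl INR. lra.
    + rewrite Rmult_0_l. apply Rmult_le_pos; [apply Rabs_pos|left; apply exp_pos].
  - apply (ex_series_scal (V := R_NormedModule)). apply ex_series_Rpower. lra.
Qed.

Lemma euler_factor_term_nat b n k i : (1 <= n)%nat ->
  euler_factor_term b n (RtoC (INR k)) i = (b (n ^ S i)%nat * pw (n ^ S i) k)%C.
Proof.
  intros Hn. unfold euler_factor_term. f_equal.
  rewrite <- RtoC_mult, <- mult_INR, ncpow_nat by exact Hn.
  unfold pw. rewrite pow_INR, pow_mult, pow_inv. reflexivity.
Qed.

Lemma euler_factor_rem b delta M n J : euler_bound b delta M -> nprime n ->
  eventually_le (/ INR (n ^ S J))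
    (fun k => log_Euler_factor b n (RtoC (INR k)) - Csum (euler_factor_term b n (RtoC (INR k))) J)%C.
Proof.
  intros Hb Hn.
  assert (H2 : 2 <= INR n) by (apply (le_INR 2); now apply nprime_ge_2).
  assert (HM : 0 <= M) by (eapply (euler_factor_dominated b delta M n 1); eauto; simpl; lra).
  assert (Hq : 0 < Rpower (INR n) delta) by apply exp_pos.
  exists (4 * M * Rpower (INR n) delta ^ S J), 1%nat.
  split; [apply Rmult_le_pos; [lra|apply pow_le; lra]|]. intros k Hk.
  assert (1 <= INR k) by (apply (le_INR 1); lia).
  eapply Rle_trans; [apply euler_factor_expansion with (delta := delta) (M := M); auto|].
  right. change (Re (RtoC (INR k))) with (INR k).
  unfold Rminus. rewrite Rpower_plus, Rpower_Ropp, Rpower_pow by lra.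
  rewrite Rpow_mult_distr, pow_INR, <- !pow_inv, <- !pow_mult, (Nat.mul_comm k). ring.
Qed.

Lemma no_term_0 p : no_term p (fun _ => RtoC 0).
Proof.
  apply no_term_big. exists 0, 0%nat. split; [lra|]. intros. rewrite Cmod_0. lra.
Qed.

Lemma pow_2_ge n : (S n <= 2 ^ S n)%nat.
Proof. induction n; simpl in *; lia. Qed.

(** No power of a prime [n < p] equals [p]. Splitting off [p] terms suffices because
    [n^{p + 1} >= 2^{p + 1} >= p + 1]. *)
Lemma no_term_euler_factor b delta M p n : euler_bound b delta M -> nprime p -> nprime n ->
  (n < p)%nat -> no_term p (fun k => log_Euler_factor b n (RtoC (INR k))).
Proof.
  intros Hb Hp Hn Hnp. pose proof (nprime_ge_2 n Hn) as Hn2.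
  apply (no_term_ext p (fun k => Csum (euler_factor_term b n (RtoC (INR k))) p +
    (log_Euler_factor b n (RtoC (INR k)) - Csum (euler_factor_term b n (RtoC (INR k))) p))%C _ 0%nat).
  { intros k _. ring. }
  apply no_term_plus.
  (* Separates the number of terms, on which the induction runs, from the prime [p]. *)
  - generalize p at 2. intros J. induction J as [|J IH]; simpl; [apply no_term_0|].
    apply no_term_plus; [exact IH|].
    apply (no_term_ext p (fun k => b (n ^ S J)%nat * pw (n ^ S J) k)%C _ 0%nat).
    { intros k _. symmetry. apply euler_factor_term_nat. lia. }
    apply no_term_pw.
    + pose proof (Nat.pow_nonzero n (S J)). lia.
    + intros E. assert (Hd : Nat.divide p (n ^ S J)) by (rewrite E; apply Nat.divide_refl).
      apply nprime_divide_pow in Hd; auto. lia.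
  - apply no_term_big. eapply eventually_le_weaken; [|eapply euler_factor_rem; eauto].
    apply inv_INR_le. split; [lia|].
    apply Nat.le_trans with (2 ^ S p)%nat; [apply pow_2_ge|].
    apply Nat.pow_le_mono_l; lia.
Qed.

Lemma log_L_tail b delta M N : euler_bound b delta M -> (1 <= N)%nat ->
  eventually_le (/ INR N)
    (fun k => log_L b (RtoC (INR k)) - Csum (euler_term b (RtoC (INR k))) N)%C.
Proof.
  intros Hb HN.
  set (Z := Series (fun i => Rpower (INR (S i)) (- (1 + 1)))).
  exists (Rabs (4 * Rabs M * INR N ^ 3 * Z)), 3%nat.
  split; [apply Rabs_pos|]. intros k Hk.
  assert (3 <= INR k) by (apply INR_ge_3; lia).
  pose proof (euler_term_dominated b delta M (RtoC (INR k)) Hb ltac:(simpl; lra)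
    (prime_series_cv_nat b delta M k Hb Hk)) as Hdom.
  change (log_L b (RtoC (INR k))) with (CSeries (euler_term b (RtoC (INR k)))).
  rewrite (CSeries_split _ _ N Hdom).
  match goal with |- Cmod ?z <= _ => replace z with
    (CSeries (fun i => euler_term b (RtoC (INR k)) (N + i)%nat)) by ring end.
  pose proof (Rabs_pos M).
  destruct (Series_tail_bound (fun i => euler_term b (RtoC (INR k)) (N + i)%nat) (4 * Rabs M) N k
    Hk HN ltac:(lra)) as [D E].
  { intros i. eapply euler_term_bound; eauto. lia. }
  eapply Rle_trans; [apply Cmod_CSeries_le, D|]. rewrite E. fold Z.
  apply Rmult_le_compat_r; [|apply Rle_abs]. apply pow_le. apply (inv_INR_le 1); lia.
Qed.

Lemma not_nprime_lt_2 n : (n < 2)%nat -> ~ nprime n.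
Proof. intros H Hp. apply nprime_ge_2 in Hp. lia. Qed.

Lemma euler_term_small b s n : (n < 2)%nat -> euler_term b s n = 0.
Proof.
  intros H. unfold euler_term. destruct (nprime_dec n) as [Hp|]; [|reflexivity].
  now apply not_nprime_lt_2 in H.
Qed.

(** The decay [O(2^{-k})], due to the absence of a term for [n = 1], is recorded as well: it is what
    makes the higher powers of [log L] harmless in the exponential. *)
Lemma log_L_expansion b delta M p : euler_bound b delta M -> nprime p ->
  let h := fun k => (log_L b (RtoC (INR k)) - b p * pw p k)%C in
  no_term p h /\ eventually_le (/ 2) h.
Proof.
  intros Hb Hp h. pose proof (nprime_ge_2 p Hp) as Hp2. split.
  - apply (no_term_ext p (fun k =>
      Csum (euler_term b (RtoC (INR k))) p
      + (log_Euler_factor b p (RtoC (INR k)) - Csum (euler_factor_term b p (RtoC (INR k))) 1)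
      + (log_L b (RtoC (INR k)) - Csum (euler_term b (RtoC (INR k))) (S p)))%C _ 0%nat).
    { intros k _. unfold h. rewrite Csum_1, euler_factor_term_nat, Nat.pow_1_r by lia.
      cbn [Csum]. unfold euler_term at 3. destruct (nprime_dec p); [|contradiction].
      ring. }
    apply no_term_plus; [apply no_term_plus|].
    + assert (H : forall N, (N <= p)%nat -> no_term p (fun k => Csum (euler_term b (RtoC (INR k))) N)).
      { induction N as [|N IH]; intros HN; cbn [Csum]; [apply no_term_0|].
        apply no_term_plus; [apply IH; lia|]. unfold euler_term.
        destruct (nprime_dec N) as [HpN|]; [|apply no_term_0].
        eapply no_term_euler_factor; eauto. }
      apply H. lia.
    + apply no_term_big. eapply eventually_le_weaken; [|eapply euler_factor_rem; eauto].
      apply inv_INR_le. simpl. nia.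
    + apply no_term_big. eapply log_L_tail; eauto. lia.
  - unfold h. apply (eventually_le_ext _ (fun k =>
      (log_L b (RtoC (INR k)) - Csum (euler_term b (RtoC (INR k))) 2) + (- b p) * pw p k)%C _ 0%nat).
    { intros k _. cbn [Csum]. rewrite !euler_term_small by lia. ring. }
    apply eventually_le_plus.
    + apply (log_L_tail b delta M 2); auto.
    + eapply eventually_le_weaken; [|apply eventually_le_pw].
      apply (inv_INR_le 2). lia.
Qed.

(** Write [l = b(p) p^{-k} + h]. A power [l^j] with [j >= 2] has no term in [p^{-k}]: products with
    [h] are handled by induction in the ring and by decay, and [b(p) p^{-k}] times [O(2^{-k})] is
    [O((2 p)^{-k})]. Only the linear term of the exponential contributes. *)
Lemma exp_log_L_expansion b delta M p : euler_bound b delta M -> nprime p ->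
  no_term p (fun k => Cexp (log_L b (RtoC (INR k))) - b p * pw p k)%C.
Proof.
  intros Hb Hp. destruct (log_L_expansion b delta M p Hb Hp) as [Hh Hh2].
  pose proof (nprime_ge_2 p Hp) as Hp2.
  set (h := fun k => (log_L b (RtoC (INR k)) - b p * pw p k)%C) in *.
  set (l := fun k => log_L b (RtoC (INR k))).
  assert (Hl : forall k, l k = (b p * pw p k + h k)%C) by (intros k; unfold l, h; ring).
  assert (Hl2 : eventually_le (/ 2) l).
  { apply (eventually_le_ext _ (fun k => b p * pw p k + h k)%C _ 0%nat); [intros; symmetry; apply Hl|].
    apply eventually_le_plus; [|exact Hh2].
    eapply eventually_le_weaken; [|apply eventually_le_pw]. apply (inv_INR_le 2). lia. }
  assert (Hsmall : forall f, eventually_le (/ 2) f -> no_term p (fun k => b p * pw p k * f k)%C).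
  { intros f Hf. apply no_term_big.
    eapply eventually_le_weaken; [|apply (eventually_le_mul (/ INR p) (/ 2)); [| |apply eventually_le_pw|exact Hf]].
    - rewrite <- Rinv_mult. change 2 with (INR 2). rewrite <- mult_INR. apply inv_INR_le. lia.
    - apply (inv_INR_le 1). lia.
    - lra. }
  assert (Hpow2 : forall j, no_term p (fun k => l k ^ S (S j))%C /\ eventually_le (/ 2) (fun k => l k ^ S (S j))%C).
  { assert (Hmul : forall f, no_term p f -> eventually_le (/ 2) f -> no_term p (fun k => f k * l k)%C).
    { intros f Hf Hf2.
      apply (no_term_ext p (fun k => f k * h k + b p * pw p k * f k)%C _ 0%nat).
      { intros k _. rewrite Hl. ring. }
      apply no_term_plus; [now apply no_term_mul|now apply Hsmall]. }
    assert (Hmul2 : forall f, eventually_le (/ 2) f -> eventually_le (/ 2) (fun k => f k * l k)%C).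
    { intros f Hf. eapply eventually_le_weaken; [|apply (eventually_le_mul (/ 2) (/ 2)); try lra; eauto]. lra. }
    induction j as [|j [IH1 IH2]].
    - split.
      + apply (no_term_ext p (fun k => h k * l k + b p * pw p k * l k)%C _ 0%nat).
        { intros k _. cbn [Cpow]. rewrite Hl. ring. }
        apply no_term_plus; [now apply Hmul|now apply Hsmall].
      + apply (eventually_le_ext _ (fun k => l k * l k)%C _ 0%nat); [intros; cbn [Cpow]; ring|auto].
    - split.
      + apply (no_term_ext p (fun k => l k ^ S (S j) * l k)%C _ 0%nat); [intros; cbn [Cpow]; ring|auto].
      + apply (eventually_le_ext _ (fun k => l k ^ S (S j) * l k)%C _ 0%nat); [intros; cbn [Cpow]; ring|auto]. }
  (* Truncation after degree [p + 1] leaves [O(2^{-(p + 2) k})], and [2^{p + 2} >= p + 1]. *)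
  apply (no_term_ext p (fun k => (Csum (exp_term (l k)) (S (S p)) - b p * pw p k)
     + (Cexp (l k) - Csum (exp_term (l k)) (S (S p))))%C _ 0%nat).
  { intros k _. unfold l. ring. }
  apply no_term_plus.
  - generalize p at 2. intros J. induction J as [|J IH].
    + apply (no_term_ext p (fun k => RtoC 1 * pw 1 k + h k)%C _ 0%nat).
      { intros k _. cbn [Csum]. unfold exp_term. cbn [Cpow fact Nat.mul Nat.add INR].
        rewrite Hl. unfold pw at 1. cbn [INR]. rewrite Rinv_1, pow1. ring. }
      apply no_term_plus; [apply no_term_pw; lia|exact Hh].
    + apply (no_term_ext p (fun k => (Csum (exp_term (l k)) (S (S J)) - b p * pw p k)
         + (RtoC (/ INR (fact (S (S J)))) * pw 1 k) * l k ^ S (S J))%C _ 0%nat).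
      { intros k _. change (Csum (exp_term (l k)) (S (S (S J)))) with
          (Csum (exp_term (l k)) (S (S J)) + exp_term (l k) (S (S J)))%C.
        unfold exp_term at 3. unfold pw at 2. change (INR 1) with 1. rewrite Rinv_1, pow1. ring. }
      apply no_term_plus; [exact IH|]. apply no_term_mul; [exact Hp| |apply Hpow2].
      apply no_term_pw; lia.
  - apply no_term_big. destruct Hl2 as [c [k0 [Hc Hl2]]].
    exists (c ^ S (S p) * exp c), k0.
    split; [apply Rmult_le_pos; [now apply pow_le|left; apply exp_pos]|]. intros k Hk.
    eapply Rle_trans; [apply Cexp_taylor|]. specialize (Hl2 k Hk).
    assert (Hh1 : 0 < (/ 2) ^ k) by (apply pow_lt; lra).
    assert (Hle1 : (/ 2) ^ k <= 1) by (rewrite <- (pow1 k); apply pow_incr; lra).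
    assert (Hlc : Cmod (l k) <= c) by nra.
    replace (c ^ S (S p) * exp c * (/ INR (S p)) ^ k) with ((c ^ S (S p) * (/ INR (S p)) ^ k) * exp c) by ring.
    apply Rmult_le_compat.
    + apply pow_le, Cmod_ge_0.
    + left; apply exp_pos.
    + eapply Rle_trans; [apply pow_incr; split; [apply Cmod_ge_0|exact Hl2]|].
      rewrite Rpow_mult_distr. apply Rmult_le_compat_l; [now apply pow_le|].
      rewrite <- pow_mult, Nat.mul_comm, pow_mult. apply pow_incr. split; [apply pow_le; lra|].
      rewrite pow_inv. apply Rinv_le_contravar; [apply lt_0_INR; lia|].
      change 2 with (INR 2). rewrite <- pow_INR. apply le_INR.
      apply Nat.le_trans with (S (S p)); [lia|apply pow_2_ge].
    + destruct Hlc as [H|H]; [left; now apply exp_increasing|right; now rewrite H].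
Qed.

(** The terms with [n < p] are permitted ones; those with [n > p] sum to [O((p + 1)^{-k})] because
    [a(n) = O(n)]. *)
Lemma dirichlet_expansion L a p : dirichlet_series a L -> ramanujan_bound a -> (1 <= p)%nat ->
  no_term p (fun k => L (RtoC (INR k)) - a p * pw p k)%C.
Proof.
  intros HL Ha Hp. destruct (Ha 1 ltac:(lra)) as [M0 HM0].
  set (M := Rabs M0).
  assert (HM : forall n, (1 <= n)%nat -> Cmod (a n) <= M * INR n).
  { intros n Hn. eapply Rle_trans; [apply HM0, Hn|]. rewrite Rpower_1 by (apply lt_0_INR; lia).
    apply Rmult_le_compat_r; [apply pos_INR|apply Rle_abs]. }
  assert (HMp : 0 <= M) by apply Rabs_pos.
  set (u := fun k i => (a (S i) * pw (S i) k)%C).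
  assert (HS : forall k, (3 <= k)%nat -> L (RtoC (INR k)) = CSeries (u k)).
  { intros k Hk. assert (3 <= INR k) by (apply INR_ge_3; lia).
    rewrite (is_series_C_CSeries _ _ (HL (RtoC (INR k)) ltac:(simpl; lra))).
    unfold CSeries. f_equal; apply Series_ext; intros n; cbv zeta; rewrite ncpow_nat by lia; reflexivity. }
  assert (Hu : forall k N i, (3 <= k)%nat ->
    Cmod (u k (N + i)%nat) <= M * Rpower (INR (S N + i)) (1 - INR k)).
  { intros k N i Hk. unfold u. rewrite Cmod_mult, Cmod_pw. change (S N + i)%nat with (S (N + i)).
    unfold Rminus. rewrite Rpower_plus, Rpower_1, Rpower_Ropp, Rpower_pow, pow_inv by (apply lt_0_INR; lia).
    rewrite <- Rmult_assoc. apply Rmult_le_compat_r; [|apply HM; lia].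
    left. apply Rinv_0_lt_compat, pow_lt, lt_0_INR. lia. }
  apply (no_term_ext p (fun k => Csum (u k) (pred p) + (L (RtoC (INR k)) - Csum (u k) p))%C _ 0%nat).
  { intros k _. destruct p; [lia|]. cbn [pred Csum]. unfold u at 3. ring. }
  apply no_term_plus.
  - assert (H : forall N, (N <= pred p)%nat -> no_term p (fun k => Csum (u k) N)).
    { induction N as [|N IH]; intros HN; cbn [Csum]; [apply no_term_0|].
      apply no_term_plus; [apply IH; lia|]. apply no_term_pw; lia. }
    apply H; lia.
  - apply no_term_big.
    set (Z := Series (fun i => Rpower (INR (S i)) (- (1 + 1)))).
    exists (Rabs (M * INR (S p) ^ 3 * Z)), 3%nat. split; [apply Rabs_pos|]. intros k Hk.
    destruct (Series_tail_bound (u k) M 1 k Hk ltac:(lia) HMp) as [D0 _].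
    { intros i. apply (Hu k 0%nat i Hk). }
    rewrite HS, (CSeries_split _ _ p D0) by exact Hk.
    match goal with |- Cmod ?z <= _ => replace z with (CSeries (fun i => u k (p + i)%nat)) by ring end.
    destruct (Series_tail_bound (fun i => u k (p + i)%nat) M (S p) k Hk ltac:(lia) HMp) as [D E].
    { intros i. now apply Hu. }
    eapply Rle_trans; [apply Cmod_CSeries_le, D|]. rewrite E. fold Z.
    apply Rmult_le_compat_r; [|apply Rle_abs]. apply pow_le. apply (inv_INR_le 1); lia.
Qed.

(** [L k] is expanded twice, from the Dirichlet series and from the exponential of [log_L];
    subtracting leaves [(b p - a p) p^{-k}] as a sequence with no term in [p^{-k}]. *)
Lemma coefficients_agree L a b delta M p : dirichlet_series a L -> ramanujan_bound a ->
  euler_product b L -> euler_bound b delta M -> nprime p -> b p = a p.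
Proof.
  intros HL Ha He Hb Hp. pose proof (nprime_ge_2 p Hp) as Hp2.
  pose proof (dirichlet_expansion L a p HL Ha ltac:(lia)) as H1.
  pose proof (exp_log_L_expansion b delta M p Hb Hp) as H2.
  assert (H : no_term p (fun k => (b p - a p) * pw p k)%C).
  { apply (no_term_ext p (fun k => (L (RtoC (INR k)) - a p * pw p k) +
      (RtoC (-1) * pw 1 k) * (Cexp (log_L b (RtoC (INR k))) - b p * pw p k))%C _ 3%nat).
    - intros k Hk. assert (3 <= INR k) by (apply INR_ge_3; lia).
      rewrite (L_eq_Cexp_log_L L b delta M (RtoC (INR k)) He Hb ltac:(simpl; lra)
        (prime_series_cv_nat b delta M k Hb Hk)).
      unfold pw at 2. change (INR 1) with 1. rewrite Rinv_1, pow1. ring.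
    - apply no_term_plus; [exact H1|]. apply no_term_mul; auto. apply no_term_pw; lia. }
  apply no_term_unique in H; [|lia].
  replace (b p) with ((b p - a p) + a p)%C by ring. rewrite H. ring.
Qed.

(** * Second-order expansions and the maximum principle *)

(** A pointwise substitute for analyticity. The order 2 is the one that the maximum principle asks
    for: its linear and quadratic terms cancel over four points, and the cubic error loses against a
    quadratic penalty. *)
Definition taylor2 (g : C -> C) (s : C) : Prop :=
  exists (A B : C) (c r : R), 0 < r /\ 0 <= c /\ forall w : C, Cmod w <= r ->
    Cmod (g (s + w) - (g s + A * w + B * (w * w)))%C <= c * Cmod w ^ 3.

Lemma taylor2_const (c s : C) : taylor2 (fun _ => c) s.
Proof.
  exists 0, 0, 0, 1. split; [lra|]. split; [lra|]. intros w _.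
  replace (c - (c + 0 * w + 0 * (w * w)))%C with (RtoC 0) by ring. rewrite Cmod_0. lra.
Qed.

Lemma taylor2_sub (c s : C) : taylor2 (fun s => s - c)%C s.
Proof.
  exists 1, 0, 0, 1. split; [lra|]. split; [lra|]. intros w _.
  replace (s + w - c - (s - c + 1 * w + 0 * (w * w)))%C with (RtoC 0) by ring. rewrite Cmod_0. lra.
Qed.

Lemma Cmod_triangle3 (x y z : C) : Cmod (x + y + z) <= Cmod x + Cmod y + Cmod z.
Proof. eapply Rle_trans; [apply Cmod_triangle|]. apply Rplus_le_compat_r, Cmod_triangle. Qed.

Lemma taylor2_mul (g h : C -> C) (s : C) : taylor2 g s -> taylor2 h s ->
  taylor2 (fun s => g s * h s)%C s.
Proof.
  intros [A [B [c [r [Hr [Hc H1]]]]]] [A' [B' [c' [r' [Hr' [Hc' H2]]]]]].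
  set (K := Cmod (g s) + Cmod A + Cmod B). set (K' := Cmod (h s) + Cmod A' + Cmod B').
  assert (HK : 0 <= K) by (unfold K; pose proof (Cmod_ge_0 (g s)); pose proof (Cmod_ge_0 A); pose proof (Cmod_ge_0 B); lra).
  assert (HK' : 0 <= K') by (unfold K'; pose proof (Cmod_ge_0 (h s)); pose proof (Cmod_ge_0 A'); pose proof (Cmod_ge_0 B'); lra).
  exists (g s * A' + A * h s)%C, (g s * B' + A * A' + B * h s)%C,
    (2 * (K * K') + K * c' + c * K' + c * c'), (Rmin 1 (Rmin r r')).
  split; [repeat apply Rmin_glb_lt; lra|]. split; [nra|]. intros w Hw.
  assert (Hw1 : Cmod w <= 1) by (eapply Rle_trans; [exact Hw|apply Rmin_l]).
  assert (Hwr : Cmod w <= r)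
    by (eapply Rle_trans; [exact Hw|]; eapply Rle_trans; [apply Rmin_r|apply Rmin_l]).
  assert (Hwr' : Cmod w <= r')
    by (eapply Rle_trans; [exact Hw|]; eapply Rle_trans; [apply Rmin_r|apply Rmin_r]).
  specialize (H1 w Hwr). specialize (H2 w Hwr').
  set (P := (g s + A * w + B * (w * w))%C) in *. set (P' := (h s + A' * w + B' * (w * w))%C) in *.
  set (E := (g (s + w) - P)%C) in *. set (E' := (h (s + w) - P')%C) in *.
  pose proof (Cmod_ge_0 w) as Hw0.
  set (t := Cmod w) in *.
  assert (Hpoly : forall X Y Z : C, Cmod (X + Y * w + Z * (w * w))%C <= Cmod X + Cmod Y + Cmod Z).
  { intros X Y Z. eapply Rle_trans; [apply Cmod_triangle3|]. rewrite !Cmod_mult. fold t.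
    pose proof (Cmod_ge_0 X). pose proof (Cmod_ge_0 Y). pose proof (Cmod_ge_0 Z).
    assert (Cmod Y * t <= Cmod Y) by nra. assert (t * t <= 1) by nra. assert (Cmod Z * (t * t) <= Cmod Z) by nra. lra. }
  assert (HP : Cmod P <= K) by apply Hpoly. assert (HP' : Cmod P' <= K') by apply Hpoly.
  replace (g (s + w) * h (s + w) - (g s * h s + (g s * A' + A * h s) * w + (g s * B' + A * A' + B * h s) * (w * w)))%C
    with ((A * B' + B * A' + B * B' * w) * (w * w * w) + (P * E' + E * P' + E * E'))%C
    by (unfold E, E', P, P'; ring).
  eapply Rle_trans; [apply Cmod_triangle|].
  assert (Ht3 : 0 <= t ^ 3) by (apply pow_le; lra).
  assert (T1 : Cmod ((A * B' + B * A' + B * B' * w) * (w * w * w))%C <= 2 * (K * K') * t ^ 3).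
  { rewrite Cmod_mult. replace (Cmod (w * w * w)) with (t ^ 3)
      by (rewrite !Cmod_mult; fold t; ring).
    apply Rmult_le_compat_r; [exact Ht3|].
    eapply Rle_trans; [apply Cmod_triangle3|]. rewrite !Cmod_mult. fold t. unfold K, K'.
    pose proof (Cmod_ge_0 (g s)). pose proof (Cmod_ge_0 A). pose proof (Cmod_ge_0 B).
    pose proof (Cmod_ge_0 (h s)). pose proof (Cmod_ge_0 A'). pose proof (Cmod_ge_0 B').
    assert (HBB : 0 <= Cmod B * Cmod B') by (apply Rmult_le_pos; lra).
    assert (Cmod B * Cmod B' * t <= Cmod B * Cmod B') by nra.
    assert (0 <= Cmod (g s) * (Cmod (h s) + Cmod A' + Cmod B')) by (apply Rmult_le_pos; lra).
    assert (0 <= Cmod A * (Cmod (h s) + Cmod A')) by (apply Rmult_le_pos; lra).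
    assert (0 <= Cmod B * Cmod (h s)) by (apply Rmult_le_pos; lra).
    assert (0 <= Cmod A * Cmod B') by (apply Rmult_le_pos; lra).
    assert (0 <= Cmod B * Cmod A') by (apply Rmult_le_pos; lra).
    lra. }
  assert (T2 : Cmod (P * E' + E * P' + E * E')%C <= (K * c' + c * K' + c * c') * t ^ 3).
  { eapply Rle_trans; [apply Cmod_triangle3|]. rewrite !Cmod_mult.
    assert (Ht31 : t ^ 3 <= 1) by (rewrite <- (pow1 3); apply pow_incr; lra).
    assert (Cmod P * Cmod E' <= K * (c' * t ^ 3)) by (apply Rmult_le_compat; auto; apply Cmod_ge_0).
    assert (Cmod E * Cmod P' <= (c * t ^ 3) * K') by (apply Rmult_le_compat; auto; apply Cmod_ge_0).
    assert (Cmod E * Cmod E' <= (c * t ^ 3) * c').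
    { apply Rmult_le_compat; auto; try apply Cmod_ge_0.
      eapply Rle_trans; [exact H2|]. rewrite <- (Rmult_1_r c') at 2. apply Rmult_le_compat_l; lra. }
    lra. }
  lra.
Qed.

Lemma taylor2_pow (g : C -> C) (s : C) (n : nat) : taylor2 g s -> taylor2 (fun s => g s ^ n)%C s.
Proof.
  intros H. induction n as [|n IH]; cbn [Cpow]; [apply taylor2_const|].
  now apply taylor2_mul.
Qed.

Lemma CSeries_plus u1 v1 u2 v2 : dominated u1 v1 -> dominated u2 v2 ->
  CSeries (fun n => u1 n + u2 n)%C = (CSeries u1 + CSeries u2)%C.
Proof.
  intros H1 H2. unfold CSeries, Cplus; simpl. f_equal.
  - rewrite <- Series_plus by (eapply dominated_ex_Re; eauto). reflexivity.
  - rewrite <- Series_plus by (eapply dominated_ex_Im; eauto). reflexivity.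
Qed.

Lemma CSeries_scal c u v : dominated u v -> CSeries (fun n => c * u n)%C = (c * CSeries u)%C.
Proof.
  intros H.
  assert (HI : forall z, Im z = Re (- Ci * z)%C) by (intros [x y]; unfold Re, Im; simpl; ring).
  rewrite (surjective_pairing (c * CSeries u)%C). unfold CSeries at 1. f_equal.
  - apply is_series_unique. exact (Re_Cmult_CSeries c u v H).
  - change (snd (c * CSeries u)%C) with (Im (c * CSeries u)%C). rewrite HI, Cmult_assoc.
    apply is_series_unique. eapply is_series_ext; [|exact (Re_Cmult_CSeries (- Ci * c)%C u v H)].
    intros n. cbv beta. rewrite HI, Cmult_assoc. reflexivity.
Qed.

(** Used with [x = ln n]: up to three logarithms cost [n^eta]. The cubic case is the cube of
    [e^{y/3} >= y/3], hence [27 = 3^3]; the summand 1 covers [x <= 1]. *)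
Lemma ln_pow_le (x eta : R) (j : nat) : 0 <= x -> 0 < eta -> (j <= 3)%nat ->
  x ^ j <= (1 + 27 / eta ^ 3) * exp (eta * x).
Proof.
  intros Hx He Hj.
  assert (H3 : x ^ 3 <= 27 / eta ^ 3 * exp (eta * x)).
  { assert (H1 : x <= 3 / eta * exp (eta * x / 3)).
    { pose proof (exp_ineq1_le (eta * x / 3)).
      apply Rle_trans with (3 / eta * (eta * x / 3)); [right; field; lra|].
      apply Rmult_le_compat_l; [left; apply Rdiv_lt_0_compat; lra|lra]. }
    apply Rle_trans with ((3 / eta * exp (eta * x / 3)) ^ 3); [apply pow_incr; lra|].
    right. rewrite Rpow_mult_distr.
    replace (exp (eta * x)) with (exp (eta * x / 3) ^ 3).
    - field. lra.
    - simpl. rewrite Rmult_1_r, <- !exp_plus. f_equal. field. }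
  assert (He1 : 1 <= exp (eta * x)) by (pose proof (exp_ineq1_le (eta * x)); nra).
  assert (Hj3 : x ^ j <= 1 + x ^ 3).
  { assert (0 <= x ^ 3) by (apply pow_le; lra).
    destruct j as [|[|[|[|j]]]]; simpl; try lia; simpl in H; destruct (Rle_dec x 1); nra. }
  lra.
Qed.

Lemma ncpow_shift n s w :
  ncpow n (- (s + w)) = (ncpow n (- s) * Cexp (RtoC (- ln (INR n)) * w))%C.
Proof.
  unfold ncpow, rcpow. rewrite <- Cexp_plus. f_equal.
  rewrite RtoC_opp. ring.
Qed.

Lemma dirichlet_taylor2 L a s : dirichlet_series a L -> ramanujan_bound a -> 1 < Re s ->
  taylor2 L s.
Proof.
  (* Of the excess [4 eta] of [Re s] over 1, one [eta] goes to the coefficients, one to the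
     logarithms and one to the shift [w]; the last keeps the series convergent. *)
  intros HL Ha Hs. set (eta := (Re s - 1) / 4). assert (He : 0 < eta) by (unfold eta; lra).
  destruct (Ha eta He) as [M0 HM0]. set (M := Rabs M0).
  assert (HM : 0 <= M) by apply Rabs_pos.
  set (K := 1 + 27 / eta ^ 3).
  assert (HK : 1 <= K).
  { unfold K. assert (0 < 27 / eta ^ 3) by (apply Rdiv_lt_0_compat; [lra|apply pow_lt; lra]). lra. }
  set (x := fun i => ln (INR (S i))).
  assert (Hx : forall i, 0 <= x i).
  { intros i. unfold x. rewrite <- ln_1. apply ln_le; [lra|]. apply (le_INR 1); lia. }
  set (t := fun i => (a (S i) * ncpow (S i) (- s))%C).
  set (v := fun i => M * K * Rpower (INR (S i)) (- (1 + eta))).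
  assert (Hv : ex_series v).
  { apply (ex_series_scal (V := R_NormedModule) (M * K)). now apply ex_series_Rpower. }
  assert (Ht : forall i, Cmod (t i) <= M * exp ((eta - Re s) * x i)).
  { intros i. unfold t. rewrite Cmod_mult, Cmod_ncpow.
    replace (M * exp ((eta - Re s) * x i)) with ((M * Rpower (INR (S i)) eta) * Rpower (INR (S i)) (Re (- s)%C)).
    - apply Rmult_le_compat_r; [left; apply exp_pos|].
      eapply Rle_trans; [apply HM0; lia|]. apply Rmult_le_compat_r; [left; apply exp_pos|apply Rle_abs].
    - rewrite Rmult_assoc, <- Rpower_plus. rewrite re_opp. reflexivity. }
  assert (Hdom : forall i j r, (j <= 3)%nat -> r <= eta ->
    Cmod (t i) * (x i ^ j * exp (r * x i)) <= v i).
  { intros i j r Hj Hr. unfold v, Rpower. fold (x i).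
    specialize (Hx i). specialize (Ht i).
    pose proof (ln_pow_le (x i) eta j Hx He Hj) as Hp. fold K in Hp.
    assert (Her : exp (r * x i) <= exp (eta * x i)).
    { assert (Hrr : r * x i <= eta * x i) by nra.
      destruct Hrr as [Hrr|Hrr]; [left; now apply exp_increasing|right; now rewrite Hrr]. }
    replace (M * K * exp (- (1 + eta) * x i))
      with ((M * exp ((eta - Re s) * x i)) * ((K * exp (eta * x i)) * exp (eta * x i))).
    2:{ transitivity (M * K * (exp ((eta - Re s) * x i) * exp (eta * x i) * exp (eta * x i))); [ring|].
        rewrite <- !exp_plus. f_equal. f_equal. unfold eta. field. }
    apply Rmult_le_compat; [apply Cmod_ge_0| |exact Ht|].
    - apply Rmult_le_pos; [now apply pow_le|left; apply exp_pos].
    - apply Rmult_le_compat; [now apply pow_le|left; apply exp_pos|exact Hp|exact Her]. }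
  assert (Hdom0 : forall i j, (j <= 3)%nat -> Cmod (t i) * x i ^ j <= v i).
  { intros i j Hj. pose proof (Hdom i j 0 Hj ltac:(lra)) as H. rewrite Rmult_0_l, exp_0, Rmult_1_r in H. exact H. }
  set (tA := fun i => (RtoC (- x i) * t i)%C).
  set (tB := fun i => (RtoC (x i ^ 2 / 2) * t i)%C).
  assert (D0 : dominated t v).
  { split; [|exact Hv]. intros i. pose proof (Hdom0 i 0%nat ltac:(lia)) as H. simpl in H. lra. }
  assert (DA : dominated tA v).
  { split; [|exact Hv]. intros i. unfold tA. rewrite Cmod_mult, Cmod_R, Rabs_Ropp, Rabs_pos_eq by auto.
    pose proof (Hdom0 i 1%nat ltac:(lia)) as H. rewrite pow_1 in H. lra. }
  assert (DB : dominated tB v).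
  { split; [|exact Hv]. intros i. unfold tB. rewrite Cmod_mult, Cmod_R.
    assert (0 <= x i ^ 2) by (apply pow2_ge_0). rewrite Rabs_pos_eq by lra.
    pose proof (Hdom0 i 2%nat ltac:(lia)) as H'.
    assert (0 <= Cmod (t i) * x i ^ 2) by (apply Rmult_le_pos; [apply Cmod_ge_0|lra]). lra. }
  exists (CSeries tA), (CSeries tB), (Series v), eta.
  split; [exact He|]. split.
  { eapply Rle_trans; [|apply (Cmod_CSeries_le t v D0)]. apply Cmod_ge_0. }
  intros w Hw.
  (* Remainders of [n^{-w}] after its quadratic term, cubic in [w] by [Cexp_taylor]. *)
  set (d := fun i => (t i * (Cexp (RtoC (- x i) * w) - Csum (exp_term (RtoC (- x i) * w)) 3))%C).
  assert (Dd : dominated d (fun i => v i * Cmod w ^ 3)).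
  { split.
    - intros i. unfold d. rewrite Cmod_mult.
      eapply Rle_trans; [apply Rmult_le_compat_l; [apply Cmod_ge_0|apply Cexp_taylor]|].
      rewrite Cmod_mult, Cmod_R, Rabs_Ropp, Rabs_pos_eq by auto.
      pose proof (Hdom i 3%nat (Cmod w) ltac:(lia) Hw) as H.
      replace (Cmod (t i) * ((x i * Cmod w) ^ 3 * exp (x i * Cmod w)))
        with ((Cmod (t i) * (x i ^ 3 * exp (Cmod w * x i))) * Cmod w ^ 3)
        by (rewrite (Rmult_comm (x i) (Cmod w)); ring).
      apply Rmult_le_compat_r; [apply pow_le, Cmod_ge_0|exact H].
    - apply (ex_series_ext (fun i => scal (Cmod w ^ 3) (v i))).
      + intros n. unfold scal; simpl; unfold mult; simpl. ring.
      + now apply (ex_series_scal (V := R_NormedModule)). }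
  assert (E1 : L s = CSeries t) by (apply is_series_C_CSeries; exact (HL s Hs)).
  assert (E2 : L (s + w)%C = CSeries (fun i => d i + (t i + (w * tA i + (w * w) * tB i)))%C).
  { assert (Hsw : 1 < Re (s + w)%C).
    { rewrite re_plus. pose proof (Rabs_Re_le_Cmod w) as H. apply Rabs_le_between in H.
      unfold eta in Hw. lra. }
    rewrite (is_series_C_CSeries _ _ (HL (s + w)%C Hsw)).
    assert (E : forall i, (a (S i) * ncpow (S i) (- (s + w)))%C = (d i + (t i + (w * tA i + (w * w) * tB i)))%C).
    { intros i. rewrite ncpow_shift. unfold d, tA, tB, t. fold (x i). cbn [Csum]. unfold exp_term.
      cbn [Cpow fact Nat.mul Nat.add INR].
      replace (x i ^ 2 / 2) with (x i * x i * / 2) by (simpl; field).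
      rewrite !RtoC_mult, Rinv_1, RtoC_opp. replace (1 + 1) with 2 by ring. ring. }
    unfold CSeries. f_equal; apply Series_ext; intros i; cbv zeta; rewrite E; reflexivity. }
  assert (DwA : dominated (fun i => w * tA i)%C (fun i => Cmod w * v i)).
  { split; [intros i; rewrite Cmod_mult; apply Rmult_le_compat_l; [apply Cmod_ge_0|apply DA]|].
    now apply (ex_series_scal (V := R_NormedModule)). }
  assert (DwB : dominated (fun i => (w * w) * tB i)%C (fun i => Cmod (w * w) * v i)).
  { split; [intros i; rewrite (Cmod_mult (w * w)); apply Rmult_le_compat_l; [apply Cmod_ge_0|apply DB]|].
    now apply (ex_series_scal (V := R_NormedModule)). }
  assert (Dsum : forall u1 v1 u2 v2, dominated u1 v1 -> dominated u2 v2 ->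
    dominated (fun i => u1 i + u2 i)%C (fun i => v1 i + v2 i)).
  { intros u1 v1 u2 v2 [H1 H1'] [H2 H2']. split.
    - intros i. eapply Rle_trans; [apply Cmod_triangle|]. now apply Rplus_le_compat.
    - now apply (ex_series_plus (V := R_NormedModule)). }
  rewrite E1, E2.
  rewrite (CSeries_plus _ _ _ _ Dd (Dsum _ _ _ _ D0 (Dsum _ _ _ _ DwA DwB))).
  rewrite (CSeries_plus _ _ _ _ D0 (Dsum _ _ _ _ DwA DwB)).
  rewrite (CSeries_plus _ _ _ _ DwA DwB).
  rewrite (CSeries_scal _ _ _ DA), (CSeries_scal _ _ _ DB).
  match goal with |- Cmod ?z <= _ => replace z with (CSeries d) by ring end.
  eapply Rle_trans; [apply (Cmod_CSeries_le _ _ Dd)|].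
  rewrite (Series_ext _ (fun i => Cmod w ^ 3 * v i)) by (intros; ring).
  rewrite Series_scal_l. lra.
Qed.

(** * The maximum principle on rectangles *)

Lemma extreme_value_2d (f : R -> R -> R) (x1 x2 y1 y2 : R) : x1 <= x2 -> y1 <= y2 ->
  (forall x y, continuity_2d_pt f x y) ->
  exists x0 y0, x1 <= x0 <= x2 /\ y1 <= y0 <= y2 /\
    forall x y, x1 <= x <= x2 -> y1 <= y <= y2 -> f x y <= f x0 y0.
Proof.
  intros Hx Hy Hf.
  assert (HY : forall x, exists y, (forall y', y1 <= y' <= y2 -> f x y' <= f x y) /\ y1 <= y <= y2).
  { intros x. apply continuity_ab_maj; [exact Hy|]. intros y _.
    intros eps Heps. destruct (Hf x y (mkposreal eps Heps)) as [d Hd].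
    exists d. split; [apply cond_pos|]. intros y' [_ Hy']. apply Hd; [|exact Hy'].
    rewrite Rminus_diag, Rabs_R0. apply cond_pos. }
  (* [Y x] maximizes over a vertical segment. Uniform continuity makes the maximal value continuous
     in [x], although [Y] itself need not be. *)
  destruct (functional_choice _ HY) as [Y HYs].
  destruct (continuity_ab_maj (fun x => f x (Y x)) x1 x2 Hx) as [x0 [Hmax Hx0]].
  { intros c Hc eps Heps.
    destruct (uniform_continuity_2d f (x1 - 1) (x2 + 1) y1 y2 (fun x y _ _ => Hf x y)
      (mkposreal eps Heps)) as [d Hd].
    exists (Rmin d 1). split; [apply Rmin_glb_lt; [apply cond_pos|lra]|].
    intros x [_ Hxc]. simpl in Hxc |- *. unfold R_dist in *.
    assert (Hx1 : Rabs (x - c) < d) by (eapply Rlt_le_trans; [exact Hxc|apply Rmin_l]).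
    assert (Hx2 : Rabs (x - c) < 1) by (eapply Rlt_le_trans; [exact Hxc|apply Rmin_r]).
    apply Rabs_lt_between in Hx2.
    destruct (HYs x) as [Mx Ix]. destruct (HYs c) as [Mc Ic].
    assert (H0 : forall y : R, Rabs (y - y) < d) by (intros; rewrite Rminus_diag, Rabs_R0; apply cond_pos).
    pose proof (Hd c (Y x) x (Y x) ltac:(lra) Ix ltac:(lra) Ix Hx1 (H0 _)) as B1.
    pose proof (Hd c (Y c) x (Y c) ltac:(lra) Ic ltac:(lra) Ic Hx1 (H0 _)) as B2.
    simpl in B1, B2. apply Rabs_lt_between in B1. apply Rabs_lt_between in B2.
    specialize (Mx (Y c) Ic). specialize (Mc (Y x) Ix).
    apply Rabs_lt_between. lra. }
  exists x0, (Y x0). split; [exact Hx0|]. split; [apply HYs|].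
  intros x y Ix Iy. eapply Rle_trans; [apply (proj1 (HYs x)), Iy|]. now apply Hmax.
Qed.

(* At an interior maximum of [|G| + e x^2] the sum of the values at the four points at distance
   [rho] exceeds four times the maximum by [2 e rho^2 - O(rho^3)]. *)
Lemma no_interior_maximum (G : C -> C) (x y e r0 : R) : 0 < e -> 0 < r0 -> taylor2 G (x, y) ->
  ~ (forall u v, Rabs (u - x) <= r0 -> Rabs (v - y) <= r0 ->
       Cmod (G (u, v)) + e * u ^ 2 <= Cmod (G (x, y)) + e * x ^ 2).
Proof.
  intros He Hr0 [A [B [c [r [Hr [Hc HT]]]]]] Hmax.
  destruct (Cmod_unit_dual (G (x, y))) as [w [Hw Hwz]].
  (* The last bound on [rho] makes [4 c rho^3 < 2 e rho^2], against the inequality obtained by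
     adding up the four points. *)
  set (rho := Rmin (Rmin r r0) (e / (2 * c + e + 1))).
  assert (Hq : 0 < e / (2 * c + e + 1)) by (apply Rdiv_lt_0_compat; lra).
  assert (Hrho : 0 < rho) by (unfold rho; repeat apply Rmin_glb_lt; lra).
  assert (R1 : rho <= r) by (unfold rho; eapply Rle_trans; [apply Rmin_l|apply Rmin_l]).
  assert (R2 : rho <= r0) by (unfold rho; eapply Rle_trans; [apply Rmin_l|apply Rmin_r]).
  assert (R3 : rho * (2 * c + e + 1) <= e).
  { apply Rle_div_r; [lra|]. unfold rho. apply Rmin_r. }
  assert (Hpt : forall p q, Cmod (p, q) = rho ->
    Cmod (G (x, y)) + Re (w * A * (p, q))%C + Re (w * B * ((p, q) * (p, q)))%C - c * rho ^ 3
      <= Cmod (G (x + p, y + q))).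
  { intros p q Hpq. pose proof (HT (p, q) ltac:(lra)) as H. rewrite Hpq in H.
    change ((x, y) + (p, q))%C with (x + p, y + q) in H.
    set (z := G (x + p, y + q)) in *.
    set (E := (z - (G (x, y) + A * (p, q) + B * ((p, q) * (p, q))))%C) in H.
    pose proof (Re_le_Cmod (w * z)%C) as H1. rewrite Cmod_mult, Hw, Rmult_1_l in H1.
    replace (w * z)%C with
      (w * G (x, y) + w * A * (p, q) + w * B * ((p, q) * (p, q)) + w * E)%C in H1
      by (unfold E; ring).
    rewrite !re_plus, Hwz in H1.
    pose proof (Rabs_Re_le_Cmod (w * E)%C) as H2. rewrite Cmod_mult, Hw, Rmult_1_l in H2.
    apply Rabs_le_between in H2. lra. }
  assert (M1 : Cmod (rho, 0) = rho).
  { change (rho, 0) with (RtoC rho). rewrite Cmod_R. apply Rabs_pos_eq; lra. }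
  assert (M2 : Cmod (- rho, 0) = rho).
  { change (- rho, 0) with (RtoC (- rho)). rewrite Cmod_R, Rabs_Ropp. apply Rabs_pos_eq; lra. }
  assert (M3 : forall q, Rabs q = rho -> Cmod (0, q) = rho).
  { intros q Hq'. unfold Cmod; simpl. replace (0 * (0 * 1) + q * (q * 1)) with (Rsqr q) by (unfold Rsqr; ring).
    rewrite sqrt_Rsqr_abs. exact Hq'. }
  pose proof (Hpt rho 0 M1) as P1. pose proof (Hpt (- rho) 0 M2) as P2.
  pose proof (Hpt 0 rho (M3 _ ltac:(apply Rabs_pos_eq; lra))) as P3.
  pose proof (Hpt 0 (- rho) (M3 _ ltac:(rewrite Rabs_Ropp; apply Rabs_pos_eq; lra))) as P4.
  assert (Hin : forall d, Rabs d <= rho -> forall z, Rabs (z + d - z) <= r0).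
  { intros d Hd z. replace (z + d - z) with d by ring. lra. }
  assert (Ha : Rabs rho <= rho) by (rewrite Rabs_pos_eq; lra).
  assert (Hb : Rabs (- rho) <= rho) by (rewrite Rabs_Ropp; lra).
  assert (H0 : Rabs 0 <= rho) by (rewrite Rabs_R0; lra).
  pose proof (Hmax _ _ (Hin _ Ha x) (Hin _ H0 y)) as Q1.
  pose proof (Hmax _ _ (Hin _ Hb x) (Hin _ H0 y)) as Q2.
  pose proof (Hmax _ _ (Hin _ H0 x) (Hin _ Ha y)) as Q3.
  pose proof (Hmax _ _ (Hin _ H0 x) (Hin _ Hb y)) as Q4.
  destruct (w * A)%C as [a1 a2]. destruct (w * B)%C as [b1 b2].
  unfold Re, Cmult in P1, P2, P3, P4. simpl in P1, P2, P3, P4.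
  assert (Hfin : 2 * e * rho ^ 2 <= 4 * c * rho ^ 3) by (simpl; lra).
  assert (rho * (rho * (2 * c + e + 1)) <= rho * e) by (apply Rmult_le_compat_l; lra).
  assert (rho * (rho * (rho * (2 * c + e + 1))) <= rho * (rho * e)) by (apply Rmult_le_compat_l; nra).
  assert (0 < rho ^ 3) by (apply pow_lt; lra). simpl in *. nra.
Qed.

(** The penalty [e x^2] forces the maximum onto the boundary; [e] is chosen so that the penalty
    never exceeds half of the supposed excess over [B]. *)
Lemma maximum_principle (G : C -> C) (x1 x2 y1 y2 B : R) : x1 < x2 -> y1 < y2 ->
  (forall x y, continuity_2d_pt (fun x y => Cmod (G (x, y))) x y) ->
  (forall x y, x1 < x < x2 -> y1 < y < y2 -> taylor2 G (x, y)) ->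
  (forall x y, x1 <= x <= x2 -> y1 <= y <= y2 -> (x = x1 \/ x = x2 \/ y = y1 \/ y = y2) ->
     Cmod (G (x, y)) <= B) ->
  forall x y, x1 <= x <= x2 -> y1 <= y <= y2 -> Cmod (G (x, y)) <= B.
Proof.
  intros Hx Hy Hc HT HB x y Ix Iy.
  set (D := x1 ^ 2 + x2 ^ 2 + 1).
  assert (HD : forall u, x1 <= u <= x2 -> u ^ 2 <= D) by (intros u Hu; unfold D; destruct (Rle_dec 0 u); nra).
  assert (HD1 : 1 <= D) by (unfold D; nra).
  apply Rnot_lt_le. intros Hlt.
  set (e := (Cmod (G (x, y)) - B) / (2 * D)).
  assert (He : 0 < e) by (unfold e; apply Rdiv_lt_0_compat; lra).
  destruct (extreme_value_2d (fun x y => Cmod (G (x, y)) + e * x ^ 2) x1 x2 y1 y2)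
    as [u [v [Iu [Iv Hmax]]]]; try lra.
  { intros p q. apply continuity_2d_pt_plus; [apply Hc|].
    apply (continuity_1d_2d_pt_comp (fun x => e * x ^ 2) (fun x _ => x)).
    - apply derivable_continuous_pt. apply derivable_pt_scal, derivable_pt_pow.
    - apply continuity_2d_pt_id1. }
  assert (Hbd : u = x1 \/ u = x2 \/ v = y1 \/ v = y2).
  { destruct (Req_dec u x1) as [|N1]; [tauto|]. destruct (Req_dec u x2) as [|N2]; [tauto|].
    destruct (Req_dec v y1) as [|N3]; [tauto|]. destruct (Req_dec v y2) as [|N4]; [tauto|].
    exfalso.
    set (r0 := Rmin (Rmin (u - x1) (x2 - u)) (Rmin (v - y1) (y2 - v))).
    assert (r0 <= u - x1) by (unfold r0; eapply Rle_trans; [apply Rmin_l|apply Rmin_l]).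
    assert (r0 <= x2 - u) by (unfold r0; eapply Rle_trans; [apply Rmin_l|apply Rmin_r]).
    assert (r0 <= v - y1) by (unfold r0; eapply Rle_trans; [apply Rmin_r|apply Rmin_l]).
    assert (r0 <= y2 - v) by (unfold r0; eapply Rle_trans; [apply Rmin_r|apply Rmin_r]).
    apply (no_interior_maximum G u v e r0 He).
    - unfold r0. repeat apply Rmin_glb_lt; lra.
    - apply HT; lra.
    - intros p q Hp Hq. apply Rabs_le_between in Hp. apply Rabs_le_between in Hq.
      apply Hmax; lra. }
  pose proof (HB u v Iu Iv Hbd). pose proof (Hmax x y Ix Iy) as Hm. simpl in Hm.
  pose proof (HD u Iu) as HDu. simpl in HDu.
  assert (e * (2 * D) = Cmod (G (x, y)) - B) by (unfold e; field; lra).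
  assert (0 <= x * (x * 1)) by nra. nra.
Qed.

(** * Large values to the right of the line [Re s = 1] *)

Lemma polar_form (z : C) : exists alpha, Re z = Cmod z * cos alpha /\ Im z = Cmod z * sin alpha.
Proof.
  destruct (Ceq_dec z 0) as [->|Hz].
  - exists 0. rewrite Cmod_0. simpl. split; ring.
  - assert (Hm : 0 < Cmod z) by now apply Cmod_gt_0.
    assert (E : Cmod z * Cmod z = Re z * Re z + Im z * Im z).
    { unfold Cmod, Re, Im. rewrite sqrt_sqrt; nra. }
    set (c := Re z / Cmod z). set (s := Im z / Cmod z).
    assert (Ec : Re z = Cmod z * c) by (unfold c; field; lra).
    assert (Es : Im z = Cmod z * s) by (unfold s; field; lra).
    assert (Hcs : c * c + s * s = 1).
    { apply Rmult_eq_reg_l with (Cmod z * Cmod z); [|nra]. rewrite E at 2. rewrite Ec, Es. ring. }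
    assert (Hc : -1 <= c <= 1) by nra.
    assert (Hq : 1 - c² = s²) by (unfold Rsqr; lra).
    destruct (Rle_dec 0 s) as [Hs|Hs].
    + exists (acos c). rewrite cos_acos, sin_acos, Hq, sqrt_Rsqr by lra. split; assumption.
    + exists (- acos c). rewrite cos_neg, sin_neg, cos_acos, sin_acos, Hq, sqrt_Rsqr_abs, Rabs_left by lra.
      split; [assumption|]. rewrite Ropp_involutive. assumption.
Qed.

Definition primes_upto (X : nat) : list nat :=
  filter (fun n => if nprime_dec n then true else false) (seq 0 (S X)).

Lemma lsum_app {A : Type} (f : A -> R) l l' : lsum f (l ++ l') = lsum f l + lsum f l'.
Proof. induction l; simpl; [ring|]. rewrite IHl; ring. Qed.

Lemma lsum_primes_upto (g : nat -> R) (X : nat) : (forall n, ~ nprime n -> g n = 0) ->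
  lsum g (primes_upto X) = sum_f_R0 g X.
Proof.
  intros Hg. unfold primes_upto.
  assert (H1 : forall n, lsum g (filter (fun n => if nprime_dec n then true else false) [n]) = g n).
  { intros n. simpl. destruct (nprime_dec n) as [Hp|Hp]; simpl; [ring|]. rewrite Hg; auto. }
  induction X as [|X IH].
  - apply H1.
  - rewrite seq_S, filter_app, lsum_app, IH, H1. reflexivity.
Qed.

Lemma primes_upto_spec X p : In p (primes_upto X) -> nprime p /\ (p <= X)%nat.
Proof.
  unfold primes_upto. rewrite filter_In, in_seq. intros [H1 H2].
  destruct (nprime_dec p); [|discriminate]. split; [assumption|lia].
Qed.

Lemma primes_upto_NoDup X : NoDup (primes_upto X).
Proof. apply NoDup_filter, seq_NoDup. Qed.

Lemma primes_upto_length X : (length (primes_upto X) <= S X)%nat.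
Proof. unfold primes_upto. eapply Nat.le_trans; [apply filter_length_le|]. rewrite length_seq. lia. Qed.

Lemma lprod_le_pow {A : Type} (f : A -> R) (c : R) (l : list A) :
  (forall x, In x l -> 0 <= f x <= c) -> lprod f l <= c ^ length l.
Proof.
  induction l as [|x l IH]; intros H; simpl; [lra|].
  destruct (H x (or_introl eq_refl)) as [H0 H1].
  apply Rmult_le_compat; [exact H0| |exact H1|apply IH; intros; apply H; right; auto].
  assert (Hl : forall y, In y l -> 0 <= f y) by (intros y Hy; apply H; right; auto).
  clear -Hl. induction l; simpl; [lra|].
  apply Rmult_le_pos; [apply Hl; left; reflexivity|apply IHl; intros; apply Hl; right; auto].
Qed.

(** With [z = X + 1] the left side is at most [z^2 z^{z + 1} z^{z^2} <= z^{z^3} <= e^{z^4}]. *)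
Lemma kronecker_size_bound (X : nat) (T : R) : (2 <= X)%nat -> exp (INR (S X) ^ 4) <= T ->
  4 * INR (S X) ^ S (length (primes_upto X)) * lprod (fun q => INR q ^ S X) (primes_upto X) <= T.
Proof.
  intros HX HT. eapply Rle_trans; [|exact HT].
  pose proof (primes_upto_length X) as HN.
  set (Z := S X) in *. set (z := INR Z). set (N := length (primes_upto X)) in *.
  assert (Hz : 3 <= z) by (apply INR_ge_3; lia).
  assert (H1 : lprod (fun q => INR q ^ Z) (primes_upto X) <= z ^ (Z * Z)).
  { eapply Rle_trans; [apply (lprod_le_pow _ (z ^ Z))|].
    - intros q Hq. apply primes_upto_spec in Hq. split; [apply pow_le, pos_INR|].
      apply pow_incr. split; [apply pos_INR|]. apply le_INR. lia.
    - rewrite <- pow_mult. apply Rle_pow; [lra|]. fold N. nia. }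
  assert (H2 : z ^ S N <= z ^ S Z) by (apply Rle_pow; [lra|lia]).
  assert (H0 : 0 <= lprod (fun q => INR q ^ Z) (primes_upto X))
    by (apply lprod_nonneg; intros; apply pow_le, pos_INR).
  assert (HzN : 0 < z ^ S N) by (apply pow_lt; lra).
  apply Rle_trans with (z ^ 2 * z ^ S Z * z ^ (Z * Z)).
  - apply Rmult_le_compat; [nra|exact H0| |exact H1].
    apply Rmult_le_compat; [lra|lra|nra|exact H2].
  - rewrite <- !pow_add. apply Rle_trans with (z ^ (Z * Z * Z)).
    + apply Rle_pow; [lra|]. nia.
    + rewrite <- Rpower_pow by lra. unfold Rpower.
      assert (Hle : INR (Z * Z * Z) * ln z <= z ^ 4).
      { rewrite !mult_INR. fold z. pose proof (ln_le_sub1 z ltac:(lra)).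
        replace (z ^ 4) with (z * z * z * z) by ring.
        apply Rmult_le_compat_l; [|lra]. apply Rmult_le_pos; nra. }
      destruct Hle as [H|H]; [left; now apply exp_increasing|right; now rewrite H].
Qed.

(** [n^{-1 / ln X} >= 1 - ln n / ln X] reduces this to [sum_div_estimate], with a loss bounded by
    [sum_ln_div_upper]. *)
Lemma sum_prime_powers_lower (s : nat -> R) (kappa : R) : (forall n, 0 <= s n) -> s 0%nat = 0 ->
  0 < kappa -> mean_value s kappa ->
  exists (K : R) (n1 : nat), forall X, (n1 <= X)%nat ->
    kappa * ln (ln (INR X)) - K
      <= sum_f_R0 (fun n => s n * Rpower (INR n) (- (1 + / ln (INR X)))) X.
Proof.
  intros Hs Hs0 Hk Hm.
  destruct (sum_div_estimate s kappa Hs Hk Hm) as [K1 [m1 H1]].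
  destruct (sum_ln_div_upper s kappa Hs Hm) as [K2 [m2 H2]].
  exists (K1 + K2), (max 3 (max m1 m2)). intros X HX.
  specialize (H1 X ltac:(lia)). specialize (H2 X ltac:(lia)).
  apply Rabs_le_between in H1.
  assert (Hx : 3 <= INR X) by (apply INR_ge_3; lia).
  assert (Hl : 1 <= ln (INR X)) by (apply ln_ge_1; lra).
  assert (H : sum_f_R0 (fun i => s i / INR i) X
     - / ln (INR X) * sum_f_R0 (fun i => s i * ln (INR i) / INR i) X
     <= sum_f_R0 (fun n => s n * Rpower (INR n) (- (1 + / ln (INR X)))) X).
  { rewrite scal_sum, <- minus_sum. apply sum_Rle. intros n _.
    destruct n as [|n]; [rewrite Hs0; unfold Rdiv; lra|].
    assert (1 <= INR (S n)) by (apply (le_INR 1); lia).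
    replace (- (1 + / ln (INR X))) with (Ropp 1 + - / ln (INR X)) by ring.
    rewrite Rpower_plus, (Rpower_Ropp _ 1), Rpower_1 by lra.
    assert (Hexp : 1 - / ln (INR X) * ln (INR (S n)) <= Rpower (INR (S n)) (- / ln (INR X))).
    { unfold Rpower. pose proof (exp_ineq1_le (- / ln (INR X) * ln (INR (S n)))). lra. }
    assert (0 <= s (S n) / INR (S n)) by (apply Rdiv_le_0_compat; [apply Hs|lra]).
    replace (s (S n) / INR (S n) - s (S n) * ln (INR (S n)) / INR (S n) * / ln (INR X))
      with (s (S n) / INR (S n) * (1 - / ln (INR X) * ln (INR (S n)))) by (field; lra).
    replace (s (S n) * (/ INR (S n) * Rpower (INR (S n)) (- / ln (INR X))))
      with (s (S n) / INR (S n) * Rpower (INR (S n)) (- / ln (INR X))) by (field; lra).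
    now apply Rmult_le_compat_l. }
  assert (/ ln (INR X) * sum_f_R0 (fun i => s i * ln (INR i) / INR i) X <= K2).
  { apply Rmult_le_reg_l with (ln (INR X)); [lra|]. rewrite <- Rmult_assoc, Rinv_r by lra. lra. }
  lra.
Qed.

Lemma prime_series_cv_mean (b : nat -> C) (kappa sigma : R) : mean_value (prime_abs b) kappa ->
  1 < sigma <= 2 -> prime_series_cv b sigma.
Proof.
  intros Hm Hsig.
  destruct (tail_sum_upper _ _ (prime_abs_nonneg b) Hm) as [K [n1 [Hn1 [HK H]]]].
  set (f := fun i => prime_abs b i * Rpower (INR i) (- sigma)) in *.
  assert (Hf : forall n, 0 <= f n)
    by (intros n; apply Rmult_le_pos; [apply prime_abs_nonneg|left; apply exp_pos]).
  apply ex_series_nonneg_bounded with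
    (sum_f_R0 f n1 + K / ((sigma - 1) * ln (INR n1))); [exact Hf|].
  intros n. apply Rle_trans with (sum_f_R0 f (max n n1)).
  - assert (Hmono : forall m, (n <= m)%nat -> sum_f_R0 f n <= sum_f_R0 f m).
    { intros m Hmn. induction Hmn as [|m Hmn IH]; [lra|]. rewrite tech5. specialize (Hf (S m)). lra. }
    apply Hmono. lia.
  - specialize (H sigma n1 (max n n1) Hsig ltac:(lia)). fold f in H. lra.
Qed.

Lemma C_pair (x y : R) : (RtoC x + Ci * RtoC y)%C = (x, y).
Proof. unfold Cplus, Cmult, Ci, RtoC; simpl. f_equal; ring. Qed.

(** Gives the phase that [ln p * t] has to match: the argument of [b p] minus [theta]. *)
Lemma prime_term_rotated (b : nat -> C) (theta sigma t : R) (alpha : C -> R) (n : nat) :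
  (forall z, Re z = Cmod z * cos (alpha z) /\ Im z = Cmod z * sin (alpha z)) ->
  Re (Cexp (- (Ci * RtoC theta)) * prime_term b (sigma, t) n)%C
  = prime_abs b n * Rpower (INR n) (- sigma)
    * cos (ln (INR n) * t - (alpha (b n) - theta)).
Proof.
  intros Ha. unfold prime_term, prime_abs. destruct (nprime_dec n) as [_|_].
  - destruct (Ha (b n)) as [HR HI].
    set (r := Cmod (b n)) in *. set (al := alpha (b n)) in *.
    replace (b n) with (r * cos al, r * sin al)
      by (rewrite <- HR, <- HI; symmetry; apply surjective_pairing).
    unfold ncpow, rcpow, Cexp, Cmult, Copp, Ci, RtoC, Re, Im; simpl.
    replace (- (0 * theta - 1 * 0)) with 0 by ring. rewrite exp_0.
    replace (- (0 * 0 + 1 * theta)) with (- theta) by ring.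
    replace (- sigma * ln (INR n) - - t * 0) with (- sigma * ln (INR n)) by ring.
    replace (- sigma * 0 + - t * ln (INR n)) with (- (ln (INR n) * t)) by ring.
    rewrite !cos_neg, !sin_neg. unfold Rpower.
    replace (ln (INR n) * t - (al - theta)) with (ln (INR n) * t + (theta - al)) by ring.
    rewrite (cos_plus (ln (INR n) * t)), cos_minus, sin_minus. ring.
  - rewrite Cmult_0_r. simpl. ring.
Qed.

Lemma prime_abs_0 b : prime_abs b 0 = 0.
Proof.
  unfold prime_abs. destruct (nprime_dec 0) as [H|]; [|reflexivity].
  apply nprime_ge_2 in H. lia.
Qed.

(** The distance of [sigma] from 1 is recorded for the line [Re s = 1]: the point has to lie in a
    rectangle of side of order [1 / ln ln T]. *)
Lemma large_values (b : nat -> C) (delta M kappa theta Mb : R) : 0 < kappa ->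
  euler_bound b delta M -> mean_value (prime_abs b) kappa ->
  (forall n, prime_abs b n <= Mb * INR n) ->
  exists K T0 : R, forall T, T0 <= T -> exists sigma t,
    1 < sigma <= 2 /\ sigma - 1 <= 16 / ln (ln T) /\ T <= t <= 2 * T /\
    kappa * ln (ln (ln T)) - K <= Re (Cexp (- (Ci * RtoC theta)) * log_L b (sigma, t))%C.
Proof.
  intros Hk Hb Hm HMb.
  destruct (sum_prime_powers_lower _ _ (prime_abs_nonneg b) (prime_abs_0 b) Hk Hm) as [K1 [m1 H1]].
  destruct (tail_sum_upper _ _ (prime_abs_nonneg b) Hm) as [K2 [m2 [Hm2 [HK2 H2]]]].
  destruct (functional_choice _ polar_form) as [alpha Halpha].
  set (n1 := max 3 (max m1 m2)).
  exists (kappa * ln 16 + K1 + (4 * Mb + 1) + K2 + Series (euler_rem delta M)),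
    (exp (exp (8 * (INR n1 + 4)))).
  intros T HT.
  assert (Hn1 : 3 <= INR n1) by (apply INR_ge_3; lia).
  assert (HT0 : 0 < T) by (eapply Rlt_le_trans; [apply exp_pos|exact HT]).
  assert (HlT : exp (8 * (INR n1 + 4)) <= ln T).
  { rewrite <- (ln_exp (exp _)). apply ln_le; [apply exp_pos|exact HT]. }
  assert (HlT0 : 0 < ln T) by (eapply Rlt_le_trans; [apply exp_pos|exact HlT]).
  assert (HllT : 8 * (INR n1 + 4) <= ln (ln T)).
  { rewrite <- (ln_exp (8 * _)). apply ln_le; [apply exp_pos|exact HlT]. }
  set (Lam := ln (ln T)) in *.
  (* [y = (ln T)^{1/8}] and [X] is its floor: [(X + 1)^4 <= y^8 = ln T] is what
     [kronecker_size_bound] asks for, and [y <= X^2] gives [ln X >= ln ln T / 16]. *)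
  set (y := exp (Lam / 8)).
  assert (Hy : INR n1 + 5 <= y).
  { unfold y. pose proof (exp_ineq1_le (Lam / 8)). lra. }
  destruct (nfloor_ex y ltac:(lra)) as [X HX].
  assert (HXn : (n1 <= X)%nat) by (apply INR_le; lra).
  assert (Hx : 3 <= INR X) by lra.
  assert (Hl1 : 1 <= ln (INR X)) by (apply ln_ge_1; lra).
  assert (HlX : Lam / 16 <= ln (INR X)).
  { assert (Hyy : ln y <= ln (INR X * INR X)) by (apply ln_le; nra).
    unfold y in Hyy. rewrite ln_exp, ln_mult in Hyy by lra. lra. }
  assert (HLam : 0 < Lam) by lra.
  set (sigma := 1 + / ln (INR X)).
  assert (Hi : 0 < / ln (INR X) <= 1).
  { split; [apply Rinv_0_lt_compat; lra|]. rewrite <- Rinv_1. apply Rinv_le_contravar; lra. }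
  assert (Hsig : 1 < sigma <= 2) by (unfold sigma; lra).
  assert (HXT : exp (INR (S X) ^ 4) <= T).
  { rewrite <- (exp_ln T) by exact HT0.
    assert (H4 : INR (S X) ^ 4 <= ln T).
    { apply Rle_trans with ((y ^ 2) ^ 4).
      - apply pow_incr. rewrite S_INR. split; [lra|]. nra.
      - right. rewrite <- pow_mult. change (2 * 4)%nat with 8%nat.
        unfold y. rewrite <- Rpower_pow by apply exp_pos. unfold Rpower. rewrite ln_exp.
        replace (INR 8 * (Lam / 8)) with Lam by (simpl; field).
        unfold Lam. apply exp_ln. exact HlT0. }
    destruct H4 as [H4|H4]; [left; now apply exp_increasing|right; now rewrite H4]. }
  set (A := fun n => prime_abs b n * Rpower (INR n) (- sigma)).
  assert (HA : forall n, 0 <= A n)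
    by (intros n; apply Rmult_le_pos; [apply prime_abs_nonneg|left; apply exp_pos]).
  set (beta := fun n => alpha (b n) - theta).
  destruct (kronecker_effective (primes_upto X) X beta A T) as [t [Ht Hcos]].
  { apply INR_le. simpl. lra. }
  { intros q Hq. now apply primes_upto_spec in Hq. }
  { apply primes_upto_NoDup. }
  { exact HA. }
  { apply kronecker_size_bound; [apply INR_le; simpl; lra|exact HXT]. }
  exists sigma, t. split; [exact Hsig|]. split.
  { unfold sigma. replace (1 + / ln (INR X) - 1) with (/ ln (INR X)) by ring.
    replace (16 / Lam) with (/ (Lam / 16)) by (field; lra). apply Rinv_le_contravar; lra. }
  split; [exact Ht|].
  assert (Hnp : forall n, ~ nprime n -> A n = 0).
  { intros n Hn. unfold A, prime_abs. destruct (nprime_dec n); [contradiction|ring]. }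
  rewrite !lsum_primes_upto in Hcos; [|exact Hnp|intros n Hn; rewrite Hnp by exact Hn; ring].
  (* Each [A n] is at most [Mb], as [prime_abs b n <= Mb n] and [sigma > 1]; the gain [1 / (X + 1)]
     from kernels of degree [X] offsets the number of terms. *)
  assert (HSA : 4 * sum_f_R0 A X / INR (S X) <= 4 * Mb).
  { assert (Hs : sum_f_R0 A X <= Mb * INR (S X)).
    { eapply Rle_trans; [apply (sum_Rle A (fun _ => Mb))|].
      - intros n _. unfold A. destruct n as [|n].
        + rewrite prime_abs_0, Rmult_0_l. specialize (HMb 1%nat). pose proof (prime_abs_nonneg b 1). simpl in HMb. lra.
        + assert (1 <= INR (S n)) by (apply (le_INR 1); lia).
          apply Rle_trans with ((Mb * INR (S n)) * / INR (S n)); [|right; field; lra].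
          apply Rmult_le_compat; [apply prime_abs_nonneg|left; apply exp_pos|apply HMb|].
          rewrite <- (Rpower_1 (INR (S n))) at 2 by lra. rewrite <- Rpower_Ropp.
          apply Rpower_le_base; lra.
      - rewrite sum_cte. lra. }
    apply Rle_div_l; [apply lt_0_INR; lia|]. lra. }
  assert (Hmain : kappa * ln (ln (INR X)) - K1 - (4 * Mb + 1)
     <= sum_f_R0 (fun n => Re (Cexp (- (Ci * RtoC theta)) * prime_term b (sigma, t) n)%C) X).
  { specialize (H1 X ltac:(lia)). fold sigma in H1. fold A in H1.
    replace (sum_f_R0 (fun n => Re (Cexp (- (Ci * RtoC theta)) * prime_term b (sigma, t) n)%C) X)
      with (sum_f_R0 A X - sum_f_R0 (fun p => A p * (1 - cos (ln (INR p) * t - beta p))) X); [lra|].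
    rewrite <- minus_sum. apply sum_eq. intros n _. rewrite (prime_term_rotated _ _ _ _ alpha) by exact Halpha.
    unfold A, beta. ring. }
  pose proof (log_L_lower b delta M (sigma, t) (Cexp (- (Ci * RtoC theta))) X K2 Hb
    ltac:(simpl; lra) (prime_series_cv_mean b kappa sigma Hm Hsig)) as HL.
  assert (Hw : Cmod (Cexp (- (Ci * RtoC theta))) = 1).
  { rewrite Cmod_Cexp. unfold Copp, Cmult, Ci, RtoC, Re; simpl.
    replace (- (0 * theta - 1 * 0)) with 0 by ring. apply exp_0. }
  specialize (HL Hw). change (Re (sigma, t)) with sigma in HL.
  assert (Htail : forall N, (X <= N)%nat -> sum_f_R0 A N - sum_f_R0 A X <= K2).
  { intros N HN. eapply Rle_trans; [apply (H2 sigma X N Hsig); lia|]. right.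
    unfold sigma. field. lra. }
  specialize (HL Htail).
  assert (Hll : ln Lam - ln 16 <= ln (ln (INR X))).
  { rewrite <- ln_div by lra. apply ln_le; [lra|exact HlX]. }
  assert (kappa * (ln Lam - ln 16) <= kappa * ln (ln (INR X))) by (apply Rmult_le_compat_l; lra).
  lra.
Qed.

(** Taking [X] near [e^{1 / (Re s - 1)}] keeps the tail bounded and turns [kappa ln ln X] into at
    most [- kappa ln (Re s - 1)]. *)
Lemma L_upper (L : C -> C) (b : nat -> C) (delta M kappa : R) : 0 < kappa ->
  euler_product b L -> euler_bound b delta M -> mean_value (prime_abs b) kappa ->
  exists c eta : R, 0 < c /\ 0 < eta <= 1 /\ forall s, 0 < Re s - 1 <= eta ->
    Cmod (L s) <= c * Rpower (Re s - 1) (- kappa).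
Proof.
  intros Hk He Hb Hm.
  destruct (sum_div_estimate _ _ (prime_abs_nonneg b) Hk Hm) as [K1 [m1 H1]].
  destruct (tail_sum_upper _ _ (prime_abs_nonneg b) Hm) as [K2 [m2 [Hm2 [HK2 H2]]]].
  set (n1 := max 3 (max m1 m2)).
  assert (Hn1 : 3 <= INR n1) by (apply INR_ge_3; lia).
  exists (exp (K1 + 2 * K2 + Series (euler_rem delta M))), (/ INR n1).
  split; [apply exp_pos|].
  split; [split; [apply Rinv_0_lt_compat; lra|rewrite <- Rinv_1; apply Rinv_le_contravar; lra]|].
  intros s Hs. set (d := Re s - 1) in *.
  assert (Hd : INR n1 <= / d).
  { rewrite <- (Rinv_inv (INR n1)). apply Rinv_le_contravar; lra. }
  assert (Hd3 : d <= / 3).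
  { eapply Rle_trans; [apply Hs|]. apply Rinv_le_contravar; lra. }
  pose proof (exp_ineq1_le (/ d)) as Hexp.
  destruct (nfloor_ex (exp (/ d)) ltac:(lra)) as [X HX].
  assert (HXn : (n1 <= X)%nat) by (apply INR_le; lra).
  assert (Hx : 3 <= INR X) by lra.
  assert (Hl1 : 1 <= ln (INR X)) by (apply ln_ge_1; lra).
  assert (Hup : ln (INR X) <= / d).
  { rewrite <- (ln_exp (/ d)). apply ln_le; lra. }
  assert (Hlo : / d <= 2 * ln (INR X)).
  { assert (Hyy : ln (exp (/ d)) <= ln (INR X * INR X)) by (apply ln_le; [apply exp_pos|nra]).
    rewrite ln_exp, ln_mult in Hyy by lra. lra. }
  assert (Hsig : 1 < Re s <= 2) by (unfold d in *; lra).
  pose proof (prime_series_cv_mean b kappa (Re s) Hm Hsig) as Hcv.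
  rewrite (L_eq_Cexp_log_L L b delta M s He Hb ltac:(lra) Hcv), Cmod_Cexp.
  pose proof (log_L_upper b delta M s X (2 * K2) Hb ltac:(lra) Hcv) as HL.
  assert (Htail : forall N, (X <= N)%nat ->
    sum_f_R0 (fun n => prime_abs b n * Rpower (INR n) (- Re s)) N
    - sum_f_R0 (fun n => prime_abs b n * Rpower (INR n) (- Re s)) X <= 2 * K2).
  { intros N HN. eapply Rle_trans; [apply (H2 (Re s) X N Hsig); lia|]. fold d.
    assert (Hdl : 1 <= 2 * (d * ln (INR X))).
    { assert (d * / d <= d * (2 * ln (INR X))) by (apply Rmult_le_compat_l; lra).
      rewrite Rinv_r in H by lra. lra. }
    apply Rle_div_l; [nra|]. nra. }
  specialize (HL Htail).
  assert (Hsum : sum_f_R0 (fun n => prime_abs b n * Rpower (INR n) (- Re s)) X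
     <= sum_f_R0 (fun n => prime_abs b n / INR n) X).
  { apply sum_Rle. intros n _. destruct n as [|n]; [rewrite prime_abs_0; unfold Rdiv; lra|].
    assert (1 <= INR (S n)) by (apply (le_INR 1); lia).
    apply Rmult_le_compat_l; [apply prime_abs_nonneg|].
    rewrite <- (Rpower_1 (INR (S n))) at 2 by lra. rewrite <- Rpower_Ropp.
    apply Rpower_le_base; lra. }
  specialize (H1 X ltac:(lia)). apply Rabs_le_between in H1.
  assert (Hll : ln (ln (INR X)) <= - ln d).
  { rewrite <- ln_Rinv by lra. apply ln_le; lra. }
  assert (kappa * ln (ln (INR X)) <= kappa * - ln d) by (apply Rmult_le_compat_l; lra).
  unfold Rpower. rewrite <- exp_plus.
  assert (Hfin : Re (log_L b s) <= K1 + 2 * K2 + Series (euler_rem delta M) + - kappa * ln d) by lra.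
  destruct Hfin as [Hf|Hf]; [left; now apply exp_increasing|right; now rewrite Hf].
Qed.

(** * Large values on the line [Re s = 1] *)

(** Continuity measured by [Cmod], for which products are easy; [ccont_Cmod_2d] translates it to two
    real variables. *)
Definition ccont (g : C -> C) (z : C) : Prop :=
  forall eps, 0 < eps -> exists d, 0 < d /\ forall w, Cmod w < d -> Cmod (g (z + w) - g z)%C < eps.

Lemma ccont_const c z : ccont (fun _ => c) z.
Proof.
  intros eps He. exists 1. split; [lra|]. intros w _.
  replace (c - c)%C with (RtoC 0) by ring. now rewrite Cmod_0.
Qed.

Lemma ccont_sub c z : ccont (fun s => s - c)%C z.
Proof.
  intros eps He. exists eps. split; [exact He|]. intros w Hw.
  replace (z + w - c - (z - c))%C with w by ring. exact Hw.
Qed.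

Lemma ccont_mul g h z : ccont g z -> ccont h z -> ccont (fun s => g s * h s)%C z.
Proof.
  intros Hg Hh eps He. pose proof (Cmod_ge_0 (g z)). pose proof (Cmod_ge_0 (h z)).
  set (k := Cmod (g z) + Cmod (h z) + 2).
  set (e := Rmin 1 (eps / k)).
  assert (Hek : 0 < eps / k) by (apply Rdiv_lt_0_compat; unfold k; lra).
  assert (He0 : 0 < e) by (apply Rmin_glb_lt; lra).
  assert (He1 : e <= 1) by apply Rmin_l.
  assert (He2 : e * k <= eps).
  { apply Rle_div_r; [unfold k; lra|]. apply Rmin_r. }
  destruct (Hg e He0) as [d1 [Hd1 G1]]. destruct (Hh e He0) as [d2 [Hd2 G2]].
  exists (Rmin d1 d2). split; [apply Rmin_glb_lt; lra|]. intros w Hw.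
  specialize (G1 w ltac:(eapply Rlt_le_trans; [exact Hw|apply Rmin_l])).
  specialize (G2 w ltac:(eapply Rlt_le_trans; [exact Hw|apply Rmin_r])).
  set (dg := (g (z + w) - g z)%C) in *. set (dh := (h (z + w) - h z)%C) in *.
  replace (g (z + w) * h (z + w) - g z * h z)%C with (dg * h z + g z * dh + dg * dh)%C
    by (unfold dg, dh; ring).
  eapply Rle_lt_trans; [apply Cmod_triangle3|]. rewrite !Cmod_mult.
  pose proof (Cmod_ge_0 dg). pose proof (Cmod_ge_0 dh). unfold k in He2. nra.
Qed.

Lemma ccont_pow g z n : ccont g z -> ccont (fun s => g s ^ n)%C z.
Proof.
  intros H. induction n as [|n IH]; cbn [Cpow]; [apply ccont_const|]. now apply ccont_mul.
Qed.

Lemma Cmod_pair_le (p q : R) : Cmod (p, q) <= Rabs p + Rabs q.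
Proof.
  replace (p, q) with (RtoC p + Ci * RtoC q)%C by apply C_pair.
  eapply Rle_trans; [apply Cmod_triangle|]. rewrite Cmod_mult, !Cmod_R.
  replace (Cmod Ci) with 1; [lra|]. unfold Cmod, Ci; simpl.
  replace (0 * (0 * 1) + 1 * (1 * 1)) with 1 by ring. symmetry; apply sqrt_1.
Qed.

Lemma entire_ccont F z : entire F -> ccont F z.
Proof.
  intros HF eps He. specialize (HF z). apply ex_derive_continuous in HF.
  (* Balls in the target are squares, so each component gets half of [eps]. *)
  assert (He2 : 0 < eps / 2) by lra.
  pose proof (proj1 (filterlim_locally F (F z)) HF (mkposreal _ He2)) as [d Hd].
  exists d. split; [apply cond_pos|]. intros w Hw.
  assert (HB : ball (F z) (mkposreal _ He2) (F (z + w)%C)).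
  { apply Hd. change (Cmod ((z + w) - z)%C < d). replace (z + w - z)%C with w by ring. exact Hw. }
  destruct HB as [B1 B2].
  change (Rabs (fst (F (z + w)%C) - fst (F z)) < eps / 2) in B1.
  change (Rabs (snd (F (z + w)%C) - snd (F z)) < eps / 2) in B2.
  rewrite (surjective_pairing (F (z + w) - F z)%C).
  eapply Rle_lt_trans; [apply Cmod_pair_le|].
  change (Rabs (fst (F (z + w)%C) - fst (F z)) + Rabs (snd (F (z + w)%C) - snd (F z)) < eps). lra.
Qed.

Lemma ccont_Cmod_2d G x y : ccont G (x, y) -> continuity_2d_pt (fun x y => Cmod (G (x, y))) x y.
Proof.
  intros HG eps. destruct (HG eps (cond_pos eps)) as [d [Hd H]].
  assert (Hd2 : 0 < d / 2) by lra. exists (mkposreal _ Hd2). simpl. intros u v Hu Hv.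
  specialize (H (u - x, v - y)).
  assert (Hw : Cmod (u - x, v - y) < d) by (eapply Rle_lt_trans; [apply Cmod_pair_le|lra]).
  specialize (H Hw).
  replace (Cplus (x, y) (u - x, v - y)) with ((u, v) : C) in H
    by (unfold Cplus; simpl; f_equal; ring).
  eapply Rle_lt_trans; [|exact H].
  pose proof (Cmod_triangle (G (u, v) - G (x, y)) (G (x, y))) as T1.
  pose proof (Cmod_triangle (G (x, y) - G (u, v)) (G (u, v))) as T2.
  replace (G (u, v) - G (x, y) + G (x, y))%C with (G (u, v)) in T1 by ring.
  replace (G (x, y) - G (u, v) + G (u, v))%C with (G (x, y)) in T2 by ring.
  replace (Cmod (G (x, y) - G (u, v))) with (Cmod (G (u, v) - G (x, y))) in T2
    by (rewrite <- Cmod_opp; f_equal; ring).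
  apply Rabs_le_between. lra.
Qed.

Lemma taylor2_ext g h z r : 0 < r -> (forall w, Cmod w <= r -> g (z + w)%C = h (z + w)%C) ->
  taylor2 g z -> taylor2 h z.
Proof.
  intros Hr E [A [B [c [r' [Hr' [Hc H]]]]]].
  exists A, B, c, (Rmin r r'). split; [apply Rmin_glb_lt; lra|]. split; [exact Hc|]. intros w Hw.
  assert (W1 : Cmod w <= r) by (eapply Rle_trans; [exact Hw|apply Rmin_l]).
  assert (W2 : Cmod w <= r') by (eapply Rle_trans; [exact Hw|apply Rmin_r]).
  pose proof (E 0) as E0. rewrite Cmod_0, Cplus_0_r in E0.
  rewrite <- E, <- E0 by lra. now apply H.
Qed.

(** A value at least [eta] beyond every [T] bounds all the suprema in [LimSup_infty] below by [eta],
    hence also their infimum. *)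
Lemma Omega_intro (f g : R -> R) (eta : R) : 0 < eta ->
  (forall T, exists t, T <= t /\ eta <= Rabs (f t) / g t) -> Omega f g.
Proof.
  intros He H. unfold Omega, LimSup_infty, Rbar_glb.
  destruct (Rbar_ex_glb _) as [l Hglb]. simpl proj1_sig. destruct Hglb as [_ Hl].
  apply Rbar_lt_le_trans with (Finite eta); [exact He|].
  apply Hl. intros m [T ->]. destruct (H T) as [t [Ht Hft]].
  apply Rbar_le_trans with (Finite (Rabs (f t) / g t)); [exact Hft|].
  apply (proj1 (Lub_Rbar_correct (fun y => exists t, T <= t /\ y = Rabs (f t) / g t))).
  exists t. split; [exact Ht|reflexivity].
Qed.

Lemma mean_value_prime_abs (a : nat -> C) (kappa : R) :
  (exists M x0 : R, forall x : R, x0 <= x ->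
     Rabs (prime_abs_sum a x - kappa * (x / ln x)) <= M * (x / (ln x) ^ 2)) ->
  mean_value (prime_abs a) kappa.
Proof.
  intros [M [x0 H]]. destruct (INR_unbounded x0) as [n0 Hn0].
  exists M, n0. intros n Hn. apply le_INR in Hn. specialize (H (INR n) ltac:(lra)).
  unfold prime_abs_sum in H. rewrite Int_part_INR, Nat2Z.id in H. exact H.
Qed.

Lemma mean_value_ext (s s' : nat -> R) (kappa : R) : (forall n, s n = s' n) ->
  mean_value s kappa -> mean_value s' kappa.
Proof.
  intros E [M [n0 H]]. exists M, n0. intros n Hn.
  rewrite <- (sum_eq s s') by (intros; apply E). now apply H.
Qed.

(* The polynomial factor vanishing at the corners [1 + i (t0 +- H)] absorbs the growth of
   [(Re s - 1)^{-kappa}] along the horizontal sides. *)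
Lemma rectangle_bound (L : C -> C) (kappa c Lb H t0 sigma : R) (m k0 : nat) (F : C -> C) :
  0 < kappa <= INR m -> 0 < c -> 0 < H <= 1 -> 5 <= t0 -> 0 < sigma - 1 < H ->
  entire F -> (forall s : C, s <> RtoC 1 -> F s = (Cpow (s - RtoC 1) k0 * L s)%C) ->
  (forall s, 1 < Re s -> taylor2 L s) ->
  (forall s, 0 < Re s - 1 <= H -> Cmod (L s) <= c * Rpower (Re s - 1) (- kappa)) ->
  c * Rpower H (- kappa) <= Lb ->
  (forall y, t0 - 1 <= y <= t0 + 1 -> Cmod (L (1, y)) <= Lb) ->
  Cmod (L (sigma, t0)) <= 2 ^ k0 * 9 ^ m * Lb.
Proof.
  intros Hk Hc HH Ht0 Hsig HF HFL HT2 Hup HLb1 Hline.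
  set (c1 := (1, t0 + H) : C). set (c2 := (1, t0 - H) : C).
  set (h := fun s : C => (((s - c1) * (s - c2)) ^ m)%C).
  set (G := fun s => (F s * h s)%C).
  assert (HLb0 : 0 <= Lb).
  { eapply Rle_trans; [|exact HLb1]. apply Rmult_le_pos; [lra|left; apply exp_pos]. }
  assert (Hne : forall x y, 0 < y -> (x, y) <> RtoC 1).
  { intros x y Hy E. injection E. lra. }
  (* On the boundary [|s - 1| <= 2 t0] and each corner is within [3 H]; at [(sigma, t0)] these
     distances are at least [t0] and [H]. The ratios give [2^{k0}] and [9^m]. *)
  set (Bnd := (2 * t0) ^ k0 * (9 ^ m * (H * H) ^ m * Lb)).
  assert (Hmax : Cmod (G (sigma, t0)) <= Bnd).
  { apply (maximum_principle G 1 (1 + H) (t0 - H) (t0 + H)); try lra.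
    - intros x y. apply ccont_Cmod_2d. unfold G, h.
      apply ccont_mul; [now apply entire_ccont|]. apply ccont_pow, ccont_mul; apply ccont_sub.
    - intros x y Hx Hy. unfold G, h. apply taylor2_mul.
      + apply (taylor2_ext (fun s => Cpow (s - RtoC 1) k0 * L s)%C F _ ((x - 1) / 2)); [lra| |].
        * intros w Hw. symmetry. apply HFL. intros E.
          pose proof (Rabs_Re_le_Cmod w) as Hr. apply Rabs_le_between in Hr.
          apply (f_equal Re) in E. rewrite re_plus in E. simpl in E. unfold Re in *. lra.
        * apply taylor2_mul; [apply taylor2_pow, taylor2_sub|]. apply HT2. simpl. lra.
      + apply taylor2_pow, taylor2_mul; apply taylor2_sub.
    - intros x y Hx Hy Hbd.
      set (z := (x, y) : C).
      assert (Hz1 : Cmod (z - RtoC 1)%C <= 2 * t0).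
      { change (z - RtoC 1)%C with (x - 1, y - 0). eapply Rle_trans; [apply Cmod_pair_le|].
        rewrite !Rabs_pos_eq by lra. lra. }
      set (P := Cmod (z - c1)%C * Cmod (z - c2)%C).
      assert (Hz : forall q, Rabs (y - q) <= 2 * H -> Cmod (x - 1, y - q) <= 3 * H).
      { intros q Hq. eapply Rle_trans; [apply Cmod_pair_le|]. rewrite (Rabs_pos_eq (x - 1)) by lra. lra. }
      assert (Z1 : Cmod (z - c1)%C <= 3 * H) by (apply (Hz (t0 + H)); apply Rabs_le; lra).
      assert (Z2 : Cmod (z - c2)%C <= 3 * H) by (apply (Hz (t0 - H)); apply Rabs_le; lra).
      pose proof (Cmod_ge_0 (z - c1)%C) as N1. pose proof (Cmod_ge_0 (z - c2)%C) as N2.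
      pose proof (Cmod_ge_0 (L z)) as NL.
      assert (HP0 : 0 <= P) by (unfold P; nra).
      assert (HGz : Cmod (G z) = Cmod (z - RtoC 1)%C ^ k0 * (P ^ m * Cmod (L z))).
      { unfold G, h. rewrite HFL by (apply Hne; lra).
        rewrite !Cmod_mult, !Cmod_pow, Cmod_mult. fold P. ring. }
      fold z. rewrite HGz. unfold Bnd.
      apply Rmult_le_compat; [apply pow_le, Cmod_ge_0|apply Rmult_le_pos; [now apply pow_le|exact NL]
        |apply pow_incr; split; [apply Cmod_ge_0|exact Hz1]|].
      (* On the left side, corners included, [Hup] says nothing and [Hline] takes over. *)
      destruct (Req_dec x 1) as [Hx1|Hx1].
      + apply Rmult_le_compat; [now apply pow_le|exact NL| |].
        * rewrite <- Rpow_mult_distr. apply pow_incr. split; [exact HP0|]. unfold P. nra.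
        * unfold z. rewrite Hx1. apply Hline. lra.
      + set (u := x - 1). assert (Hu : 0 < u <= H) by (unfold u; lra).
        (* On a horizontal side one corner is within [u] and the other within [3 H]; on the right
           side [u = H]. *)
        assert (HPu : P <= 9 * (H * u)).
        { assert (Hedge : forall q, y = q -> Cmod (x - 1, y - q) <= u).
          { intros q Hq. eapply Rle_trans; [apply Cmod_pair_le|].
            rewrite Hq, Rminus_diag, Rabs_R0, Rabs_pos_eq by (fold u; lra). fold u; lra. }
          unfold P. destruct Hbd as [E|[E|[E|E]]]; [lra| | |].
          - assert (u = H) by (unfold u; lra). subst u. nra.
          - assert (Cmod (z - c2)%C <= u) by (apply (Hedge (t0 - H)); lra). nra.
          - assert (Cmod (z - c1)%C <= u) by (apply (Hedge (t0 + H)); lra). nra. }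
        specialize (Hup z Hu). change (Re z - 1) with u in Hup.
        apply Rle_trans with ((9 * (H * u)) ^ m * (c * Rpower u (- kappa))).
        * apply Rmult_le_compat; [now apply pow_le|exact NL| |exact Hup]. apply pow_incr. lra.
        * rewrite !Rpow_mult_distr.
          (* [u^{m - kappa}] is nondecreasing as [m >= kappa]: the zero at the corner beats the
             growth of [L]. *)
          assert (Hpw : u ^ m * Rpower u (- kappa) <= H ^ m * Rpower H (- kappa)).
          { rewrite <- !Rpower_pow, <- !Rpower_plus by lra. apply Rle_Rpower_l; lra. }
          replace (9 ^ m * (H ^ m * u ^ m) * (c * Rpower u (- kappa)))
            with (9 ^ m * H ^ m * c * (u ^ m * Rpower u (- kappa))) by ring.
          assert (H9 : 0 < 9 ^ m * H ^ m) by (apply Rmult_lt_0_compat; apply pow_lt; lra).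
          apply Rle_trans with (9 ^ m * H ^ m * c * (H ^ m * Rpower H (- kappa))).
          -- apply Rmult_le_compat_l; [nra|exact Hpw].
          -- replace (9 ^ m * H ^ m * c * (H ^ m * Rpower H (- kappa)))
               with (9 ^ m * (H ^ m * H ^ m) * (c * Rpower H (- kappa))) by ring.
             apply Rmult_le_compat_l; [|exact HLb1].
             apply Rmult_le_pos; [apply pow_le; lra|]. apply Rmult_le_pos; apply pow_le; lra. }
  set (z := (sigma, t0) : C) in *.
  assert (Hq : forall q, Rabs q <= Cmod (sigma - 1, q)) by (intros q; apply (Rabs_Im_le_Cmod (sigma - 1, q))).
  assert (Z1 : H <= Cmod (z - c1)%C).
  { change (z - c1)%C with (sigma - 1, t0 - (t0 + H)). eapply Rle_trans; [|apply Hq].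
    replace (t0 - (t0 + H)) with (- H) by ring. rewrite Rabs_Ropp. apply Rle_abs. }
  assert (Z2 : H <= Cmod (z - c2)%C).
  { change (z - c2)%C with (sigma - 1, t0 - (t0 - H)). eapply Rle_trans; [|apply Hq].
    replace (t0 - (t0 - H)) with H by ring. apply Rle_abs. }
  assert (Z3 : t0 <= Cmod (z - RtoC 1)%C).
  { change (z - RtoC 1)%C with (sigma - 1, t0 - 0). eapply Rle_trans; [|apply Hq].
    rewrite Rminus_0_r. apply Rle_abs. }
  assert (HGz : t0 ^ k0 * ((H * H) ^ m * Cmod (L z)) <= Cmod (G z)).
  { unfold G, h. rewrite HFL by (apply Hne; lra).
    rewrite !Cmod_mult, !Cmod_pow, Cmod_mult.
    replace (Cmod (z - RtoC 1)%C ^ k0 * Cmod (L z) * (Cmod (z - c1)%C * Cmod (z - c2)%C) ^ m)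
      with (Cmod (z - RtoC 1)%C ^ k0 * ((Cmod (z - c1)%C * Cmod (z - c2)%C) ^ m * Cmod (L z))) by ring.
    pose proof (Cmod_ge_0 (L z)).
    assert (0 <= (H * H) ^ m) by (apply pow_le; nra).
    apply Rmult_le_compat; [apply pow_le; lra|nra|apply pow_incr; lra|].
    apply Rmult_le_compat_r; [assumption|]. apply pow_incr. split; nra. }
  assert (Hpos : 0 < t0 ^ k0 * (H * H) ^ m) by (apply Rmult_lt_0_compat; apply pow_lt; nra).
  apply Rmult_le_reg_l with (t0 ^ k0 * (H * H) ^ m); [exact Hpos|].
  replace (t0 ^ k0 * (H * H) ^ m * (2 ^ k0 * 9 ^ m * Lb)) with Bnd
    by (unfold Bnd; rewrite !Rpow_mult_distr; ring).
  lra.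
Qed.

Lemma Omega_line (L : C -> C) (a b : nat -> C) (delta M kappa Mb : R) : 0 < kappa ->
  dirichlet_series a L -> ramanujan_bound a -> analytic_continuation L ->
  euler_product b L -> euler_bound b delta M -> mean_value (prime_abs b) kappa ->
  (forall n, prime_abs b n <= Mb * INR n) ->
  Omega (fun t => Cmod (L (RtoC 1 + Ci * RtoC t)%C)) (fun t => Rpower (ln (ln t)) kappa).
Proof.
  intros Hk HD Ha [k0 [F [HF [_ HFL]]]] He Hb Hm HMb.
  destruct (large_values b delta M kappa 0 Mb Hk Hb Hm HMb) as [K [T0 Hlarge]].
  destruct (L_upper L b delta M kappa Hk He Hb Hm) as [c [eta [Hc [Heta Hup]]]].
  destruct (INR_unbounded kappa) as [m Hm'].
  set (c0 := exp (- K)). assert (Hc0 : 0 < c0) by apply exp_pos.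
  set (Q0 := 2 ^ k0 * 9 ^ m).
  assert (HQ0 : 0 < Q0) by (apply Rmult_lt_0_compat; apply pow_lt; lra).
  set (q := 4 * c * Q0 / c0).
  assert (Hq : 0 < q) by (apply Rdiv_lt_0_compat; [nra|lra]).
  (* [A > 16] puts the point of [large_values] inside the rectangle of side [A / ln ln T];
     [A^kappa >= q] makes [c H^{-kappa}] at most [Lb]. *)
  set (A := 17 + Rpower q (/ kappa)).
  assert (HA : 17 < A) by (unfold A; assert (0 < Rpower q (/ kappa)) by apply exp_pos; lra).
  assert (HAk : q <= Rpower A kappa).
  { rewrite <- (Rpower_1 q) at 1 by lra. replace 1 with (/ kappa * kappa) by (field; lra).
    rewrite <- Rpower_mult. apply Rle_Rpower_l; [lra|]. split; [apply exp_pos|]. unfold A. lra. }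
  (* [2^kappa] allows for [ln ln y <= 2 ln ln T] along the left side; [4 Q0] brings the final bound
     down to a quarter of the value found by [large_values]. *)
  set (eps := c0 / (4 * Q0 * Rpower 2 kappa)).
  assert (H2k : 0 < Rpower 2 kappa) by apply exp_pos.
  assert (Heps : 0 < eps) by (apply Rdiv_lt_0_compat; [lra|]; apply Rmult_lt_0_compat; lra).
  apply (Omega_intro _ _ eps Heps). intros T1.
  apply Classical_Prop.NNPP. intros Hno.
  assert (Hline : forall t, T1 <= t ->
    Cmod (L (1, t)) <= eps * Rpower (ln (ln t)) kappa).
  { intros t Ht. apply Rnot_lt_le. intros Hlt. apply Hno. exists t. split; [exact Ht|].
    cbv beta. rewrite C_pair, Rabs_pos_eq by apply Cmod_ge_0.
    assert (0 < Rpower (ln (ln t)) kappa) by apply exp_pos.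
    apply (Rle_div_r eps (Cmod (L (1, t)))); lra. }
  (* [ln ln T >= V] keeps the side [A / ln ln T] below [eta], within the range of [L_upper]. *)
  set (V := A / eta + 2).
  assert (HV : A + 2 <= V).
  { unfold V. assert (A <= A / eta); [|lra].
    apply Rmult_le_reg_r with eta; [lra|]. replace (A / eta * eta) with A by (field; lra).
    assert (0 <= A * (1 - eta)) by (apply Rmult_le_pos; lra). lra. }
  set (T := Rmax (exp (exp V)) (Rmax T0 (T1 + 1))).
  assert (HTV : exp (exp V) <= T) by apply Rmax_l.
  assert (HT0 : T0 <= T) by (eapply Rle_trans; [apply Rmax_l|apply Rmax_r]).
  assert (HT1 : T1 + 1 <= T) by (eapply Rle_trans; [apply Rmax_r|apply Rmax_r]).
  pose proof (exp_ineq1_le V) as E1. pose proof (exp_ineq1_le (exp V)) as E2.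
  assert (HlT : exp V <= ln T).
  { rewrite <- (ln_exp (exp V)). apply ln_le; [apply exp_pos|exact HTV]. }
  set (Lam := ln (ln T)).
  assert (HLam : V <= Lam).
  { unfold Lam. rewrite <- (ln_exp V). apply ln_le; [apply exp_pos|exact HlT]. }
  destruct (Hlarge T HT0) as [sigma [t0 [Hsig [Hsig' [Ht0 HRe]]]]]. fold Lam in Hsig', HRe.
  set (H := A / Lam).
  assert (HH : 0 < H <= eta).
  { unfold H. split; [apply Rdiv_lt_0_compat; lra|]. apply Rle_div_l; [lra|].
    assert (A = eta * (A / eta)) by (field; lra).
    assert (eta * (A / eta) <= eta * Lam) by (apply Rmult_le_compat_l; unfold V in HLam; lra). lra. }
  set (Lk := Rpower Lam kappa). assert (HLk : 0 < Lk) by apply exp_pos.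
  set (Lb := c0 / (4 * Q0) * Lk).
  assert (HsH : sigma - 1 < H).
  { eapply Rle_lt_trans; [exact Hsig'|]. unfold H. apply Rmult_lt_compat_r; [apply Rinv_0_lt_compat; lra|lra]. }
  assert (Hbound : Cmod (L (sigma, t0)) <= 2 ^ k0 * 9 ^ m * Lb).
  { apply (rectangle_bound L kappa c Lb H t0 sigma m k0 F); auto; try lra.
    - intros s Hs. now apply (dirichlet_taylor2 L a).
    - intros s Hs. apply Hup. lra.
    - unfold H, Lb. replace (Rpower (A / Lam) (- kappa)) with (/ Rpower A kappa * Lk).
      + assert (HAi : / Rpower A kappa <= / q) by (apply Rinv_le_contravar; lra).
        assert (Eq : c * / q = c0 / (4 * Q0)) by (unfold q; field; lra).
        rewrite <- Rmult_assoc, <- Eq. apply Rmult_le_compat_r; [lra|]. apply Rmult_le_compat_l; lra.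
      + rewrite <- Rpower_Ropp. unfold Lk, Rpower. rewrite ln_div, <- exp_plus by lra. f_equal. ring.
    - intros y Hy. eapply Rle_trans; [apply Hline; lra|].
      assert (Hy4 : 4 < y) by lra.
      assert (Hly : 1 < ln y).
      { rewrite <- (ln_exp 1). apply ln_increasing; [apply exp_pos|]. pose proof exp_le_3; lra. }
      assert (Hyy : ln y <= 2 * ln T).
      { replace (2 * ln T) with (ln (T * T)) by (rewrite ln_mult by lra; ring). apply ln_le; [lra|nra]. }
      assert (Hlly : ln (ln y) <= 2 * Lam).
      { apply Rle_trans with (ln (2 * ln T)); [apply ln_le; lra|]. rewrite ln_mult by lra.
        fold Lam. pose proof (ln_le_sub1 2 ltac:(lra)). lra. }
      assert (Hlly0 : 0 < ln (ln y)) by (rewrite <- ln_1; apply ln_increasing; lra).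
      apply Rle_trans with (eps * Rpower (2 * Lam) kappa).
      + apply Rmult_le_compat_l; [lra|]. apply Rle_Rpower_l; lra.
      + rewrite <- Rpower_mult_distr by lra. fold Lk. right. unfold eps, Lb. field. lra. }
  assert (Hlow : c0 * Lk <= Cmod (L (sigma, t0))).
  { rewrite (L_eq_Cexp_log_L L b delta M (sigma, t0) He Hb ltac:(simpl; lra)
      (prime_series_cv_mean b kappa sigma Hm Hsig)), Cmod_Cexp.
    replace (Cexp (- (Ci * RtoC 0))) with (RtoC 1) in HRe.
    2:{ replace (- (Ci * RtoC 0))%C with (RtoC 0) by ring. symmetry. apply Cexp_0. }
    rewrite Cmult_1_l in HRe. unfold c0, Lk, Rpower. rewrite <- exp_plus.
    assert (Hle : - K + kappa * ln Lam <= Re (log_L b (sigma, t0))) by lra.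
    destruct Hle as [Hle|Hle]; [left; now apply exp_increasing|right; now rewrite Hle]. }
  fold Q0 in Hbound.
  assert (Q0 * Lb = c0 * Lk / 4) by (unfold Lb; field; lra).
  assert (0 < c0 * Lk) by nra. lra.
Qed.

Theorem theorem3 (L : C -> C) (a b : nat -> C) (kappa : R)
    (HL : selberg_class L a b)
    (Hkappa : 0 < kappa)
    (Hmean : exists M x0 : R, forall x : R, x0 <= x ->
       Rabs (prime_abs_sum a x - kappa * (x / ln x)) <= M * (x / (ln x) ^ 2)) :
  (forall theta : R, exists K T0 : R, forall T : R, T0 <= T ->
     exists sigma t : R, 1 < sigma /\ T <= t <= 2 * T /\
       Re (Cexp (- (Ci * RtoC theta)) * log_L b (RtoC sigma + Ci * RtoC t))%C
         >= kappa * ln (ln (ln T)) - K) /\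
  Omega (fun t => Cmod (L (RtoC 1 + Ci * RtoC t)%C)) (fun t => Rpower (ln (ln t)) kappa).
Proof.
  destruct HL as [HD Ha Hcont _ He].
  destruct (proj2 He) as [delta [M Hb]].
  assert (Hab : forall n, prime_abs a n = prime_abs b n).
  { intros n. unfold prime_abs. destruct (nprime_dec n) as [Hp|]; [|reflexivity].
    rewrite (coefficients_agree L a b delta M n HD Ha He Hb Hp). reflexivity. }
  assert (Hm : mean_value (prime_abs b) kappa).
  { apply (mean_value_ext (prime_abs a)); [exact Hab|]. now apply mean_value_prime_abs. }
  (* The exponent 1 in [ramanujan_bound] already gives the linear bound on [prime_abs b] that
     [large_values] expects. *)
  destruct (Ha 1 ltac:(lra)) as [Ma HMa].
  assert (HMb : forall n, prime_abs b n <= Rabs Ma * INR n).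
  { intros n. rewrite <- Hab. unfold prime_abs. destruct (nprime_dec n) as [Hp|].
    - apply nprime_ge_2 in Hp. specialize (HMa n ltac:(lia)).
      rewrite Rpower_1 in HMa by (apply lt_0_INR; lia).
      eapply Rle_trans; [exact HMa|]. apply Rmult_le_compat_r; [apply pos_INR|apply Rle_abs].
    - apply Rmult_le_pos; [apply Rabs_pos|apply pos_INR]. }
  split.
  - intros theta.
    destruct (large_values b delta M kappa theta (Rabs Ma) Hkappa Hb Hm HMb) as [K [T0 H]].
    exists K, T0. intros T HT. destruct (H T HT) as [sigma [t [Hs [_ [Ht HRe]]]]].
    exists sigma, t. split; [lra|]. split; [exact Ht|]. rewrite C_pair. lra.
  - now apply (Omega_line L a b delta M kappa (Rabs Ma)).
Qed.
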